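(* The Landau--Ginzburg model $\mathrm{LG}(2)$ has no projective mirrors; that is, there is no projective variety $Y$ over $\mathbb C$ such that the bounded derived category $D^b(\operatorname{Coh}Y)$ of coherent sheaves on $Y$ is equivalent to the Fukaya--Seidel category of $\mathrm{LG}(2)$.
   Context: $\mathrm{LG}(2)=(X,f_H)$, where $X=\{x^2+yz=1\}\subset\mathbb C^3$ is the adjoint orbit of $H_0=\operatorname{diag}(1,-1)$ in $\mathfrak{sl}(2,\mathbb C)$ (matrices $A=\begin{pmatrix}x&y\\ z&-x\end{pmatrix}$), with symplectic form $\Omega$ the restriction of the imaginary part of the Hermitian form $\operatorname{tr}(AB^* )$ (up to a positive constant), and $f_H(A)=\operatorname{tr}(H_0A)=2x$, a symplectic Lefschetz fibration with two critical values $\pm2$. The Fukaya--Seidel category of $\mathrm{LG}(2)$ is the directed $A_\infty$-category of vanishing cycles, taken with regular value $0$ and the segments from $0$ to $\mp2$ as paths. It has two objects $L_0,L_1$ (the thimbles over the segments $[-2,0]$ and $[0,2]$, or their vanishing cycles in the fibre $f_H^{-1}(0)\cong\mathbb C^*$, both equal to the circle $\{(0,e^{it},e^{-it})\}$), with $\operatorname{Hom}(L_0,L_1)$ the Lagrangian Floer complex in $f_H^{-1}(0)$, $\operatorname{Hom}(L_i,L_i)$ generated by a strict unit and $\operatorname{Hom}(L_1,L_0)=0$. Explicitly, $\operatorname{Hom}(L_0,L_1)$ is free of rank one in each of the degrees $0$ and $1$ and zero in other degrees, and all products $m_k$ vanish except $m_2(\,\cdot\,,\mathrm{id})$ and $m_2(\mathrm{id},\,\cdot\,)$.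 In comparing with coherent sheaves, coefficients are taken in $\mathbb C$, and ''equivalent to the Fukaya--Seidel category'' means equivalent, as a triangulated category, to the triangulated category generated by this $A_\infty$-category. Thus a mirror $Y$ would have $D^b(\operatorname{Coh}Y)$ generated by two objects $\mathcal F_0,\mathcal F_1$ with graded morphism spaces $\operatorname{Hom}(\mathcal F_i,\mathcal F_j)\simeq\mathbb C\oplus\mathbb C[-1]$ for $i<j$, $\mathbb C$ for $i=j$, and $0$ for $i>j$. *)

(* Defs.v *)
From HB Require Import structures.
From mathcomp Require Import all_boot all_order all_algebra.
From mathcomp Require Import boolp classical_sets functions reals.
From mathcomp Require Import complex mpoly ring.

Set Implicit Arguments.
Unset Strict Implicit.
Unset Printing Implicit Defensive.

Import Order.TTheory GRing.Theory Num.Theory.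
Local Open Scope classical_set_scope.
Local Open Scope ring_scope.

(** * Categories with shift and triangles

   Hom-sets are setoids: [heq] is the equality of morphisms.  This lets
   localizations and homotopy categories be presented without quotient types. *)

Record category := Category {
  ob :> Type;
  hom : ob -> ob -> Type;
  heq : forall X Y, hom X Y -> hom X Y -> Prop;
  idm : forall X, hom X X;
  comp : forall X Y Z, hom Y Z -> hom X Y -> hom X Z;
  heq_refl : forall X Y (f : hom X Y), heq f f;
  heq_sym : forall X Y (f g : hom X Y), heq f g -> heq g f;
  heq_trans : forall X Y (f g h : hom X Y), heq f g -> heq g h -> heq f h;
  comp_heq : forall X Y Z (g g' : hom Y Z) (f f' : hom X Y),
    heq g g' -> heq f f' -> heq (comp g f) (comp g' f');
  compA : forall X Y Z T (h : hom Z T) (g : hom Y Z) (f : hom X Y),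
    heq (comp h (comp g f)) (comp (comp h g) f);
  comp1m : forall X Y (f : hom X Y), heq (comp (idm Y) f) f;
  compm1 : forall X Y (f : hom X Y), heq (comp f (idm X)) f
}.
Arguments idm {c}.

Record shift_category := ShiftCategory {
  scat :> category;
  sh : scat -> scat;
  shm : forall X Y : scat, hom X Y -> hom (sh X) (sh Y);
  shm_heq : forall (X Y : scat) (f g : hom X Y),
    heq f g -> heq (shm f) (shm g);
  shm_id : forall X : scat, heq (shm (idm X)) (idm (sh X));
  shm_comp : forall (X Y Z : scat) (g : hom Y Z) (f : hom X Y),
    heq (shm (comp g f)) (comp (shm g) (shm f))
}.

(* [std f g h] : X -> Y -> Z -> X[1] is a standard (mapping cone) triangle; the
   distinguished triangles are those isomorphic to a standard one.  The axioms of
   triangulated categories are not part of the record: an exact equivalence only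
   refers to the shift and to the distinguished triangles. *)
Record tri_category := TriCategory {
  tcat :> shift_category;
  std : forall X Y Z : tcat, hom X Y -> hom Y Z -> hom Z (sh X) -> Prop
}.

Definition isom (C : category) (X Y : C) (f : hom X Y) : Prop :=
  exists g : hom Y X, heq (comp g f) (idm X) /\ heq (comp f g) (idm Y).

Definition distinguished (T : tri_category) (X Y Z : T)
    (f : hom X Y) (g : hom Y Z) (h : hom Z (sh X)) : Prop :=
  exists (X' Y' Z' : T) (f' : hom X' Y') (g' : hom Y' Z') (h' : hom Z' (sh X'))
         (a : hom X X') (b : hom Y Y') (c : hom Z Z'),
    [/\ std f' g' h',
        [/\ isom a, isom b & isom c],
        heq (comp b f) (comp f' a),
        heq (comp c g) (comp g' b) &
        heq (comp (shm a) h) (comp h' c)].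

(* Equivalence of triangulated categories.  Additivity need not be required:
   an equivalence of categories preserves finite biproducts, hence the addition
   of morphisms. *)
Record exact_equivalence (T T' : tri_category) := ExactEquivalence {
  fob : T -> T';
  fmap : forall X Y : T, hom X Y -> hom (fob X) (fob Y);
  fmap_heq : forall (X Y : T) (f g : hom X Y),
    heq f g -> heq (fmap f) (fmap g);
  fmap_id : forall X : T, heq (fmap (idm X)) (idm (fob X));
  fmap_comp : forall (X Y Z : T) (g : hom Y Z) (f : hom X Y),
    heq (fmap (comp g f)) (comp (fmap g) (fmap f));
  fmap_faithful : forall (X Y : T) (f g : hom X Y),
    heq (fmap f) (fmap g) -> heq f g;
  fmap_full : forall (X Y : T) (g : hom (fob X) (fob Y)),
    exists f : hom X Y, heq (fmap f) g;
  fob_ess_surj : forall Y : T', exists (X : T) (a : hom (fob X) Y), isom a;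
  feta : forall X : T, hom (fob (sh X)) (sh (fob X));
  feta_isom : forall X : T, isom (feta X);
  feta_nat : forall (X Y : T) (f : hom X Y),
    heq (comp (feta Y) (fmap (shm f))) (comp (shm (fmap f)) (feta X));
  fmap_distinguished : forall (X Y Z : T)
      (f : hom X Y) (g : hom Y Z) (h : hom Z (sh X)),
    distinguished f g h ->
    distinguished (fmap f) (fmap g) (comp (feta X) (fmap h))
}.

Definition triangulated_equivalent (T T' : tri_category) : Prop :=
  inhabited (exact_equivalence T T').

(** * Localization

   C[W^-1] following Gabriel and Zisman: morphisms are finite zigzags of
   morphisms of C and formal inverses of morphisms of W, modulo the congruence
   generated by functoriality of C -> C[W^-1] and by the inverse relations. *)

Section Localization.
Variables (C : tri_category) (W : forall X Y : C, hom X Y -> Prop).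
Hypothesis Wsh : forall (X Y : C) (f : hom X Y), W f -> W (shm f).

Inductive zigzag (X : C) : C -> Type :=
| zz_id : zigzag X X
| zz_fwd Y Z (f : hom Y Z) (p : zigzag X Y) : zigzag X Z
| zz_bwd Y Z (s : hom Z Y) (w : W s) (p : zigzag X Y) : zigzag X Z.

Inductive zz_eq (X : C) : forall Y : C, zigzag X Y -> zigzag X Y -> Prop :=
| zz_refl Y (p : zigzag X Y) : zz_eq p p
| zz_sym Y (p q : zigzag X Y) : zz_eq p q -> zz_eq q p
| zz_trans Y (p q r : zigzag X Y) : zz_eq p q -> zz_eq q r -> zz_eq p r
| zz_fwd_cong Y Z (f g : hom Y Z) (p q : zigzag X Y) :
    heq f g -> zz_eq p q -> zz_eq (zz_fwd f p) (zz_fwd g q)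
| zz_bwd_cong Y Z (s : hom Z Y) (w : W s) (p q : zigzag X Y) :
    zz_eq p q -> zz_eq (zz_bwd w p) (zz_bwd w q)
| zz_fwd_id Y (p : zigzag X Y) : zz_eq (zz_fwd (idm Y) p) p
| zz_fwd_comp Y Z T (g : hom Z T) (f : hom Y Z) (p : zigzag X Y) :
    zz_eq (zz_fwd (comp g f) p) (zz_fwd g (zz_fwd f p))
| zz_fwd_bwd Y Z (s : hom Z Y) (w : W s) (p : zigzag X Y) :
    zz_eq (zz_fwd s (zz_bwd w p)) p
| zz_bwd_fwd Y Z (s : hom Z Y) (w : W s) (p : zigzag X Z) :
    zz_eq (zz_bwd w (zz_fwd s p)) p.

Fixpoint zz_comp (X Y Z : C) (q : zigzag Y Z) : zigzag X Y -> zigzag X Z :=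
  match q in zigzag _ Z return zigzag X Y -> zigzag X Z with
  | zz_id => fun p => p
  | zz_fwd _ _ f q' => fun p => zz_fwd f (zz_comp q' p)
  | zz_bwd _ _ _ w q' => fun p => zz_bwd w (zz_comp q' p)
  end.

Fixpoint zz_sh (X Y : C) (p : zigzag X Y) : zigzag (sh X) (sh Y) :=
  match p in zigzag _ Y return zigzag (sh X) (sh Y) with
  | zz_id => zz_id (sh X)
  | zz_fwd _ _ f q => zz_fwd (shm f) (zz_sh q)
  | zz_bwd _ _ _ w q => zz_bwd (Wsh w) (zz_sh q)
  end.

Lemma zz_compA X Y Z T (r : zigzag Z T) (q : zigzag Y Z) (p : zigzag X Y) :
  zz_comp r (zz_comp q p) = zz_comp (zz_comp r q) p.
Proof.
by elim: r => //= [U V f r ->|U V s w r ->].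
Qed.

Lemma zz_compm1 X Y (p : zigzag X Y) : zz_comp p (zz_id X) = p.
Proof. by elim: p => //= [U V f r ->|U V s w r ->]. Qed.

Lemma zz_comp_eq X Y Z (q q' : zigzag Y Z) (p p' : zigzag X Y) :
  zz_eq q q' -> zz_eq p p' -> zz_eq (zz_comp q p) (zz_comp q' p').
Proof.
move=> qq' pp'; apply: (@zz_trans _ _ _ (zz_comp q p')).
  elim: q {qq'} => //= [U V f q IH|U V s w q IH].
  - by apply: zz_fwd_cong => //; apply: heq_refl.
  - exact: zz_bwd_cong.
elim: qq' => /=.
- by move=> *; apply: zz_refl.
- by move=> *; apply: zz_sym.
- by move=> U a b c _ IH1 _ IH2; apply: zz_trans IH1 IH2.
- by move=> *; apply: zz_fwd_cong.
- by move=> *; apply: zz_bwd_cong.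
- by move=> *; apply: zz_fwd_id.
- by move=> *; apply: zz_fwd_comp.
- by move=> *; apply: zz_fwd_bwd.
- by move=> *; apply: zz_bwd_fwd.
Qed.

Definition loc_category : category :=
  @Category C zigzag zz_eq zz_id zz_comp
    zz_refl zz_sym zz_trans zz_comp_eq
    (fun X Y Z T r q p => eq_ind _ (zz_eq _) (zz_refl _) _ (zz_compA r q p))
    (fun X Y p => zz_refl p)
    (fun X Y p => eq_ind _ (fun q => zz_eq q p) (zz_refl p) _
                    (esym (zz_compm1 p))).

Lemma zz_sh_eq X Y (p q : zigzag X Y) : zz_eq p q -> zz_eq (zz_sh p) (zz_sh q).
Proof.
elim=> {Y p q} /=.
- by move=> *; apply: zz_refl.
- by move=> *; apply: zz_sym.
- by move=> U a b c _ IH1 _ IH2; apply: zz_trans IH1 IH2.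
- by move=> *; apply: zz_fwd_cong => //; apply: shm_heq.
- by move=> *; apply: zz_bwd_cong.
- move=> Y p; apply: zz_trans (zz_fwd_id _).
  by apply: zz_fwd_cong; [apply: shm_id|apply: zz_refl].
- move=> Y Z T g f p; apply: zz_trans (zz_fwd_comp _ _ _).
  by apply: zz_fwd_cong; [apply: shm_comp|apply: zz_refl].
- by move=> *; apply: zz_fwd_bwd.
- by move=> *; apply: zz_bwd_fwd.
Qed.

Lemma zz_sh_comp X Y Z (q : zigzag Y Z) (p : zigzag X Y) :
  zz_eq (zz_sh (zz_comp q p)) (zz_comp (zz_sh q) (zz_sh p)).
Proof.
elim: q => /= [|U V f q IH|U V s w q IH].
- exact: zz_refl.
- by apply: zz_fwd_cong => //; apply: heq_refl.
- exact: zz_bwd_cong.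
Qed.

Definition loc_shift : shift_category :=
  @ShiftCategory loc_category (@sh C) zz_sh zz_sh_eq
    (fun X => zz_refl (zz_id (sh X))) zz_sh_comp.

Definition zz_of (X Y : C) (f : hom X Y) : zigzag X Y := zz_fwd f (zz_id X).

Definition localization : tri_category :=
  @TriCategory loc_shift
    (fun (X Y Z : C) (f : zigzag X Y) (g : zigzag Y Z) (h : zigzag Z (sh X)) =>
    exists (f' : hom X Y) (g' : hom Y Z) (h' : hom Z (sh X)),
      [/\ std f' g' h', f = zz_of f', g = zz_of g' & h = zz_of h']).

End Localization.

(** * Bounded complexes in a preadditive category *)

Record preadditive := Preadditive {
  pob :> Type;
  phom : pob -> pob -> zmodType;
  pid : forall X, phom X X;
  pcomp : forall X Y Z, phom Y Z -> phom X Y -> phom X Z;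
  pcompA : forall X Y Z T (h : phom Z T) (g : phom Y Z) (f : phom X Y),
    pcomp h (pcomp g f) = pcomp (pcomp h g) f;
  pcomp1m : forall X Y (f : phom X Y), pcomp (pid Y) f = f;
  pcompm1 : forall X Y (f : phom X Y), pcomp f (pid X) = f;
  pcompDl : forall X Y Z (g g' : phom Y Z) (f : phom X Y),
    pcomp (g + g') f = pcomp g f + pcomp g' f;
  pcompDr : forall X Y Z (g : phom Y Z) (f f' : phom X Y),
    pcomp g (f + f') = pcomp g f + pcomp g f'
}.
Arguments pid {p}.

Section Complexes.
Variable A : preadditive.

Lemma pcompNl (X Y Z : A) (g : phom Y Z) (f : phom X Y) :
  pcomp (- g) f = - pcomp g f.
Proof.
have p0 : pcomp 0 f = 0 :> phom X Z.
  by apply: (addrI (pcomp 0 f)); rewrite -pcompDl !addr0.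
by apply: (addrI (pcomp g f)); rewrite -pcompDl !subrr.
Qed.

Lemma pcompNr (X Y Z : A) (g : phom Y Z) (f : phom X Y) :
  pcomp g (- f) = - pcomp g f.
Proof.
have p0 : pcomp g 0 = 0 :> phom X Z.
  by apply: (addrI (pcomp g 0)); rewrite -pcompDr !addr0.
by apply: (addrI (pcomp g f)); rewrite -pcompDr !subrr.
Qed.

(* In the boundedness clause, [pid X = 0] says that X is a zero object. *)
Record complex_ob := Complex {
  cob : int -> A;
  cd : forall n : int, phom (cob n) (cob (n + 1));
  cdd : forall n : int, pcomp (cd (n + 1)) (cd n) = 0;
  cbounded : exists N : int, forall n : int, N < `|n| -> pid (cob n) = 0
}.

Record chain_map (X Y : complex_ob) := ChainMap {
  cmap : forall n : int, phom (cob X n) (cob Y n);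
  cmap_d : forall n : int,
    pcomp (cmap (n + 1)) (cd X n) = pcomp (cd Y n) (cmap n)
}.

Definition chain_map_eq (X Y : complex_ob) (f g : chain_map X Y) : Prop :=
  forall n, cmap f n = cmap g n.

Lemma chain_id_subproof (X : complex_ob) (n : int) :
  pcomp (pid (cob X (n + 1))) (cd X n) = pcomp (cd X n) (pid (cob X n)).
Proof. by rewrite pcomp1m pcompm1. Qed.

Definition chain_id (X : complex_ob) : chain_map X X :=
  ChainMap (@chain_id_subproof X).

Lemma chain_comp_subproof (X Y Z : complex_ob)
    (g : chain_map Y Z) (f : chain_map X Y) (n : int) :
  pcomp (pcomp (cmap g (n + 1)) (cmap f (n + 1))) (cd X n)
  = pcomp (cd Z n) (pcomp (cmap g n) (cmap f n)).
Proof. by rewrite -pcompA cmap_d pcompA cmap_d pcompA. Qed.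

Definition chain_comp (X Y Z : complex_ob)
    (g : chain_map Y Z) (f : chain_map X Y) : chain_map X Z :=
  ChainMap (chain_comp_subproof g f).

Definition Chb_category : category.
Proof.
refine (@Category complex_ob chain_map chain_map_eq chain_id chain_comp
          _ _ _ _ _ _ _).
- by [].
- by move=> X Y f g fg n; rewrite fg.
- by move=> X Y f g h fg gh n; rewrite fg gh.
- by move=> X Y Z g g' f f' gg' ff' n /=; rewrite gg' ff'.
- by move=> X Y Z T h g f n /=; rewrite pcompA.
- by move=> X Y f n /=; rewrite pcomp1m.
- by move=> X Y f n /=; rewrite pcompm1.
Defined.

Lemma csh_dd (X : complex_ob) (n : int) :
  pcomp (- cd X (n + 1 + 1)) (- cd X (n + 1)) = 0.
Proof. by rewrite pcompNl pcompNr cdd !oppr0. Qed.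

Lemma csh_bounded (X : complex_ob) :
  exists N : int, forall n : int, N < `|n| -> pid (cob X (n + 1)) = 0.
Proof.
have [N HN] := cbounded X; exists (N + 1) => n Nn; apply: HN.
rewrite -(ltrD2r 1); apply: (lt_le_trans Nn).
by rewrite -{1}(addrK 1 n) (le_trans (ler_normB _ _)).
Qed.

(* X[1]^n = X^(n+1) with differential - d_X. *)
Definition csh (X : complex_ob) : complex_ob :=
  @Complex (fun n : int => cob X (n + 1)) (fun n : int => - cd X (n + 1))
    (csh_dd X) (csh_bounded X).

Lemma cshm_subproof (X Y : complex_ob) (f : chain_map X Y) (n : int) :
  pcomp (cmap f (n + 1 + 1)) (cd (csh X) n)
  = pcomp (cd (csh Y) n) (cmap f (n + 1)).
Proof. by rewrite /= pcompNr pcompNl cmap_d. Qed.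

Definition cshm (X Y : complex_ob) (f : chain_map X Y) :
    chain_map (csh X) (csh Y) :=
  @ChainMap (csh X) (csh Y) (fun n : int => cmap f (n + 1)) (cshm_subproof f).

Definition Chb_shift : shift_category.
Proof.
refine (@ShiftCategory Chb_category csh cshm _ _ _).
- by move=> X Y f g fg n /=; rewrite fg.
- by [].
- by [].
Defined.

(* X -f-> Y -i-> Z -p-> X[1] where Z is the mapping cone of f: in each degree
   Z^n is the biproduct of X^(n+1) and Y^n, with inclusions s, i and projections
   p, r, and d_Z = [[- d_X, 0], [f, d_Y]].  The second column of d_Z is the fact
   that i is a chain map, the first column is the last equation. *)
Definition cone_triangle (X Y Z : complex_ob) (f : chain_map X Y)
    (i : chain_map Y Z) (p : chain_map Z (csh X)) : Prop :=
  exists (s : forall n, phom (cob (csh X) n) (cob Z n))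
         (r : forall n, phom (cob Z n) (cob Y n)), forall n : int,
    [/\ [/\ pcomp (r n) (cmap i n) = pid (cob Y n),
            pcomp (cmap p n) (s n) = pid (cob (csh X) n),
            pcomp (r n) (s n) = 0 &
            pcomp (cmap p n) (cmap i n) = 0],
        pcomp (cmap i n) (r n) + pcomp (s n) (cmap p n) = pid (cob Z n) &
        pcomp (cd Z n) (s n)
        = pcomp (s (n + 1)) (cd (csh X) n)
          + pcomp (cmap i (n + 1)) (cmap f (n + 1))].

Definition Chb : tri_category := @TriCategory Chb_shift cone_triangle.

End Complexes.

(** * Projective varieties and their coherent sheaves

   Varieties are taken in the classical sense: sets of closed points, with the
   Zariski topology and the sheaf of regular functions. *)

(* Points of P^n are the lines of K^(n+1). *)
Definition PP (K : closedFieldType) (n : nat) : Type :=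
  {l : {vspace 'rV[K]_n.+1} | \dim l == 1%N}.

Section ProjectiveSpace.
Variables (K : closedFieldType) (n : nat).

(* The homogeneous coordinates of some nonzero vector on the line x.  Vanishing
   of a homogeneous polynomial, and the quotient of the values of two homogeneous
   polynomials of the same degree, do not depend on this vector. *)
Definition hcoord (x : PP K n) : 'I_n.+1 -> K :=
  fun i => vpick (val x) 0 i.

Definition homogeneous (p : {mpoly K[n.+1]}) : Prop :=
  exists d : nat, p \is d.-homog.

Definition zeros (S : set {mpoly K[n.+1]}) : set (PP K n) :=
  [set x | forall p, S p -> p.@[hcoord x] = 0].

Definition zariski_closed (A : set (PP K n)) : Prop :=
  exists S : set {mpoly K[n.+1]}, S `<=` homogeneous /\ A = zeros S.

(* Irreducibility is not part of the definition; irreducible varieties are a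
   special case. *)
Definition projective_variety (Y : set (PP K n)) : Prop := zariski_closed Y.

Lemma zariski_closedU A B :
  zariski_closed A -> zariski_closed B -> zariski_closed (A `|` B).
Proof.
move=> [S [Sh ->]] [T [Th ->]].
exists [set r | exists p q, [/\ S p, T q & r = p * q]]; split.
  move=> r [p [q [Sp Tq ->]]].
  have [d pd] := Sh _ Sp; have [e qe] := Th _ Tq.
  by exists (d + e)%N; apply: dhomogM.
apply/seteqP; split=> x /=.
  by move=> [xS|xT] r [p [q [Sp Tq ->]]];
    rewrite mevalM ?(xS p Sp) ?(xT q Tq) ?mul0r ?mulr0.
move=> xST; apply: contrapT => /not_orP[].
move=> /existsNP[p /not_implyP[Sp /eqP pN0]].
move=> /existsNP[q /not_implyP[Tq /eqP qN0]].
have /eqP := xST (p * q) (ex_intro _ p (ex_intro _ q (And3 Sp Tq erefl))).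
by rewrite mevalM mulf_eq0 (negPf pN0) (negPf qN0).
Qed.

End ProjectiveSpace.

Section CoherentSheaves.
Variables (K : closedFieldType) (n : nat) (Y : set (PP K n)).

Record opens := Opens {
  oset :> set (PP K n);
  opensP : exists2 Z, zariski_closed Z & oset = Y `\` Z
}.

Lemma opensI_subproof (U V : opens) :
  exists2 Z, zariski_closed Z & U `&` V = Y `\` Z.
Proof.
case: U V => U /= [Z cZ ->] [V /= [T cT ->]].
by exists (Z `|` T); [apply: zariski_closedU|rewrite setDUr].
Qed.

Definition opensI (U V : opens) : opens := Opens (opensI_subproof U V).

Definition incl (U V : set (PP K n)) (VU : V `<=` U) (x : V) : U :=
  exist _ (val x) (mem_set (VU _ (set_mem (valP x)))).

Definition regular (U : opens) (f : U -> K) : Prop :=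
  forall x : U, exists (W : opens) (d : nat) (p q : {mpoly K[n.+1]}),
    [/\ oset W (val x), p \is d.-homog, q \is d.-homog &
        forall y : U, oset W (val y) ->
          q.@[hcoord (val y)] != 0 /\
          f y = p.@[hcoord (val y)] / q.@[hcoord (val y)]].

Definition regular_pred (U : opens) : {pred (U -> K)} := fun f => `[< regular f >].

Lemma regular_subring (U : opens) : subring_closed (@regular_pred U).
Proof.
split.
- apply/asboolP => x; exists U, 0%N, 1, 1; split.
  + exact: set_mem (valP x).
  + exact: dhomog1.
  + exact: dhomog1.
  + by move=> y _; rewrite meval1 oner_neq0 divr1.
- move=> f g /asboolP rf /asboolP rg; apply/asboolP => x.
  have [W1 [d1 [p1 [q1 [W1x p1h q1h H1]]]]] := rf x.
  have [W2 [d2 [p2 [q2 [W2x p2h q2h H2]]]]] := rg x.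
  exists (opensI W1 W2), (d1 + d2)%N, (p1 * q2 - p2 * q1), (q1 * q2); split.
  + by split.
  + by apply: rpredB; [apply: dhomogM|rewrite addnC; apply: dhomogM].
  + exact: dhomogM.
  + move=> y [/H1[q1N0 fy] /H2[q2N0 gy]].
    rewrite mevalM mulf_neq0 //; split=> //.
    by rewrite mevalB !mevalM -mulNr -addf_div // mulNr -fy -gy.
- move=> f g /asboolP rf /asboolP rg; apply/asboolP => x.
  have [W1 [d1 [p1 [q1 [W1x p1h q1h H1]]]]] := rf x.
  have [W2 [d2 [p2 [q2 [W2x p2h q2h H2]]]]] := rg x.
  exists (opensI W1 W2), (d1 + d2)%N, (p1 * p2), (q1 * q2); split.
  + by split.
  + exact: dhomogM.
  + exact: dhomogM.
  + move=> y [/H1[q1N0 fy] /H2[q2N0 gy]].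
    by rewrite !mevalM mulf_neq0 //; split=> //; rewrite fctE fy gy mulf_div.
Qed.

HB.instance Definition _ (U : opens) :=
  GRing.isSubringClosed.Build (U -> K) (@regular_pred U) (@regular_subring U).

Record structure_sheaf (U : opens) := RegularFunction {
  regfun :> U -> K;
  _ : regfun \in @regular_pred U
}.
Local Notation O := structure_sheaf.

HB.instance Definition _ (U : opens) := [isSub for @regfun U].
HB.instance Definition _ (U : opens) := [Choice of O U by <:].
HB.instance Definition _ (U : opens) :=
  GRing.SubChoice_isSubComPzRing.Build (U -> K) (@regular_pred U) (O U)
    (@regular_subring U).

Lemma ores_subproof (U V : opens) (VU : V `<=` U) (f : O U) :
  (regfun f \o incl VU) \in @regular_pred V.
Proof.
case: f => f /= /asboolP rf; apply/asboolP => x.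
have [W [d [p [q [Wx ph qh H]]]]] := rf (incl VU x).
by exists W, d, p, q; split=> // y Wy; apply: (H (incl VU y)).
Qed.

Definition ores (U V : opens) (VU : V `<=` U) (f : O U) : O V :=
  RegularFunction (ores_subproof VU f).

Record omodule := OModule {
  sec : forall U : opens, lmodType (O U);
  res : forall U V : opens, V `<=` U -> sec U -> sec V;
  res_linear : forall (U V : opens) (VU : V `<=` U) (a : O U) (s t : sec U),
    res VU (a *: s + t) = ores VU a *: res VU s + res VU t;
  res_id : forall (U : opens) (UU : U `<=` U) (s : sec U), res UU s = s;
  res_res : forall (U V W : opens) (VU : V `<=` U) (WV : W `<=` V)
      (WU : W `<=` U) (s : sec U),
    res WV (res VU s) = res WU s;
  sheaf_locality : forall (I : Type) (U : opens) (V : I -> opens)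
      (VU : forall i, V i `<=` U),
    (forall x, oset U x -> exists i, oset (V i) x) ->
    forall s t : sec U, (forall i, res (VU i) s = res (VU i) t) -> s = t;
  sheaf_gluing : forall (I : Type) (U : opens) (V : I -> opens)
      (VU : forall i, V i `<=` U),
    (forall x, oset U x -> exists i, oset (V i) x) ->
    forall s : forall i, sec (V i),
    (forall i j (W : opens) (Wi : W `<=` V i) (Wj : W `<=` V j),
        res Wi (s i) = res Wj (s j)) ->
    exists t : sec U, forall i, res (VU i) t = s i
}.

Record omorphism (F G : omodule) := OMorphism {
  app : forall U : opens, sec F U -> sec G U;
  app_linear : forall (U : opens) (a : O U) (s t : sec F U),
    app (a *: s + t) = a *: app s + app t;
  app_res : forall (U V : opens) (VU : V `<=` U) (s : sec F U),
    app (res VU s) = res VU (app s)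
}.
Arguments app {F G} o {U}.

Lemma omorphism_eq F G (f g : omorphism F G) :
  (forall U (s : sec F U), app f s = app g s) -> f = g.
Proof.
case: f g => [f f1 f2] [g g1 g2] /= fg.
have e : f = g by apply: functional_extensionality_dep => U; apply/funext => s.
by subst g; congr OMorphism; apply: Prop_irrelevance.
Qed.

Lemma res_zmod (F : omodule) (U V : opens) (VU : V `<=` U) :
  (res (o:=F) VU 0 = 0)
  * (forall s t, res (o:=F) VU (s + t) = res VU s + res VU t)
  * (forall s, res (o:=F) VU (- s) = - res VU s).
Proof.
have D s t : res (o:=F) VU (s + t) = res VU s + res VU t.
  rewrite -[s in LHS]scale1r res_linear; congr (_ + _).
  by rewrite -[RHS]scale1r; congr (_ *: _); apply: val_inj.
have Z : res (o:=F) VU 0 = 0.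
  by apply: (addrI (res (o:=F) VU 0)); rewrite -D !addr0.
split; first by split.
by move=> s; apply: (addrI (res VU s)); rewrite -D !subrr.
Qed.

Section HomZmodule.
Variables F G : omodule.

Definition ohom0 : omorphism F G.
Proof.
refine (@OMorphism F G (fun U _ => 0) _ _).
- by move=> U a s t; rewrite scaler0 addr0.
- by move=> U V VU s; rewrite !res_zmod.
Defined.

Definition ohomD (f g : omorphism F G) : omorphism F G.
Proof.
refine (@OMorphism F G (fun U s => app f s + app g s) _ _).
- by move=> U a s t; rewrite !app_linear scalerDr addrACA.
- by move=> U V VU s; rewrite !res_zmod !app_res.
Defined.

Definition ohomN (f : omorphism F G) : omorphism F G.
Proof.
refine (@OMorphism F G (fun U s => - app f s) _ _).
- by move=> U a s t; rewrite !app_linear opprD scalerN.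
- by move=> U V VU s; rewrite !res_zmod !app_res.
Defined.

HB.instance Definition _ := gen_eqMixin (omorphism F G).
HB.instance Definition _ := gen_choiceMixin (omorphism F G).

Lemma ohomDA : associative ohomD.
Proof. by move=> f g h; apply: omorphism_eq => U s /=; rewrite addrA. Qed.
Lemma ohomDC : commutative ohomD.
Proof. by move=> f g; apply: omorphism_eq => U s /=; rewrite addrC. Qed.
Lemma ohom0D : left_id ohom0 ohomD.
Proof. by move=> f; apply: omorphism_eq => U s /=; rewrite add0r. Qed.
Lemma ohomND : left_inverse ohom0 ohomN ohomD.
Proof. by move=> f; apply: omorphism_eq => U s /=; rewrite addNr. Qed.

HB.instance Definition _ :=
  GRing.isZmodule.Build (omorphism F G) ohomDA ohomDC ohom0D ohomND.

End HomZmodule.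

(* The sections s_1, ..., s_m of F over V generate F over V. *)
Definition generating (F : omodule) (V : opens) (m : nat)
    (s : 'I_m -> sec F V) : Prop :=
  forall (W : opens) (WV : W `<=` V) (t : sec F W) x, oset W x ->
  exists (W' : opens) (W'W : W' `<=` W) (W'V : W' `<=` V) (a : 'I_m -> O W'),
    oset W' x /\ res W'W t = \sum_i a i *: res W'V (s i).

Definition finite_type (F : omodule) : Prop :=
  forall x, Y x -> exists (V : opens) (m : nat) (s : 'I_m -> sec F V),
    oset V x /\ generating s.

Definition relation_on (F : omodule) (U : opens) (m : nat)
    (s : 'I_m -> sec F U) (W : opens) (WU : W `<=` U) (a : 'I_m -> O W) : Prop :=
  \sum_i a i *: res WU (s i) = 0.

(* The sheaf of relations between s_1, ..., s_m, that is, the kernel of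
   O_U^m -> F_U, is of finite type. *)
Definition finite_relations (F : omodule) (U : opens) (m : nat)
    (s : 'I_m -> sec F U) : Prop :=
  forall x, oset U x ->
  exists (V : opens) (VU : V `<=` U) (k : nat) (r : 'I_k -> 'I_m -> O V),
    [/\ oset V x, forall j, relation_on s VU (r j) &
      forall (W : opens) (WV : W `<=` V) (WU : W `<=` U) (a : 'I_m -> O W),
        relation_on s WU a -> forall y, oset W y ->
        exists (W' : opens) (W'W : W' `<=` W) (W'V : W' `<=` V)
               (b : 'I_k -> O W'),
          oset W' y /\
          forall i, ores W'W (a i) = \sum_j b j * ores W'V (r j i)].

Definition coherent (F : omodule) : Prop :=
  finite_type F /\
  forall (U : opens) (m : nat) (s : 'I_m -> sec F U), finite_relations s.

Record coherent_sheaf := CoherentSheaf {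
  csheaf :> omodule;
  csheafP : coherent csheaf
}.

Definition ohom_id (F : omodule) : omorphism F F :=
  @OMorphism F F (fun U s => s) (fun U a s t => erefl) (fun U V VU s => erefl).

Definition ohom_comp (F G H : omodule) (g : omorphism G H) (f : omorphism F G) :
  omorphism F H.
Proof.
refine (@OMorphism F H (fun U s => app g (app f s)) _ _).
- by move=> U a s t; rewrite !app_linear.
- by move=> U V VU s; rewrite !app_res.
Defined.

Lemma app_add F G (f : omorphism F G) U (s t : sec F U) :
  app f (s + t) = app f s + app f t.
Proof. by rewrite -[s in LHS]scale1r app_linear scale1r. Qed.

Definition Coh : preadditive.
Proof.
refine (@Preadditive coherent_sheaf (fun F G => omorphism F G : zmodType)
          ohom_id ohom_comp _ _ _ _ _).
- by move=> *; apply: omorphism_eq.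
- by move=> *; apply: omorphism_eq.
- by move=> *; apply: omorphism_eq.
- by move=> *; apply: omorphism_eq.
- by move=> F G H g f f'; apply: omorphism_eq => U s /=; rewrite app_add.
Defined.

(* f induces isomorphisms of cohomology sheaves H^(n+1)(A) -> H^(n+1)(B), for all
   n in Z: a cocycle of A that locally becomes a coboundary in B is locally a
   coboundary, and every cocycle of B is locally the image of a cocycle of A up
   to a coboundary. *)
Definition quasi_iso (A B : Chb Coh) (f : hom A B) : Prop :=
  forall m : int,
  (forall (U : opens) (s : sec (cob A (m + 1)) U),
     app (cd A (m + 1)) s = 0 ->
     (exists t : sec (cob B m) U, app (cmap f (m + 1)) s = app (cd B m) t) ->
     forall x, oset U x ->
     exists (V : opens) (VU : V `<=` U) (u : sec (cob A m) V),
       oset V x /\ res VU s = app (cd A m) u)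
  /\
  (forall (U : opens) (t : sec (cob B (m + 1)) U),
     app (cd B (m + 1)) t = 0 ->
     forall x, oset U x ->
     exists (V : opens) (VU : V `<=` U)
            (s : sec (cob A (m + 1)) V) (u : sec (cob B m) V),
       [/\ oset V x, app (cd A (m + 1)) s = 0 &
           res VU t = app (cmap f (m + 1)) s + app (cd B m) u]).

Lemma app_opp F G (f : omorphism F G) U (s : sec F U) :
  app f (- s) = - app f s.
Proof.
have f0 : app f (0 : sec F U) = 0.
  by apply: (addrI (app f (0 : sec F U))); rewrite -app_add !addr0.
by apply: (addrI (app f s)); rewrite -app_add !subrr.
Qed.

Lemma quasi_iso_shift (A B : Chb Coh) (f : hom A B) :
  quasi_iso f -> quasi_iso (shm f).
Proof.
move=> qf m; have [inj surj] := qf (m + 1); split.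
- move=> U s /= ds [t st] x Ux.
  have ds' : app (cd A (m + 1 + 1)) s = 0 by apply: oppr_inj; rewrite oppr0.
  have [|V [VU [u [Vx us]]]] := inj U s ds' _ x Ux.
    by exists (- t); rewrite app_opp.
  by exists V, VU, (- u); split=> //; rewrite app_opp opprK.
- move=> U t /= dt x Ux.
  have dt' : app (cd B (m + 1 + 1)) t = 0 by apply: oppr_inj; rewrite oppr0.
  have [V [VU [s [u [Vx ds st]]]]] := surj U t dt' x Ux.
  exists V, VU, s, (- u); split=> //; first by rewrite ds oppr0.
  by rewrite app_opp opprK.
Qed.

Definition DbCoh : tri_category := localization quasi_iso_shift.

End CoherentSheaves.

(** * Twisted complexes over a graded category

   A strictly unital A-infinity category whose only nonzero product is m_2 is a
   graded linear category (with composition g o f = (-1)^|f| m_2(g, f) or m_2(g, f),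
   according to the sign convention).  Morphism spaces are given as total spaces
   together with the subspaces [gdeg d] of elements of degree d. *)

Record graded_category (K : comNzRingType) := GradedCategory {
  gob :> Type;
  ghom : gob -> gob -> lmodType K;
  gdeg : forall X Y, int -> ghom X Y -> Prop;
  gid : forall X, ghom X X;
  gcomp : forall X Y Z, ghom Y Z -> ghom X Y -> ghom X Z;
  gdeg_linear : forall X Y d (a : K) (f g : ghom X Y),
    gdeg d f -> gdeg d g -> gdeg d (a *: f + g);
  gdeg_direct : forall X Y (r : seq int) (c : int -> ghom X Y),
    uniq r -> (forall d, gdeg d (c d)) -> \sum_(d <- r) c d = 0 ->
    forall d, d \in r -> c d = 0;
  gdeg_total : forall X Y (f : ghom X Y),
    exists (r : seq int) (c : int -> ghom X Y),
      (forall d, gdeg d (c d)) /\ f = \sum_(d <- r) c d;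
  gdeg_id : forall X, gdeg 0 (gid X);
  gdeg_comp : forall X Y Z d e (g : ghom Y Z) (f : ghom X Y),
    gdeg e g -> gdeg d f -> gdeg (d + e) (gcomp g f);
  gcompA : forall X Y Z T (h : ghom Z T) (g : ghom Y Z) (f : ghom X Y),
    gcomp h (gcomp g f) = gcomp (gcomp h g) f;
  gcomp1m : forall X Y (f : ghom X Y), gcomp (gid Y) f = f;
  gcompm1 : forall X Y (f : ghom X Y), gcomp f (gid X) = f;
  gcomp_linearl : forall X Y Z (a : K) (g g' : ghom Y Z) (f : ghom X Y),
    gcomp (a *: g + g') f = a *: gcomp g f + gcomp g' f;
  gcomp_linearr : forall X Y Z (a : K) (g : ghom Y Z) (f f' : ghom X Y),
    gcomp g (a *: f + f') = a *: gcomp g f + gcomp g f'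
}.
Arguments gid {_ _}.

Section TwistedComplexes.
Variables (K : comNzRingType) (A : graded_category K).

Lemma gcompDl (X Y Z : A) (g g' : ghom Y Z) (f : ghom X Y) :
  gcomp (g + g') f = gcomp g f + gcomp g' f.
Proof. by rewrite -[g in LHS]scale1r gcomp_linearl scale1r. Qed.

Lemma gcompDr (X Y Z : A) (g : ghom Y Z) (f f' : ghom X Y) :
  gcomp g (f + f') = gcomp g f + gcomp g f'.
Proof. by rewrite -[f in LHS]scale1r gcomp_linearr scale1r. Qed.

Lemma gcomp0m (X Y Z : A) (f : ghom X Y) : gcomp (0 : ghom Y Z) f = 0.
Proof.
by apply: (addrI (gcomp (0 : ghom Y Z) f)); rewrite -gcompDl !addr0.
Qed.

Lemma gcompm0 (X Y Z : A) (g : ghom Y Z) : gcomp g (0 : ghom X Y) = 0.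
Proof.
by apply: (addrI (gcomp g (0 : ghom X Y))); rewrite -gcompDr !addr0.
Qed.

Lemma gcompNl (X Y Z : A) (g : ghom Y Z) (f : ghom X Y) :
  gcomp (- g) f = - gcomp g f.
Proof.
by apply: (addrI (gcomp g f)); rewrite -gcompDl !subrr gcomp0m.
Qed.

Lemma gcompNr (X Y Z : A) (g : ghom Y Z) (f : ghom X Y) :
  gcomp g (- f) = - gcomp g f.
Proof.
by apply: (addrI (gcomp g f)); rewrite -gcompDr !subrr gcompm0.
Qed.

Lemma gcomp_suml (X Y Z : A) (I : finType) (g : I -> ghom Y Z) (f : ghom X Y) :
  gcomp (\sum_i g i) f = \sum_i gcomp (g i) f.
Proof.
by elim/big_rec2: _ => [|i u v _ <-]; rewrite ?gcomp0m ?gcompDl.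
Qed.

Lemma gcomp_sumr (X Y Z : A) (I : finType) (g : ghom Y Z) (f : I -> ghom X Y) :
  gcomp g (\sum_i f i) = \sum_i gcomp g (f i).
Proof.
by elim/big_rec2: _ => [|i u v _ <-]; rewrite ?gcompm0 ?gcompDr.
Qed.

Lemma gdeg0 (X Y : A) d : gdeg d (0 : ghom X Y).
Proof.
have [r [c [cd _]]] := @gdeg_total K A X Y 0.
have := gdeg_linear (-1) (cd d) (cd d).
by rewrite scaleN1r addNr.
Qed.

Lemma gdegD (X Y : A) d (f g : ghom X Y) :
  gdeg d f -> gdeg d g -> gdeg d (f + g).
Proof. by move=> fd gd; have := gdeg_linear 1 fd gd; rewrite scale1r. Qed.

Lemma gdegN (X Y : A) d (f : ghom X Y) : gdeg d f -> gdeg d (- f).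
Proof.
move=> fd; have := gdeg_linear (-1) fd (gdeg0 X Y d).
by rewrite scaleN1r addr0.
Qed.

Lemma gdeg_sum (X Y : A) d (I : finType) (f : I -> ghom X Y) :
  (forall i, gdeg d (f i)) -> gdeg d (\sum_i f i).
Proof.
by move=> fd; apply: big_ind => // [|u v]; [exact: gdeg0|exact: gdegD].
Qed.

(* The formal sum of the objects [sob i], shifted by [ssh i]. *)
Record shifted_sum := ShiftedSum {
  slen : nat;
  sob : 'I_slen -> A;
  ssh : 'I_slen -> int
}.

Definition gmat (E F : shifted_sum) : Type :=
  forall (i : 'I_(slen E)) (j : 'I_(slen F)), ghom (sob i) (sob j).

(* Hom^d(X[a], Y[b]) = Hom^(d+b-a)(X, Y). *)
Definition gmat_deg (E F : shifted_sum) (d : int) (f : gmat E F) : Prop :=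
  forall i j, gdeg (d + ssh j - ssh i) (f i j).

Definition gmul (E F G : shifted_sum) (g : gmat F G) (f : gmat E F) :
    gmat E G :=
  fun i k => \sum_j gcomp (g j k) (f i j).

Definition gone (E : shifted_sum) : gmat E E := fun i j =>
  match i =P j with
  | ReflectT e => eq_rect i (fun k => ghom (sob i) (sob k)) (gid (sob i)) j e
  | ReflectF _ => 0
  end.
Arguments gone : clear implicits.

Definition gadd (E F : shifted_sum) (f g : gmat E F) : gmat E F :=
  fun i j => f i j + g i j.
Definition gopp (E F : shifted_sum) (f : gmat E F) : gmat E F :=
  fun i j => - f i j.
Definition gzero (E F : shifted_sum) : gmat E F := fun i j => 0.
Arguments gzero : clear implicits.

Lemma gmat_eq (E F : shifted_sum) (f g : gmat E F) :
  (forall i j, f i j = g i j) -> f = g.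
Proof.
by move=> fg; do 2!apply: functional_extensionality_dep => ?; apply: fg.
Qed.

Lemma gone_diag (E : shifted_sum) (i : 'I_(slen E)) : gone E i i = gid (sob i).
Proof.
by rewrite /gone; case: eqP => // e; rewrite (eq_irrelevance e erefl).
Qed.

Lemma gone_off (E : shifted_sum) (i j : 'I_(slen E)) : i != j -> gone E i j = 0.
Proof. by rewrite /gone; case: eqP. Qed.

Lemma gmulA E F G H (h : gmat G H) (g : gmat F G) (f : gmat E F) :
  gmul h (gmul g f) = gmul (gmul h g) f.
Proof.
apply: gmat_eq => i l; rewrite /gmul.
under eq_bigr do rewrite gcomp_sumr.
rewrite exchange_big; apply: eq_bigr => j _.
by rewrite gcomp_suml; apply: eq_bigr => k _; rewrite gcompA.
Qed.

Lemma gmul1m E F (f : gmat E F) : gmul (gone F) f = f.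
Proof.
apply: gmat_eq => i k; rewrite /gmul (bigD1 k) //= gone_diag gcomp1m.
by rewrite big1 ?addr0 // => j jk; rewrite gone_off // gcomp0m.
Qed.

Lemma gmulm1 E F (f : gmat E F) : gmul f (gone E) = f.
Proof.
apply: gmat_eq => i k; rewrite /gmul (bigD1 i) //= gone_diag gcompm1.
by rewrite big1 ?addr0 // => j ji; rewrite gone_off 1?eq_sym // gcompm0.
Qed.

Lemma gmulDl E F G (g g' : gmat F G) (f : gmat E F) :
  gmul (gadd g g') f = gadd (gmul g f) (gmul g' f).
Proof.
apply: gmat_eq => i k; rewrite /gadd /gmul -big_split.
by apply: eq_bigr => j _; rewrite gcompDl.
Qed.

Lemma gmulDr E F G (g : gmat F G) (f f' : gmat E F) :
  gmul g (gadd f f') = gadd (gmul g f) (gmul g f').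
Proof.
apply: gmat_eq => i k; rewrite /gadd /gmul -big_split.
by apply: eq_bigr => j _; rewrite gcompDr.
Qed.

Lemma gmulNl E F G (g : gmat F G) (f : gmat E F) :
  gmul (gopp g) f = gopp (gmul g f).
Proof.
apply: gmat_eq => i k; rewrite /gopp /gmul -sumrN.
by apply: eq_bigr => j _; rewrite gcompNl.
Qed.

Lemma gmulNr E F G (g : gmat F G) (f : gmat E F) :
  gmul g (gopp f) = gopp (gmul g f).
Proof.
apply: gmat_eq => i k; rewrite /gopp /gmul -sumrN.
by apply: eq_bigr => j _; rewrite gcompNr.
Qed.

Lemma gmul_deg E F G d e (g : gmat F G) (f : gmat E F) :
  gmat_deg e g -> gmat_deg d f -> gmat_deg (d + e) (gmul g f).
Proof.
move=> ge fd i k; apply: gdeg_sum => j.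
have := gdeg_comp (ge j k) (fd i j); congr (gdeg _ _).
by ring.
Qed.

Lemma gone_deg E : gmat_deg 0 (gone E).
Proof.
move=> i j; have [<-|ij] := eqVneq i j.
  by rewrite gone_diag add0r subrr; apply: gdeg_id.
by rewrite gone_off //; apply: gdeg0.
Qed.

(* One-sided twisted complexes (E, delta): delta is strictly triangular of
   degree 1 and satisfies the Maurer-Cartan equation, which for an A-infinity
   category with only m_2 reads delta^2 = 0. *)
Record twisted := Twisted {
  tsum :> shifted_sum;
  tdelta : gmat tsum tsum;
  tdelta_deg : gmat_deg 1 tdelta;
  tdelta_tri : forall i j : 'I_(slen tsum), (j <= i)%N -> tdelta i j = 0;
  tdelta_mc : gmul tdelta tdelta = gzero tsum tsum
}.
Arguments tdelta : clear implicits.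
Arguments tdelta_deg : clear implicits.

(* Closed morphisms of degree 0; the differential of a morphism f of degree d is
   delta f - (-1)^d f delta. *)
Record tw_hom (E F : twisted) := TwHom {
  tw_mat :> gmat E F;
  tw_deg : gmat_deg 0 tw_mat;
  tw_closed : gmul (tdelta F) tw_mat = gmul tw_mat (tdelta E)
}.

Definition homotopic (E F : twisted) (f g : tw_hom E F) : Prop :=
  exists h : gmat E F, gmat_deg (-1) h /\
    tw_mat f = gadd g (gadd (gmul (tdelta F) h) (gmul h (tdelta E))).

Definition tw_id (E : twisted) : tw_hom E E.
Proof.
refine (@TwHom E E (gone E) (@gone_deg E) _).
by rewrite gmul1m gmulm1.
Defined.

Definition tw_comp (E F G : twisted) (g : tw_hom F G) (f : tw_hom E F) :
  tw_hom E G.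
Proof.
refine (@TwHom E G (gmul g f) _ _).
- by rewrite -[0]addr0; apply: gmul_deg; exact: tw_deg.
- by rewrite gmulA tw_closed -gmulA tw_closed gmulA.
Defined.

Lemma homotopic_eq (E F : twisted) (f g : tw_hom E F) :
  tw_mat f = tw_mat g -> homotopic f g.
Proof.
move=> fg; exists (gzero E F); split; first by move=> i j; apply: gdeg0.
rewrite fg; apply: gmat_eq => i j; rewrite /gadd /gmul /gzero !big1 ?addr0 //.
  by move=> k _; rewrite gcomp0m.
by move=> k _; rewrite gcompm0.
Qed.

Lemma homotopic_sym (E F : twisted) (f g : tw_hom E F) :
  homotopic f g -> homotopic g f.
Proof.
move=> [h [hd fg]]; exists (gopp h); split.
  by move=> i j; apply: gdegN; apply: hd.
rewrite fg gmulNl gmulNr; apply: gmat_eq => i j; rewrite /gadd /gopp.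
by rewrite -opprD addrK.
Qed.

Lemma homotopic_trans (E F : twisted) (f g k : tw_hom E F) :
  homotopic f g -> homotopic g k -> homotopic f k.
Proof.
move=> [h [hd fg]] [h' [hd' gk]]; exists (gadd h h'); split.
  by move=> i j; apply: gdegD.
rewrite fg gk gmulDl gmulDr; apply: gmat_eq => i j; rewrite /gadd.
by rewrite -addrA; congr (_ + _); rewrite [LHS]addrC addrACA.
Qed.

Lemma homotopic_comp (E F G : twisted) (g g' : tw_hom F G) (f f' : tw_hom E F) :
  homotopic g g' -> homotopic f f' ->
  homotopic (tw_comp g f) (tw_comp g' f').
Proof.
move=> [k [kd gg']] [h [hd ff']].
apply: (@homotopic_trans _ _ _ (tw_comp g' f)).
- exists (gmul k f); split.
    by have := gmul_deg kd (tw_deg f); rewrite add0r.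
  by rewrite /= gg' !gmulDl -!gmulA tw_closed.
- exists (gmul g' h); split.
    by have := gmul_deg (tw_deg g') hd; rewrite addr0.
  by rewrite /= ff' !gmulDr !gmulA tw_closed.
Qed.

Definition Tw_category : category.
Proof.
refine (@Category twisted tw_hom homotopic tw_id tw_comp _ homotopic_sym
          homotopic_trans homotopic_comp _ _ _).
- by move=> E F f; apply: homotopic_eq.
- by move=> *; apply: homotopic_eq => /=; rewrite gmulA.
- by move=> *; apply: homotopic_eq => /=; rewrite gmul1m.
- by move=> *; apply: homotopic_eq => /=; rewrite gmulm1.
Defined.

Definition ssum_shift (E : shifted_sum) : shifted_sum :=
  @ShiftedSum (slen E) (@sob E) (fun i => ssh i + 1).

Lemma gmat_deg_shift (E F : shifted_sum) d (f : gmat E F) :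
  gmat_deg d f -> @gmat_deg (ssum_shift E) (ssum_shift F) d f.
Proof.
by move=> fd i j; have := fd i j; rewrite /= opprD !addrA addrAC addrK.
Qed.

(* E[1] has differential - delta. *)
Definition tw_sh (E : twisted) : twisted.
Proof.
refine (@Twisted (ssum_shift E) (gopp (tdelta E)) _ _ _).
- by apply: gmat_deg_shift => i j; apply: gdegN; apply: (tdelta_deg E).
- by move=> i j ji; rewrite /gopp tdelta_tri // oppr0.
- change (gmul (gopp (tdelta E)) (gopp (tdelta E)) = gzero E E).
  rewrite gmulNl gmulNr tdelta_mc.
  by apply: gmat_eq => i j; rewrite /gopp /gzero !oppr0.
Defined.

Definition tw_shm (E F : twisted) (f : tw_hom E F) :
  tw_hom (tw_sh E) (tw_sh F).
Proof.
refine (@TwHom (tw_sh E) (tw_sh F) (f : gmat E F) _ _).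
- exact: gmat_deg_shift (tw_deg f).
- change (gmul (gopp (tdelta F)) f = gmul f (gopp (tdelta E))).
  by rewrite gmulNl gmulNr tw_closed.
Defined.

Definition Tw_shift : shift_category.
Proof.
refine (@ShiftCategory Tw_category tw_sh tw_shm _ _ _).
- move=> E F f g [h [hd fg]]; exists (gopp h); split.
    by apply: gmat_deg_shift => i j; apply: gdegN; apply: hd.
  change (tw_mat f = gadd g (gadd (gmul (gopp (tdelta F)) (gopp h))
                              (gmul (gopp h) (gopp (tdelta E))))).
  rewrite fg !gmulNl !gmulNr; apply: gmat_eq => i j.
  by rewrite /gadd /gopp !opprK.
- by move=> *; apply: homotopic_eq.
- by move=> *; apply: homotopic_eq.
Defined.

(* E -f-> F -i-> Z -p-> E[1] where Z is the mapping cone of f: the shifted sum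
   underlying Z is the biproduct of E[1] and F in degree 0, with inclusions s, i
   and projections p, r, and delta_Z = [[- delta_E, 0], [f, delta_F]]. *)
Definition tw_cone_triangle (E F Z : twisted) (f : tw_hom E F)
    (i : tw_hom F Z) (p : tw_hom Z (tw_sh E)) : Prop :=
  exists (s : gmat (tw_sh E) Z) (r : gmat Z F),
    [/\ gmat_deg 0 s /\ gmat_deg 0 r,
        [/\ gmul r i = gone F,
            gmul p s = gone (tw_sh E),
            gmul r s = gzero (tw_sh E) F &
            gmul p i = gzero F (tw_sh E)],
        gadd (gmul i r) (gmul s p) = gone Z &
        gmul (tdelta Z) s
        = gadd (gmul s (tdelta (tw_sh E)))
               (gmul i (tw_mat f : gmat (tw_sh E) F))].

(* H^0(Tw A), the triangulated category generated by A. *)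
Definition H0Tw : tri_category := @TriCategory Tw_shift tw_cone_triangle.

End TwistedComplexes.

(** * The Fukaya-Seidel category of LG(2)

   This is the directed A-infinity category of the two vanishing cycles (both the
   circle in the fibre over 0), given by its Floer complexes and products: all
   m_k with k <> 2 vanish, as do the m_2 not involving a unit. *)

Variant vanishing_cycle := L0 | L1.

Section FukayaSeidel.
Variable K : fieldType.

Definition fs_rank (X Y : vanishing_cycle) : nat :=
  match X, Y with
  | L0, L0 | L1, L1 => 1
  | L0, L1 => 2
  | L1, L0 => 0
  end.

Definition fs_hom (X Y : vanishing_cycle) : lmodType K := 'rV[K]_(fs_rank X Y).

(* The k-th basis vector has degree k, so Hom(L_0, L_1) is K + K[-1]. *)
Definition fs_deg (X Y : vanishing_cycle) (d : int) (f : fs_hom X Y) : Prop :=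
  forall k : 'I_(fs_rank X Y), d != (k : nat)%:Z -> f 0 k = 0.

Definition fs_id (X : vanishing_cycle) : fs_hom X X := const_mx 1.

Definition fs_comp (X Y Z : vanishing_cycle) :
    fs_hom Y Z -> fs_hom X Y -> fs_hom X Z :=
  match X, Y, Z with
  | L0, L0, Z => fun (g : fs_hom L0 Z) (f : 'rV[K]_1) => f 0 0 *: g
  | L1, L1, Z => fun (g : fs_hom L1 Z) (f : 'rV[K]_1) => f 0 0 *: g
  | L0, L1, L1 => fun (g : 'rV[K]_1) (f : fs_hom L0 L1) => g 0 0 *: f
  | _, _, _ => fun _ _ => 0
  end.

Lemma fs_deg_direct X Y (r : seq int) (c : int -> fs_hom X Y) :
  uniq r -> (forall d, fs_deg d (c d)) -> \sum_(d <- r) c d = 0 ->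
  forall d, d \in r -> c d = 0.
Proof.
move=> ur cd c0 d dr; apply/rowP => k; rewrite mxE.
have [dk|dk] := eqVneq d (k : nat)%:Z; last exact: cd.
have := congr1 (fun v : 'rV[K]_(fs_rank X Y) => v 0 k) c0.
rewrite /= summxE (bigD1_seq d) //= big1 ?addr0 ?mxE // => e ed.
by apply: cd; rewrite -dk.
Qed.

Lemma fs_deg_total X Y (f : fs_hom X Y) :
  exists (r : seq int) (c : int -> fs_hom X Y),
    (forall d, fs_deg d (c d)) /\ f = \sum_(d <- r) c d.
Proof.
exists [:: 0; 1], (fun d => \row_k (if d == (k : nat)%:Z then f 0 k else 0)).
split; first by move=> d k dk; rewrite mxE (negPf dk).
apply/rowP => k; rewrite !big_cons big_nil addr0 !mxE.
have : (k < 2)%N by apply: leq_trans (ltn_ord k) _; case: X Y {f k} => [] [].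
by case: (nat_of_ord k) => [|[|m]] //= _; rewrite ?addr0 ?add0r.
Qed.

Lemma fs_deg_comp X Y Z d e (g : fs_hom Y Z) (f : fs_hom X Y) :
  fs_deg e g -> fs_deg d f -> fs_deg (d + e) (fs_comp g f).
Proof.
case: X Y Z f g => [] [] [] f g ge fd k dek; rewrite /fs_comp ?mxE //.
- have [d0|d0] := eqVneq d 0; last by rewrite fd ?mul0r.
  by rewrite ge ?mulr0 //; move: dek; rewrite d0 add0r.
- have [d0|d0] := eqVneq d 0; last by rewrite fd ?mul0r.
  by rewrite ge ?mulr0 //; move: dek; rewrite d0 add0r.
- have [e0|e0] := eqVneq e 0; last by rewrite ge ?mul0r.
  by rewrite fd ?mulr0 //; move: dek; rewrite e0 addr0.
- have [d0|d0] := eqVneq d 0; last by rewrite fd ?mul0r.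
  by rewrite ge ?mulr0 //; move: dek; rewrite d0 add0r.
- have [d0|d0] := eqVneq d 0; last by rewrite fd ?mul0r.
  by rewrite ge ?mulr0 //; move: dek; rewrite d0 add0r.
Qed.

Definition FS_category : graded_category K.
Proof.
refine (@GradedCategory K vanishing_cycle fs_hom fs_deg fs_id fs_comp
          _ fs_deg_direct fs_deg_total _ fs_deg_comp _ _ _ _ _).
- move=> X Y d a f g fd gd k dk.
  by rewrite !mxE fd // gd // mulr0 addr0.
- by case=> [] k; rewrite ord1.
- by case=> [] [] [] [] h g f; apply/rowP => k;
    rewrite /fs_comp ?mxE ?ord1 ?mulrA ?mulr0 ?mul0r //; congr (_ * _);
    rewrite mulrC.
all: case=> [] []; rewrite /fs_comp /fs_id; try case; move=> *;
  apply/rowP => k; rewrite ?mxE ?ord1 ?mul1r ?mulr1 ?mulr0 ?addr0 //;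
  try ring; by case: k.
Defined.

Definition FS : tri_category := H0Tw FS_category.

End FukayaSeidel.

(* Main.v *)
(* Let T be the triangulated category generated by the Fukaya-Seidel category.

   T contains no three nonzero objects that are pairwise orthogonal, in both
   directions and for all shifts.  By Gaussian elimination every twisted complex
   is homotopy equivalent to a minimal one, with differential going only from
   copies of L0 to copies of L1.  For minimal E and F with vanishing graded Hom,
   the Hom differential is an isomorphism from the maps preserving the type
   (L0 or L1) to the maps L0 -> L1.  Counting dimensions degree by degree, with
   E_i(t) the sum of t^s over the summands L_i[s] of E, one gets
     E_0(t) F_0(1/t) + E_1(t) F_1(1/t) = (1 + 1/t) E_0(t) F_1(1/t),
   and three mutually orthogonal objects contradict these relations.

   On Y, skyscraper sheaves at distinct points x, y are orthogonal: a linear form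
   vanishing at x but not at y defines a natural transformation from the identity
   to the twist F -> F(1), zero on the skyscraper at x and invertible on the one
   at y.  Hence Y has at most two points.  Then every point is isolated, and every
   nonzero complex on Y has a shifted skyscraper as a direct summand, so L0 and L1
   correspond to shifted skyscrapers.  At distinct points these are orthogonal,
   contradicting Hom(L0, L1) <> 0; at the same point L1 would be a shift of L0,
   contradicting Hom(L1, L0[n]) = 0. *)

From HB Require Import structures.
From mathcomp Require Import all_boot all_order all_algebra.
From mathcomp Require Import boolp classical_sets reals.
From mathcomp Require Import complex mpoly ring lra zify.
Require Import Defs.

Set Implicit Arguments.
Unset Strict Implicit.
Unset Printing Implicit Defensive.

Import Order.TTheory GRing.Theory Num.Theory.
Local Open Scope ring_scope.

(** * Gaussian elimination of twisted complexes *)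

(** Three is the right number: the cones of the two generators of Hom(L0, L1) are orthogonal to each
    other. Put rho_E = E_0/E_1. The relation for (E, F) and the one for (F, E) at 1/t have the same
    left side, whence rho_E(t) = t rho_F(1/t); eliminating F leaves (rho_E - 1)(rho_E - t) = 0. The
    two cones have rho equal to t and to 1, in agreement with both. A third object forces rho_E(t) =
    t rho_E(1/t) for a single E, which fails for 1 and for t.

    Morphisms of D^b(Coh Y) are zigzags modulo a generated congruence, without a normal form.
    Equality of zigzags comes from the naturality of a linear form along each arrow; inequality
    comes from their action on stalks of cohomology, an invariant of the congruence.

    Skyscrapers split off at an isolated point because regular functions are determined by their
    values: over the open set {x} they are constants, a coherent sheaf has there a
    finite-dimensional space of sections, and a linear functional detects a cocycle that is not a
    coboundary. *)

Lemma delta_mulmx_delta (R : comNzRingType) m (M : 'M[R]_m) (a b c' d' : 'I_m) :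
  delta_mx a b *m M *m delta_mx c' d' = M b c' *: (delta_mx a d' : 'M[R]_m).
Proof.
apply/matrixP => i j; rewrite !mxE (bigD1 c') //= big1 => [|k kc]; last first.
  by rewrite !mxE (negPf kc) mulr0.
rewrite !mxE eqxx /= (bigD1 b) //= big1 => [|k kb]; last first.
  by rewrite !mxE (negPf kb) andbF mul0r.
rewrite !mxE eqxx !addr0 andbT.
by case: (i == a); case: (j == d'); rewrite ?mul1r ?mul0r ?mulr0.
Qed.

Section DifferentialMatrices.
Variable K : fieldType.
Local Notation ssum := (shifted_sum (FS_category K)).
Local Notation gmx E F := 'M[{poly K}]_(slen E, slen F).

(* A matrix over [{poly K}] encodes a morphism between formal sums of copies of
   L0 and L1: the generators of degrees 0 and 1 of Hom(L0, L1) become 1 and 'X. *)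
Definition mxdeg (E F : ssum) (d : int) (f : gmx E F) : Prop :=
  forall i j (k : nat), (f i j)`_k != 0 ->
    (k < fs_rank (sob i) (sob j))%N /\ d + ssh j - ssh i = k%:Z.

Lemma mxdeg0 E F d : mxdeg d (0 : gmx E F).
Proof. by move=> i j k; rewrite mxE coef0 eqxx. Qed.

Lemma mxdegD E F d (f g : gmx E F) : mxdeg d f -> mxdeg d g -> mxdeg d (f + g).
Proof.
move=> fd gd i j k; rewrite mxE coefD.
have [f0|/fd //] := eqVneq (f i j)`_k 0.
by rewrite f0 add0r => /gd.
Qed.

Lemma mxdegZ E F d (c : K) (f : gmx E F) : mxdeg d f -> mxdeg d (c%:P *: f).
Proof.
move=> fd i j k; rewrite mxE coefCM mulf_eq0 negb_or => /andP[_].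
exact: fd.
Qed.

Lemma mxdegN E F d (f : gmx E F) : mxdeg d f -> mxdeg d (- f).
Proof. by move=> fd i j k; rewrite mxE coefN oppr_eq0; apply: fd. Qed.

Lemma mxdeg1 E : mxdeg 0 (1%:M : gmx E E).
Proof.
move=> i j k; rewrite mxE -polyC_natr coefC.
case: k => [|k] /=; last by rewrite eqxx.
have [<- _|_] := eqVneq i j; last by rewrite eqxx.
by rewrite add0r subrr; split=> //; case: (sob i).
Qed.

(** Of two composable entries at most one runs from L0 to L1, and only such an entry can involve
    ['X]. So the exponents add up within the rank of the composite Hom space. *)
Lemma mxdegM E F G d e (f : gmx E F) (g : gmx F G) :
  mxdeg d f -> mxdeg e g -> mxdeg (d + e) (f *m g).
Proof.
move=> fd ge i k m; rewrite mxE coef_sum => s0.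
have [j /eqP] : exists j, (f i j * g j k)`_m <> 0.
  apply: contrapT => /forallNP s; move: s0; rewrite big1 ?eqxx // => j _.
  exact: contrapT (s j).
rewrite coefM => t0.
have [[a ha] /eqP /=] :
    exists a : 'I_m.+1, (f i j)`_a * (g j k)`_(m - a) <> 0.
  apply: contrapT => /forallNP s; move: t0; rewrite big1 ?eqxx // => a _.
  exact: contrapT (s a).
rewrite mulf_eq0 negb_or => /andP[/fd[fr fe] /ge[gr ee]].
split; last by lia.
by move: fr gr; case: (sob i) (sob j) (sob k) => [] [] [] /=; lia.
Qed.

(* Twisted complexes with the triangularity condition dropped; it plays no
   role in Gaussian elimination. *)
Record dmx := Dmx {
  dsum :> ssum;
  ddif : gmx dsum dsum;
  ddif_deg : mxdeg 1 ddif;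
  ddif_sq : ddif *m ddif = 0
}.

(** Composition is written from left to right: [f *m dF] is delta_F f and [dE *m f] is f delta_E.
    Cocycles of degree d satisfy delta f = (-1)^d f delta; the plus sign in the conclusion is the
    one for [h], of degree d - 1. *)
Definition acyclic_at (E F : ssum) (dE : gmx E E) (dF : gmx F F) (d : int) :=
  forall f : gmx E F, mxdeg d f ->
    f *m dF = ((-1 : K) ^ d)%:P *: (dE *m f) ->
    exists2 h : gmx E F, mxdeg (d - 1) h &
      f = h *m dF + ((-1 : K) ^ d)%:P *: (dE *m h).

Definition hom_acyclic (E F : dmx) : Prop :=
  forall d, acyclic_at (ddif E) (ddif F) d.

Definition contractible (E : dmx) : Prop :=
  exists2 h : gmx E E, mxdeg (-1) h & 1%:M = h *m ddif E + ddif E *m h.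

(** A strict direct summand: this is what transports acyclicity of Hom complexes. That a
    non-contractible [E] keeps a non-contractible summand is tracked separately, by
    [elim_contractible]. *)
Record retract (E M : dmx) := Retract {
  rinc : gmx M E;
  rprj : gmx E M;
  rinc_deg : mxdeg 0 rinc;
  rprj_deg : mxdeg 0 rprj;
  rincC : rinc *m ddif E = ddif M *m rinc;
  rprjC : rprj *m ddif M = ddif E *m rprj;
  rincK : rinc *m rprj = 1%:M
}.

Lemma retract_acyclicl E M F :
  retract E M -> hom_acyclic E F -> hom_acyclic M F.
Proof.
case=> i p id_ pd iC pC ip aEF d f fd fC.
have pfd : mxdeg d (p *m f) by rewrite -[d]add0r; apply: mxdegM.
have [|h hd ph] := aEF d (p *m f) pfd.
  by rewrite -mulmxA fC -scalemxAr !mulmxA pC.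
exists (i *m h); first by rewrite -[d - 1]add0r; apply: mxdegM.
rewrite -[f]mul1mx -ip -mulmxA ph mulmxDr -scalemxAr !mulmxA.
by rewrite iC.
Qed.

Lemma retract_acyclicr E M F :
  retract E M -> hom_acyclic F E -> hom_acyclic F M.
Proof.
case=> i p id_ pd iC pC ip aEF d f fd fC.
have pfd : mxdeg d (f *m i) by rewrite -[d]addr0; apply: mxdegM.
have [|h hd ph] := aEF d (f *m i) pfd.
  by rewrite -mulmxA iC mulmxA fC -scalemxAl -!mulmxA.
exists (h *m p); first by rewrite -[d - 1]addr0; apply: mxdegM.
rewrite -[f]mulmx1 -ip mulmxA ph mulmxDl -scalemxAl -!mulmxA.
by rewrite pC.
Qed.

Lemma retract_trans E M N : retract E M -> retract M N -> retract E N.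
Proof.
case=> i p id_ pd iC pC ip [j q jd qd jC qC jq].
exists (j *m i) (p *m q).
- by rewrite -[0]add0r; apply: mxdegM.
- by rewrite -[0]add0r; apply: mxdegM.
- by rewrite -mulmxA iC !mulmxA jC.
- by rewrite -mulmxA qC !mulmxA pC.
- by rewrite mulmxA -[j *m i *m p]mulmxA ip mulmx1.
Qed.

Lemma retract_refl E : retract E E.
Proof.
by exists 1%:M 1%:M; rewrite ?mul1mx ?mulmx1 //; apply: mxdeg1.
Qed.

Definition minimal (M : dmx) : Prop :=
  forall i j, sob i = sob j -> ddif M i j = 0.

Section Elimination.
Variables (E : dmx) (x y : 'I_(slen E)).
Hypotheses (xy : sob x = sob y) (Exy : ddif E x y != 0).
Local Notation n := (slen E).
Local Notation D := (ddif E).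

Let c : K := (D x y)`_0.

(** Between equal types the Hom space has rank 1, so a nonzero entry is an invertible scalar. *)
Let DxyE : D x y = c%:P.
Proof.
apply/polyP => k; rewrite coefC; case: k => [//|k] /=.
have [//|/(ddif_deg)[]] := eqVneq (D x y)`_k.+1 0.
by rewrite xy; case: (sob y).
Qed.

Let c0 : c != 0.
Proof. by move: Exy; rewrite DxyE polyC_eq0. Qed.

Let sxy : ssh x = ssh y + 1.
Proof. by have [_] := ddif_deg c0; lia. Qed.

Let xNy : x != y.
Proof. by apply/eqP => e; move: sxy; rewrite e; lia. Qed.

(* [h] contracts the summand spanned by x and y, and [p] projects onto a
   complement of the subcomplex generated by it. *)
Let h : 'M[{poly K}]_n := (c^-1)%:P *: delta_mx y x.
Let e := h *m D + D *m h.
Let p := 1%:M - e.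

Let hDh : h *m D *m h = h.
Proof.
rewrite /h -!scalemxAl -scalemxAr delta_mulmx_delta DxyE !scalerA.
by rewrite -!polyCM -?mulrA mulVf // mulr1.
Qed.

Let hh : h *m h = 0.
Proof.
rewrite /h -scalemxAl -scalemxAr mul_delta_mx_0 ?scaler0 //.
Qed.

Let DD : D *m D = 0. Proof. exact: ddif_sq. Qed.

Let eD : e *m D = D *m e.
Proof.
by rewrite /e mulmxDl mulmxDr -mulmxA DD mulmx0 add0r !mulmxA DD mul0mx addr0.
Qed.

(** From h D h = h and h h = 0 follows e h = h; since [e] commutes with [D], e (h D + D h) = h D + D
    h. *)
Let ee : e *m e = e.
Proof.
have eh : e *m h = h.
  by rewrite /e mulmxDl hDh -mulmxA hh mulmx0 addr0.
by rewrite {2}/e mulmxDr !mulmxA eh eD -mulmxA eh.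
Qed.

Let pp : p *m p = p.
Proof. by rewrite /p mulmxBl mul1mx mulmxBr mulmx1 ee subrr subr0. Qed.

Let pD : p *m D = D *m p.
Proof. by rewrite /p mulmxBl mulmxBr mul1mx mulmx1 eD. Qed.

Definition elim_keep : {set 'I_n} := ~: [set x; y].
Local Notation R := elim_keep.

Definition elim_sum : ssum :=
  @ShiftedSum K (FS_category K) #|R| (fun k => sob (enum_val k))
    (fun k => ssh (enum_val k)).

Let inc : gmx elim_sum E := \matrix_(k, i) ((enum_val k == i)%:R).

Let inc_deg : mxdeg 0 inc.
Proof.
move=> k i m; rewrite mxE -polyC_natr coefC.
case: m => [|m] /=; last by rewrite eqxx.
have [<- _|_] := eqVneq (enum_val k) i; last by rewrite eqxx.
by rewrite add0r subrr; split=> //; case: (sob _).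
Qed.

Let rst : gmx E elim_sum := inc^T.

Let rst_deg : mxdeg 0 rst.
Proof.
move=> i k m; rewrite !mxE -polyC_natr coefC.
case: m => [|m] /=; last by rewrite eqxx.
have [<- _|_] := eqVneq (enum_val k) i; last by rewrite eqxx.
by rewrite add0r subrr; split=> //; case: (sob _).
Qed.

Let inc_rst : inc *m rst = 1%:M.
Proof.
apply/matrixP => k l; rewrite !mxE (bigD1 (enum_val k)) //= big1 ?addr0.
  by rewrite !mxE eqxx mul1r eq_sym (inj_eq enum_val_inj).
by move=> i ik; rewrite !mxE eq_sym (negPf ik) mul0r.
Qed.

Let rst_inc : rst *m inc = 1%:M - delta_mx x x - delta_mx y y.
Proof.
apply/matrixP => i j; rewrite !mxE.
have [iR|iR] := boolP (i \in R).
  rewrite (bigD1 (enum_rank_in iR i)) //= big1 ?addr0.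
    rewrite !mxE enum_rankK_in // eqxx mul1r.
    by move: iR; rewrite !inE negb_or => /andP[/negPf-> /negPf->]; rewrite !subr0.
  move=> k; rewrite !mxE; have [ki|_] := eqVneq (enum_val k) i; last by rewrite mul0r.
  by case/eqP; apply: enum_val_inj; rewrite enum_rankK_in.
rewrite big1 => [|k _]; last first.
  rewrite !mxE; have [ki|_] := eqVneq (enum_val k) i; last by rewrite mul0r.
  by move: iR; rewrite -ki enum_valP.
move: iR; rewrite !inE negbK => /orP[] /eqP->.
  by rewrite eqxx (negPf xNy) subr0 eq_sym subrr.
by rewrite eqxx (eq_sym y x) (negPf xNy) subr0 eq_sym subrr.
Qed.

Let inc_h : inc *m h = 0.
Proof.
apply/matrixP => k i; rewrite /h -scalemxAr !mxE big1 ?mulr0 // => j _.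
rewrite !mxE; have [kj|_] := eqVneq (enum_val k) j; last by rewrite mul0r.
have := enum_valP k; rewrite kj !inE negb_or => /andP[_ /negPf->].
by rewrite mulr0.
Qed.

Let h_rst : h *m rst = 0.
Proof.
apply/matrixP => i k; rewrite /h -scalemxAl !mxE big1 ?mulr0 // => j _.
rewrite !mxE; have [kj|_] := eqVneq (enum_val k) j; last by rewrite mulr0.
have := enum_valP k; rewrite kj !inE negb_or => /andP[/negPf-> _].
by rewrite andbF mul0r.
Qed.

Let xp : delta_mx x x *m p = 0.
Proof.
rewrite /p /e mulmxBr mulmx1 mulmxDr !mulmxA.
rewrite -[delta_mx x x *m h]scalemxAr mul_delta_mx_0 // scaler0 mul0mx add0r.
rewrite -scalemxAr delta_mulmx_delta DxyE scalerA -polyCM mulVf //.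
by rewrite scale1r subrr.
Qed.

Let py : p *m delta_mx y y = 0.
Proof.
rewrite /p /e mulmxBl mul1mx mulmxDl -[D *m h *m _]mulmxA.
rewrite -[h *m delta_mx y y]scalemxAl mul_delta_mx_0 // scaler0 mulmx0 addr0.
rewrite -!scalemxAl delta_mulmx_delta DxyE scalerA -polyCM mulVf //.
by rewrite scale1r subrr.
Qed.

(** Row x and column y of [p] vanish, so deleting the coordinates x and y between two copies of [p]
    loses nothing. *)
Let prip : p *m (rst *m inc) *m p = p.
Proof.
have pB a b : p *m (1%:M - a - b) = p - p *m a - p *m b.
  by rewrite 2!(mulmxBr p) mulmx1.
by rewrite rst_inc pB py subr0 (mulmxBl p _ p) pp -mulmxA xp mulmx0 subr0.
Qed.

Let h_deg : mxdeg (-1) h.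
Proof.
move=> i j k; rewrite !mxE coefCM -polyC_natr coefC.
case: k => [|k] /=; last by rewrite mulr0 eqxx.
have [->|] := eqVneq i y; last by rewrite mulr0 eqxx.
have [->|] := eqVneq j x; last by rewrite mulr0 eqxx.
move=> _; split; last by rewrite sxy; lia.
by rewrite xy; case: (sob y).
Qed.

Let p_deg : mxdeg 0 p.
Proof.
apply: mxdegD; first exact: mxdeg1.
apply: mxdegN; apply: mxdegD.
  have := mxdegM h_deg (@ddif_deg E).
  by rewrite addNr.
have := mxdegM (@ddif_deg E) h_deg.
by rewrite subrr.
Qed.

(** Expanding [p] gives the Gaussian elimination formula D_kl - D_ky c^-1 D_xl. The symmetric form
    with [p] on both sides makes the square vanish by [prip] and D D = 0. *)
Definition elim_dif : gmx elim_sum elim_sum := inc *m p *m D *m p *m rst.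

Let mid_deg : mxdeg 1 elim_dif.
Proof.
have a1 := mxdegM (mxdegM (mxdegM (mxdegM inc_deg p_deg) (@ddif_deg E)) p_deg) rst_deg.
by rewrite !add0r !addr0 in a1.
Qed.

Let mid_sq : elim_dif *m elim_dif = 0.
Proof.
rewrite /elim_dif.
transitivity (inc *m p *m D *m (p *m (rst *m inc) *m p) *m D *m p *m rst).
  by rewrite !mulmxA.
rewrite prip -[inc *m p *m D *m p]mulmxA -pD mulmxA -[_ *m D *m D]mulmxA DD.
by rewrite mulmx0 !mul0mx.
Qed.

Definition elim_dmx : dmx := Dmx mid_deg mid_sq.

(** The correction e = h D + D h disappears between [inc] and [rst], because inc h = 0 and h rst =
    0. *)
Lemma elim_retract : retract E elim_dmx.
Proof.
exists (inc *m p : gmx elim_dmx E) (p *m rst : gmx E elim_dmx).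
- by have := mxdegM inc_deg p_deg; rewrite addr0.
- by have := mxdegM p_deg rst_deg; rewrite addr0.
- rewrite /= /elim_dif.
  transitivity (inc *m p *m D *m (p *m (rst *m inc) *m p)); last by rewrite !mulmxA.
  by rewrite prip -[RHS]mulmxA -pD mulmxA -[inc *m p *m p]mulmxA pp.
- rewrite /= /elim_dif.
  transitivity ((p *m (rst *m inc) *m p) *m D *m p *m rst); first by rewrite !mulmxA.
  by rewrite prip pD -[D *m p *m p]mulmxA pp mulmxA.
- rewrite mulmxA -[inc *m p *m p]mulmxA pp /p mulmxBr mulmx1 mulmxBl inc_rst.
  rewrite /e mulmxDr mulmxA inc_h mul0mx add0r !mulmxA.
  by rewrite -[_ *m h *m rst]mulmxA h_rst mulmx0 subr0.
Qed.

(** A contraction of [E] is the sum of [h], which contracts the image of [e], and of the given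
    contraction transported to the image of [p]. *)
Lemma elim_contractible : contractible elim_dmx -> contractible E.
Proof.
case=> k kd k1.
exists (h + p *m rst *m k *m inc *m p).
  apply: mxdegD h_deg _.
  have a1 := mxdegM (mxdegM (mxdegM (mxdegM p_deg rst_deg) kd) inc_deg) p_deg.
  by rewrite !add0r !addr0 in a1.
have -> : 1%:M = e + p *m (rst *m 1%:M *m inc) *m p :> 'M[{poly K}]_n.
  by rewrite mulmx1 prip /p addrC subrK.
set X := p *m rst *m k *m inc *m p.
have XD : p *m (rst *m (k *m elim_dif) *m inc) *m p = X *m D.
  transitivity (p *m rst *m k *m inc *m p *m D *m (p *m (rst *m inc) *m p)).
    by rewrite /elim_dif !mulmxA.
  by rewrite prip -[LHS]mulmxA -pD mulmxA -[_ *m p *m p]mulmxA pp.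
have DX : p *m (rst *m (elim_dif *m k) *m inc) *m p = D *m X.
  transitivity ((p *m (rst *m inc) *m p) *m D *m p *m rst *m k *m inc *m p).
    by rewrite /elim_dif !mulmxA.
  by rewrite prip pD -[D *m p *m p]mulmxA pp /X !mulmxA.
rewrite k1 (mulmxDr rst) (mulmxDl _ _ inc) (mulmxDr p) (mulmxDl _ _ p) XD DX.
by rewrite (mulmxDl h) (mulmxDr D) /e addrACA.
Qed.

Lemma elim_slen : (slen elim_dmx < slen E)%N.
Proof.
rewrite /= -[X in (_ < X)%N](card_ord n) -cardsT; apply: proper_card.
by apply/properP; split; [exact: finset.subsetT|exists x; rewrite !inE ?eqxx].
Qed.

End Elimination.

(** Any nonzero entry between equal types can be eliminated, and the number of summands drops each
    time. *)
Lemma minimal_retract (E : dmx) : ~ contractible E ->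
  exists M : dmx, [/\ minimal M, ~ contractible M & inhabited (retract E M)].
Proof.
have [m] := ubnP (slen E); elim: m E => // m IH E Em nE.
have [mE|] := EM (minimal E).
  by exists E; split=> //; split; apply: retract_refl.
move=> /existsNP[x /existsNP[y /not_implyP[xy /eqP Exy]]].
have [|nM|M [mM cM [rM]]] := IH (elim_dmx xy Exy).
- exact: leq_trans (elim_slen xy Exy) _.
- exact/nE/(elim_contractible nM).
- exists M; split=> //; split.
  exact: retract_trans (elim_retract xy Exy) rM.
Qed.

End DifferentialMatrices.

(** * Dimension count for minimal complexes *)

Section CardLinear.
Variables (K : fieldType) (S T : finType) (A : {set S}) (B : {set T}).
Variable phi : (S -> K) -> T -> K.
Hypothesis phi_linear : forall a u v t,
  phi (fun s => a * u s + v s) t = a * phi u t + phi v t.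

(** The matrix of [phi] from functions supported on [A] to restrictions to [B]; both cardinality
    bounds compare its rank with its size. *)
Let M : 'M[K]_(#|A|, #|B|) :=
  \matrix_(a, b) phi (fun s => (s == enum_val a)%:R) (enum_val b).

Let ext (r : 'rV[K]_#|A|) : S -> K :=
  fun s => \sum_a r 0 a * (s == enum_val a)%:R.

Let phi0 t : phi (fun=> 0) t = 0.
Proof.
have e := phi_linear (-1) (fun=> 0) (fun=> 0) t.
have z : (fun s : S => -1 * 0 + 0 : K) = fun=> 0.
  by apply/funext => s; rewrite mulr0 addr0.
by rewrite z mulN1r addNr in e.
Qed.

Let phi_ext r b : phi (ext r) (enum_val b) = (r *m M) 0 b.
Proof.
rewrite /ext mxE.
suff H (s : seq 'I_#|A|) :
    phi (fun x => \sum_(a <- s) r 0 a * (x == enum_val a)%:R) (enum_val b)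
    = \sum_(a <- s) r 0 a * M a b by exact: H.
elim: s => [|a s IH].
  rewrite big_nil -[RHS](phi0 (enum_val b)); congr phi.
  by apply/funext => x; rewrite big_nil.
rewrite big_cons -IH mxE -phi_linear; congr phi.
by apply/funext => x; rewrite big_cons.
Qed.

Let ext_out r s : s \notin A -> ext r s = 0.
Proof.
move=> sA; rewrite /ext big1 // => a _.
have [e|_] := eqVneq s (enum_val a); last by rewrite mulr0.
by move: sA; rewrite e enum_valP.
Qed.

Let ext_in r a : ext r (enum_val a) = r 0 a.
Proof.
rewrite /ext (bigD1 a) //= eqxx mulr1 big1 ?addr0 // => b ba.
by rewrite (inj_eq enum_val_inj) eq_sym (negPf ba) mulr0.
Qed.

Lemma card_le_inj :
  (forall u, (forall s, s \notin A -> u s = 0) ->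
     (forall t, t \in B -> phi u t = 0) -> forall s, u s = 0) ->
  (#|A| <= #|B|)%N.
Proof.
move=> inj; have : row_free M.
  apply: inj_row_free => r rM; apply/rowP => a; rewrite mxE -ext_in.
  apply: inj => [s|t tB]; first exact: ext_out.
  by rewrite -(enum_rankK_in tB tB) phi_ext rM mxE.
by rewrite /row_free => /eqP <-; apply: rank_leq_col.
Qed.

Lemma card_le_surj :
  (forall w : T -> K, (forall t, t \notin B -> w t = 0) ->
     exists2 u, (forall s, s \notin A -> u s = 0) &
       forall t, t \in B -> phi u t = w t) ->
  (#|B| <= #|A|)%N.
Proof.
move=> surj; have : row_full M.
  rewrite -sub1mx; apply/row_subP => b.
  have [t tB|u uA uw] := surj (fun t => (t == enum_val b)%:R).
    have [e|//] := eqVneq t (enum_val b).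
    by move: tB; rewrite e enum_valP.
  apply/submxP; exists (\row_a u (enum_val a)).
  apply/rowP => b'; rewrite -phi_ext [LHS]mxE [LHS]mxE.
  have -> : ext (\row_a u (enum_val a)) = u.
    apply/funext => s; have [sA|sA] := boolP (s \in A); last first.
      by rewrite ext_out // uA.
    by rewrite -(enum_rankK_in sA sA) ext_in mxE.
  by rewrite uw ?enum_valP // (inj_eq enum_val_inj) eq_sym.
by rewrite /row_full => /eqP <-; apply: rank_leq_row.
Qed.

End CardLinear.

(** Both sums run over the same multiset of integers, counted level by level. *)
Lemma sum_level (R : nmodType) (S T : finType) (A : {pred S}) (B : {pred T})
    (g : S -> int) (g' : T -> int) (f : int -> R) :
  (forall d, #|[set x in A | g x == d]| = #|[set y in B | g' y == d]|) ->
  \sum_(x in A) f (g x) = \sum_(y in B) f (g' y).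
Proof.
move=> AB; rewrite -(big_image _ _ g A f) -(big_image _ _ g' B f).
have cnt (U : finType) (C : {pred U}) (k : U -> int) d :
    count_mem d [seq k x | x in C] = #|[set x in C | k x == d]|.
  rewrite count_map cardsE cardE -size_filter; congr size.
  by rewrite /enum_mem -filter_predI; apply: eq_filter => x; rewrite !inE andbC.
by apply: perm_big; apply/allP => d _ /=; rewrite !cnt AB.
Qed.

Definition isL1 (X : vanishing_cycle) : bool := if X is L1 then true else false.

Lemma isL1_inj : injective isL1.
Proof. by case=> [] []. Qed.

(** Meant for the weights aF, aT of one object at t and cF, cT of an orthogonal one at 1/t: a
    nonzero minimal object contains copies of both L0 and L1, which later allows division by any
    weight. *)
Lemma weights_neq0 (F : fieldType) (aF aT cF cT t : F) : t != 0 ->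
  aF * cF + aT * cT = aF * cT * (1 + t^-1) -> aF * cT = t * (cF * aT) ->
  ~~ ((aF == 0) && (aT == 0)) -> ~~ ((cF == 0) && (cT == 0)) ->
  aF != 0 /\ aT != 0.
Proof.
move=> t0 r r2 a0 c0.
have aT0 : aT != 0.
  apply: contraNneq a0 => aT0; move: r r2; rewrite aT0 eqxx andbT !mulr0 mul0r addr0.
  move=> r /eqP; rewrite mulf_eq0 => /orP[//|/eqP cT0].
  move: r c0; rewrite cT0 eqxx andbT mulr0 mul0r => /eqP.
  by rewrite mulf_eq0 => /orP[//|->].
split=> //; apply: contraNneq a0 => aF0; move: r r2; rewrite aF0 eqxx /= !mul0r add0r.
move=> r /esym/eqP; rewrite !mulf_eq0 (negPf t0) (negPf aT0) orbF => /= cF0.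
by move: c0; rewrite cF0 /=; move/eqP: r; rewrite mulf_eq0 (negPf aT0) => /= ->.
Qed.

Lemma signzS (K : fieldType) (d : int) : (-1 : K) ^ (d + 1) = - (-1) ^ d.
Proof. by rewrite expfzDr ?oppr_eq0 ?oner_eq0 // expr1z mulrN1. Qed.

Section Counting.
Variable K : fieldType.
Local Notation ssum := (shifted_sum (FS_category K)).
Local Notation gmx E F := 'M[{poly K}]_(slen E, slen F).
Definition type1 (E : ssum) (i : 'I_(slen E)) : bool := isL1 (sob i).
Local Notation b1 := type1.

Lemma mxdeg_tri (E F : ssum) d (f : gmx E F) i j :
  mxdeg d f -> b1 i -> ~~ b1 j -> f i j = 0.
Proof.
move=> fd i1 j0; apply/polyP => k; rewrite coef0.
have [//|/fd[]] := eqVneq (f i j)`_k 0.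
by rewrite /type1 in i1 j0 *; case: (sob i) (sob j) i1 j0 => [] [].
Qed.

Lemma minimal_tri (M : dmx K) i j :
  minimal M -> b1 i || ~~ b1 j -> ddif M i j = 0.
Proof.
move=> mM ij; have [bij|bij] := eqVneq (b1 i) (b1 j).
  by apply: mM; apply: isL1_inj.
by apply: (mxdeg_tri (@ddif_deg _ M)); move: ij bij; case: (b1 i) (b1 j) => [] [].
Qed.

Section Minimal.
Variables (E F : dmx K).
Hypotheses (mE : minimal E) (mF : minimal F) (aEF : hom_acyclic E F).

Variable d : int.

(* The matrix entries and coefficients of the degree-d morphisms that preserve
   the type (L0 or L1), and of the degree-(d+1) morphisms that change it.  The
   differential of the Hom complex of minimal E and F maps the former to the
   latter and vanishes otherwise. *)
Definition diag_pos :=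
  [set ij : 'I_(slen E) * 'I_(slen F) | (b1 ij.1 == b1 ij.2) && (d + ssh ij.2 - ssh ij.1 == 0)].

Definition off_pos :=
  [set ijk : 'I_(slen E) * 'I_(slen F) * 'I_2 | [&& ~~ b1 ijk.1.1, b1 ijk.1.2 &
    d + 1 + ssh ijk.1.2 - ssh ijk.1.1 == (ijk.2 : nat)%:Z]].

Let cst (u : 'I_(slen E) * 'I_(slen F) -> K) : gmx E F :=
  \matrix_(i, j) (u (i, j))%:P.

Let dif (h : gmx E F) : gmx E F :=
  h *m ddif F - ((-1 : K) ^ d)%:P *: (ddif E *m h).

Let phi (u : 'I_(slen E) * 'I_(slen F) -> K) (t : 'I_(slen E) * 'I_(slen F) * 'I_2)
  : K := (dif (cst u) t.1.1 t.1.2)`_t.2.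

Let phi_linear a u v t : phi (fun s => a * u s + v s) t = a * phi u t + phi v t.
Proof.
have cstl : cst (fun s => a * u s + v s) = a%:P *: cst u + cst v.
  by apply/matrixP => i j; rewrite !mxE polyCD polyCM.
rewrite /phi cstl /dif mulmxDl mulmxDr -scalemxAl -scalemxAr scalerDr.
rewrite scalerA mulrC -scalerA opprD addrACA -scalerBr.
by rewrite mxE coefD [in X in X + _]mxE coefCM.
Qed.

Let h_mulF (h : gmx E F) i j e : mxdeg e h -> b1 i || ~~ b1 j ->
  (h *m ddif F) i j = 0.
Proof.
move=> hd ij; rewrite mxE big1 // => l _.
have [j1|j0] := boolP (b1 j); last by rewrite (minimal_tri mF) ?mulr0 // j0 orbT.
have [l1|l0] := boolP (b1 l); first by rewrite (minimal_tri mF) ?mulr0 // l1.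
by rewrite (mxdeg_tri hd) ?mul0r //; move: ij; rewrite j1 orbF.
Qed.

Let E_mulh (h : gmx E F) i j e : mxdeg e h -> b1 i || ~~ b1 j ->
  (ddif E *m h) i j = 0.
Proof.
move=> hd ij; rewrite mxE big1 // => l _.
have [i1|i0] := boolP (b1 i); first by rewrite (minimal_tri mE) ?mul0r // i1.
have [l1|l0] := boolP (b1 l); last by rewrite (minimal_tri mE) ?mul0r // l0 orbT.
by rewrite (mxdeg_tri hd) ?mulr0 //; move: ij; rewrite (negPf i0).
Qed.

Let cst_deg u : (forall s, s \notin diag_pos -> u s = 0) -> mxdeg d (cst u).
Proof.
move=> uS i j k; rewrite mxE coefC; case: k => [|k] /=; last by rewrite eqxx.
have [ijS _|ijS] := boolP ((i, j) \in diag_pos); last by rewrite uS ?eqxx.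
move: ijS; rewrite inE => /andP[/= /eqP bij /eqP ->]; split=> //.
by move: bij; rewrite /type1; case: (sob i) (sob j) => [] [].
Qed.

(** Injectivity of the Hom differential: a type-preserving cocycle is a coboundary by acyclicity,
    but coboundaries have entries only from L0 to L1, so it vanishes. *)
Lemma diag_le_off : (#|diag_pos| <= #|off_pos|)%N.
Proof.
apply: (card_le_inj phi_linear) => u uS phi0 [i j].
have [ijS|ijS] := boolP ((i, j) \in diag_pos); last exact: uS.
have ud := cst_deg uS.
have dd : mxdeg (d + 1) (dif (cst u)).
  apply: mxdegD; first exact: mxdegM (@ddif_deg _ F).
  by apply: mxdegN; apply: mxdegZ; rewrite addrC; apply: mxdegM (@ddif_deg _ E) ud.
have d0 : dif (cst u) = 0.
  apply/matrixP => a b; apply/polyP => k; rewrite [in RHS]mxE coef0.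
  have [ab|] := boolP (b1 a || ~~ b1 b).
    rewrite /dif mxE [in X in _ + X]mxE [in X in _ - X]mxE.
    by rewrite (h_mulF ud) // (E_mulh ud) // mulr0 subr0 coef0.
  rewrite negb_or negbK => /andP[a0 bb1].
  have [//|k0] := eqVneq (dif (cst u) a b)`_k 0.
  have [kr ke] := dd _ _ _ k0.
  have k2 : (k < 2)%N by apply: leq_trans kr _; case: (sob a) (sob b) => [] [].
  have := phi0 (a, b, Ordinal k2); rewrite /phi /=; apply.
  by rewrite inE /= a0 bb1 ke eqxx.
have [|h hd hE] := aEF ud; first by apply/eqP; rewrite -subr_eq0 -/(dif _) d0.
have ij : b1 i || ~~ b1 j.
  by move: ijS; rewrite inE /= => /andP[/eqP-> _]; rewrite orbN.
have : cst u i j = 0.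
  rewrite hE mxE [in X in _ + X]mxE.
  by rewrite (h_mulF hd) // (E_mulh hd) // mulr0 addr0.
by rewrite mxE => /eqP; rewrite polyC_eq0 => /eqP.
Qed.

(** Surjectivity: a map with entries only from L0 to L1 is a cocycle, hence the coboundary of some
    [h]. The entries of [h] from L0 to L1 never meet a nonzero entry of the differentials, so
    keeping the type-preserving constants of [h] yields the same coboundary. *)
Lemma off_le_diag : (#|off_pos| <= #|diag_pos|)%N.
Proof.
apply: (card_le_surj phi_linear) => w wS.
pose W : gmx E F := \matrix_(i, j) \poly_(k < 2) w (i, j, inord k).
have WE i j (k : 'I_2) : (W i j)`_k = w (i, j, k).
  by rewrite mxE coef_poly ltn_ord inord_val.
have Wd : mxdeg (d + 1) W.
  move=> i j k; rewrite mxE coef_poly.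
  have [k2|] := ltnP k 2; last by rewrite eqxx.
  have [+ _|ijS] := boolP ((i, j, inord k) \in off_pos); last by rewrite wS ?eqxx.
  rewrite inE /= inordK // => /and3P[i0 j1 /eqP ->]; split=> //.
  by move: i0 j1; rewrite /type1; case: (sob i) (sob j) => [] [].
have W0 i j : b1 i || ~~ b1 j -> W i j = 0.
  move=> ij; apply/polyP => k; rewrite coef0 mxE coef_poly.
  case: ifP => // _; apply: wS; rewrite inE /=.
  by move: ij; case: (b1 i) (b1 j) => [] [].
have WF : W *m ddif F = 0.
  apply/matrixP => i j; rewrite !mxE big1 // => l _.
  have [l1|l0] := boolP (b1 l); first by rewrite (minimal_tri mF) ?mulr0 // l1.
  by rewrite W0 ?mul0r // l0 orbT.
have EW : ddif E *m W = 0.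
  apply/matrixP => i j; rewrite !mxE big1 // => l _.
  have [l1|l0] := boolP (b1 l); first by rewrite W0 ?mulr0 // l1.
  by rewrite (minimal_tri mE) ?mul0r // l0 orbT.
have [|h] := aEF Wd; first by rewrite WF EW scaler0.
rewrite addrK => hd hW.
exists (fun s => if b1 s.1 == b1 s.2 then (h s.1 s.2)`_0 else 0).
  move=> [i j]; rewrite inE /=; case: ifP => //= _ sij.
  by have [//|/hd[_ /eqP]] := eqVneq (h i j)`_0 0; rewrite (negPf sij).
move=> [[i j] k] /= _; rewrite /phi /= -WE hW /dif signzS polyCN scaleNr.
set U := cst _.
have hU a b : b1 a || ~~ b1 b -> U a b = h a b.
  move=> ab; rewrite mxE /=; apply/polyP => m.
  case: ifP => ab1; last first.
    by rewrite (mxdeg_tri hd) ?coefC ?coef0 ?if_same //; move: ab ab1; case: (b1 a) (b1 b) => [] [].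
  rewrite coefC; case: m => //= m.
  have [//|/hd[]] := eqVneq (h a b)`_m.+1 0.
  by move: ab1; rewrite /type1; case: (sob a) (sob b) => [] [].
have -> : U *m ddif F = h *m ddif F.
  apply/matrixP => a b; rewrite !mxE; apply: eq_bigr => l _.
  have [l1|l0] := boolP (b1 l); first by rewrite (minimal_tri mF) ?mulr0 // l1.
  by rewrite hU // l0 orbT.
have -> // : ddif E *m U = ddif E *m h.
apply/matrixP => a b; rewrite !mxE; apply: eq_bigr => l _.
have [l1|l0] := boolP (b1 l); first by rewrite hU // l1.
by rewrite (minimal_tri mE) ?mul0r // l0 orbT.
Qed.

Lemma card_diag_off : #|diag_pos| = #|off_pos|.
Proof. by apply/eqP; rewrite eqn_leq diag_le_off off_le_diag. Qed.

End Minimal.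

(** The Laurent polynomial E_0 or E_1, evaluated at a rational number: at t > 0 all terms are
    positive, so that nothing cancels. *)
Definition weight (E : ssum) (b : bool) (t : rat) : rat :=
  \sum_(i < slen E | b1 i == b) t ^ ssh i.

(** Expanding both sides gives sums of powers of t over [diag_pos] and [off_pos]; the terms t^d on
    the two sides are equinumerous by [card_diag_off]. The factor 1 + t^-1 is the sum of t^(k-1)
    over the degrees k = 0, 1 of the generators of Hom(L0, L1). *)
Lemma weight_relation (E F : dmx K) (t : rat) :
  minimal E -> minimal F -> hom_acyclic E F -> t != 0 ->
  weight E false t * weight F false t^-1 + weight E true t * weight F true t^-1
  = weight E false t * weight F true t^-1 * (1 + t^-1).
Proof.
move=> mE mF aEF t0.
have wM b b' : weight E b t * weight F b' t^-1
    = \sum_(ij : 'I_(slen E) * 'I_(slen F) | (b1 ij.1 == b) && (b1 ij.2 == b'))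
        t ^ (ssh ij.1 - ssh ij.2).
  rewrite /weight big_distrlr /= pair_big /=; apply: eq_bigr => ij _.
  by rewrite expfzDr // exprz_inv.
have -> : weight E false t * weight F false t^-1
    + weight E true t * weight F true t^-1
  = \sum_(ij in [set ij : 'I_(slen E) * 'I_(slen F) | b1 ij.1 == b1 ij.2])
      t ^ (ssh ij.1 - ssh ij.2).
  rewrite !wM [RHS](bigID (fun ij => b1 ij.1)) /= addrC.
  congr (_ + _); apply: eq_bigl => ij; rewrite inE /=;
    by case: (b1 ij.1) (b1 ij.2) => [] [].
have -> : weight E false t * weight F true t^-1 * (1 + t^-1)
  = \sum_(ijk in [set ijk : 'I_(slen E) * 'I_(slen F) * 'I_2 |
                    ~~ b1 ijk.1.1 && b1 ijk.1.2])
      t ^ (ssh ijk.1.1 - ssh ijk.1.2 + (ijk.2 : nat)%:Z - 1).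
  have -> : 1 + t^-1 = \sum_(k < 2) t ^ ((k : nat)%:Z - 1).
    by rewrite !big_ord_recl big_ord0 /= addr0 addrC sub0r subrr expr0z exprN1.
  rewrite wM big_distrlr /= pair_big /=; apply: eq_big => [[[i j] k]|[[i j] k] _].
    by rewrite inE /= andbT eqbF_neg eqb_id.
  by rewrite -expfzDr // addrA.
apply: (@sum_level _ _ _ _ _ (fun ij : 'I_(slen E) * 'I_(slen F) =>
  ssh ij.1 - ssh ij.2) (fun ijk : 'I_(slen E) * 'I_(slen F) * 'I_2 =>
  ssh ijk.1.1 - ssh ijk.1.2 + (ijk.2 : nat)%:Z - 1) (fun n => t ^ n)) => d.
transitivity #|diag_pos E F d|.
  apply: eq_card => -[i j]; rewrite !inE /=; congr (_ && _); lia.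
rewrite (card_diag_off mE mF aEF); apply: eq_card => -[[i j] k].
rewrite !inE /= -andbA; congr [&& _, _ & _]; lia.
Qed.

Lemma weight_neq0 E b t (i : 'I_(slen E)) : 0 < t -> b1 i = b -> weight E b t != 0.
Proof.
move=> t0 ib; rewrite gt_eqF // /weight (bigD1 i) ?ib ?eqxx //=.
apply: ltr_pwDl; first by rewrite exprz_gt0.
by apply: sumr_ge0 => j _; rewrite exprz_ge0 // ltW.
Qed.

(** Clears denominators. A product of weights that vanishes at each t says only that some factor
    vanishes, possibly a different one for each t; in the domain of polynomials one factor is
    identically zero. *)
Lemma weight_poly (E : ssum) : exists (N : nat) (p : bool -> {poly rat}),
  forall b t, t != 0 -> (p b).[t] = t ^+ N * weight E b t.
Proof.
pose N := \sum_(i < slen E) `|ssh i|%N.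
exists N, (fun b => \sum_(i < slen E | b1 i == b) 'X^(`|(N%:Z + ssh i)%R|%N)) => b t t0.
rewrite horner_sum mulr_sumr; apply: eq_bigr => i _; rewrite hornerXn.
rewrite -[t ^+ N]/(t ^ N%:Z) -expfzDr //.
have Ni : 0 <= N%:Z + ssh i.
  suff : (`|ssh i| <= N)%N by lia.
  by rewrite /N (bigD1 i) //= leq_addr.
by rewrite -[in RHS](gez0_abs Ni).
Qed.

Lemma poly_eq0_pos (q : {poly rat}) : (forall t, 0 < t -> q.[t] = 0) -> q = 0.
Proof.
move=> q0; apply: (@roots_geq_poly_eq0 _ _ [seq k.+1%:R | k <- iota 0 (size q)]).
- by apply/allP => _ /mapP[k _ ->]; apply/rootP/q0; rewrite ltr0n.
- rewrite map_inj_uniq ?iota_uniq // => j k /eqP.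
  by rewrite eqr_nat eqSS => /eqP.
- by rewrite size_map size_iota.
Qed.

Lemma no_three_orthogonal_minimal (E : 'I_3 -> dmx K) :
  (forall a, minimal (E a)) -> (forall a, (0 < slen (E a))%N) ->
  (forall a b, a != b -> hom_acyclic (E a) (E b)) -> False.
Proof.
move=> mE E0 aE.
have rel a b t : 0 < t -> a != b ->
    weight (E a) false t * weight (E b) false t^-1
    + weight (E a) true t * weight (E b) true t^-1
    = weight (E a) false t * weight (E b) true t^-1 * (1 + t^-1).
  by move=> t0 ab; apply: weight_relation; rewrite ?gt_eqF //; apply: aE.
(* The relation for (a, b) at t and the one for (b, a) at 1/t have equal left sides; comparing the
   right sides and cancelling 1 + t gives the claim. *)
have rel2 a b t : 0 < t -> a != b ->
    weight (E a) false t * weight (E b) true t^-1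
    = t * (weight (E b) false t^-1 * weight (E a) true t).
  move=> t0 ab; have tN0 : t != 0 by rewrite gt_eqF.
  have ti : 0 < t^-1 by rewrite invr_gt0.
  have := rel b a t^-1 ti; rewrite eq_sym invrK => /(_ ab) r.
  have := rel a b t t0 ab.
  rewrite [_ * _ + _]addrC mulrC [X in _ + X]mulrC addrC.
  rewrite r => e.
  have t1 : 1 + t != 0 by rewrite gt_eqF // addr_gt0.
  apply: (mulIf t1); apply: (mulIf (invr_neq0 tN0)).
  move: e; rewrite -[1 + t^-1](_ : (1 + t) * t^-1 = _); last by field.
  by rewrite mulrA => <-; field.
have nz a b t : 0 < t -> weight (E a) b t != 0.
  move=> t0; have ti : 0 < t^-1 by rewrite invr_gt0.
  have some c u : 0 < u -> ~~ ((weight (E c) false u == 0) && (weight (E c) true u == 0)).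
    move=> u0; pose i0 := Ordinal (E0 c); rewrite negb_and.
    by case e: (b1 i0); rewrite (weight_neq0 u0 e) ?orbT.
  have [c ac] : exists c : 'I_3, a != c.
    by have [->|n0] := eqVneq a 0; [exists 1|exists 0].
  have [] := weights_neq0 (lt0r_neq0 t0) (rel a c t t0 ac) (rel2 a c t t0 ac)
    (some a t t0) (some c _ ti).
  by case: b.
(* The combination t A1 rel + A0 rel2 eliminates B0, and the nonzero B1 is cancelled. *)
have quad t : 0 < t ->
    (weight (E 0) false t - weight (E 0) true t) *
    (weight (E 0) false t - t * weight (E 0) true t) = 0.
  move=> t0; have ti : 0 < t^-1 by rewrite invr_gt0.
  have tN0 := lt0r_neq0 t0.
  have r := rel 0 1 t t0 isT; have r2 := rel2 0 1 t t0 isT.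
  apply: (mulfI (nz 1 true _ ti)); rewrite mulr0.
  set A0 := weight (E 0) false t in r r2 *; set A1 := weight (E 0) true t in r r2 *.
  set B0 := weight (E 1) false t^-1 in r r2 *; set B1 := weight (E 1) true t^-1 in r r2 *.
  transitivity (t * A1 * (A0 * B0 + A1 * B1 - A0 * B1 * (1 + t^-1))
                + A0 * (A0 * B1 - t * (B0 * A1))); last first.
    by rewrite r r2 !subrr !mulr0 addr0.
  by field.
(* With rho the ratio of the two weights, rho_0(t) = t rho_1(1/t) = rho_2(t) = t rho_0(1/t): the
   third object enters here. *)
have recip t : 0 < t ->
    weight (E 0) false t * weight (E 0) true t^-1
    = t * (weight (E 0) false t^-1 * weight (E 0) true t).
  move=> t0; have ti : 0 < t^-1 by rewrite invr_gt0.
  have tN0 := lt0r_neq0 t0.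
  have r01 := rel2 0 1 t t0 isT; have r21 := rel2 2 1 t t0 isT.
  have r20 := rel2 2 0 t t0 isT.
  apply: (mulfI (nz 2 true _ t0)); apply: (mulfI (nz 1 true _ ti)).
  transitivity (weight (E 2) true t * weight (E 0) true t^-1 *
    (weight (E 0) false t * weight (E 1) true t^-1)); first by ring.
  rewrite r01.
  transitivity (weight (E 0) true t * weight (E 0) true t^-1 *
    (t * (weight (E 1) false t^-1 * weight (E 2) true t))); first by ring.
  rewrite -r21.
  transitivity (weight (E 0) true t * weight (E 1) true t^-1 *
    (weight (E 2) false t * weight (E 0) true t^-1)); first by ring.
  by rewrite r20; ring.
(* By [quad] the ratio of the two weights is 1 or t as a rational function of t,
   and by [recip] it is divided by t under t -> 1/t: neither is possible. *)
have [N [p pE]] := weight_poly (E 0).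
have /eqP : (p false - p true) * (p false - 'X * p true) = 0.
  apply: poly_eq0_pos => t t0; have tN0 : t != 0 by rewrite gt_eqF.
  rewrite !hornerE !pE // mulrCA -!mulrBr mulrACA quad //.
  by rewrite mulr0.
(* The values 1 and t differ at t = 2, so one evaluation refutes both cases. *)
have two : 0 < 2 :> rat by []. have half : 0 < 2^-1 :> rat by [].
have r2 := recip 2 two.
have n1 := nz 0 true _ two; have n2 := nz 0 true _ half.
rewrite mulf_eq0 !subr_eq0 => /orP[]/eqP e.
  have ew t : t != 0 -> weight (E 0) false t = weight (E 0) true t.
    move=> t0; apply: (mulfI (expf_neq0 N t0)).
    by rewrite -!pE // e.
  move: r2; rewrite !ew // => r2.
  have /eqP : weight (E 0) true 2 * weight (E 0) true 2^-1 = 0 by lra.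
  by rewrite mulf_eq0 (negPf n1) (negPf n2).
have ew t : t != 0 -> weight (E 0) false t = t * weight (E 0) true t.
  move=> t0; apply: (mulfI (expf_neq0 N t0)).
  by rewrite mulrCA -!pE // e !hornerE.
move: r2; rewrite !ew // => r2.
have /eqP : weight (E 0) true 2 * weight (E 0) true 2^-1 = 0 by lra.
by rewrite mulf_eq0 (negPf n1) (negPf n2).
Qed.
End Counting.

(** * Orthogonal objects in H^0(Tw) *)

Section Categories.

(** The form taken by Hom(X, Y) = 0 in a [category], which carries no addition and no zero morphism.
    Applied to X = Y, it says that X is a zero object. *)
Definition hom_trivial (C : category) (X Y : C) : Prop :=
  forall f g : hom X Y, heq f g.

Definition isomorphic (C : category) (X Y : C) : Prop :=
  exists f : hom X Y, isom f.

Lemma isomorphic_refl (C : category) (X : C) : isomorphic X X.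
Proof. by exists (idm X), (idm X); split; apply: comp1m. Qed.

Lemma isomorphic_sym (C : category) (X Y : C) :
  isomorphic X Y -> isomorphic Y X.
Proof. by move=> [f [g [gf fg]]]; exists g, f. Qed.

Lemma comp_cancel_mid (C : category) (X Y Z T : C)
    (f : hom X Y) (g : hom Y Z) (g' : hom Z Y) (h : hom Y T) :
  heq (comp g' g) (idm Y) ->
  heq (comp (comp h g') (comp g f)) (comp h f).
Proof.
move=> e; apply: heq_trans (heq_sym (compA _ _ _)) _.
apply: comp_heq (heq_refl _) _; apply: heq_trans (compA _ _ _) _.
by apply: heq_trans (comp_heq e (heq_refl _)) _; apply: comp1m.
Qed.

Lemma isomorphic_trans (C : category) (X Y Z : C) :
  isomorphic X Y -> isomorphic Y Z -> isomorphic X Z.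
Proof.
move=> [f [f' [f'f ff']]] [g [g' [g'g gg']]].
exists (comp g f), (comp f' g'); split.
  by apply: heq_trans (comp_cancel_mid _ _ g'g) _.
by apply: heq_trans (comp_cancel_mid _ _ ff') _.
Qed.

Lemma hom_trivial_iso (C : category) (X X' Y Y' : C) :
  isomorphic X X' -> isomorphic Y Y' -> hom_trivial X Y -> hom_trivial X' Y'.
Proof.
move=> [a [a' [_ aa']]] [b [b' [_ bb']]] XY f g.
have cut k : heq k (comp b (comp (comp b' (comp k a)) a')).
  apply: heq_sym; apply: heq_trans (comp_heq (heq_refl b) (heq_sym (compA _ _ _))) _.
  apply: heq_trans (compA _ _ _) _; apply: heq_trans (comp_heq bb' _) (comp1m k).
  apply: heq_trans (heq_sym (compA _ _ _)) _.
  by apply: heq_trans (comp_heq (heq_refl k) aa') (compm1 _).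
apply: heq_trans (cut f) _; apply: heq_trans _ (heq_sym (cut g)).
apply: comp_heq (heq_refl _) _; apply: comp_heq _ (heq_refl _).
exact: XY.
Qed.

(** Shifting source and target by natural numbers p and q reaches every integer degree q - p without
    an inverse of the shift. *)
Definition orthogonal (C : shift_category) (X Y : C) : Prop :=
  forall p q, hom_trivial (iter p (@sh C) X) (iter q (@sh C) Y).

Lemma sh_isomorphic (C : shift_category) (X Y : C) :
  isomorphic X Y -> isomorphic (sh X) (sh Y).
Proof.
move=> [f [g [gf fg]]]; exists (shm f), (shm g); split.
  apply: heq_trans (heq_sym (shm_comp _ _)) _.
  by apply: heq_trans (shm_heq gf) (shm_id _).
apply: heq_trans (heq_sym (shm_comp _ _)) _.
by apply: heq_trans (shm_heq fg) (shm_id _).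
Qed.

Lemma iter_sh_isomorphic (C : shift_category) p (X Y : C) :
  isomorphic X Y -> isomorphic (iter p (@sh C) X) (iter p (@sh C) Y).
Proof. by move=> XY; elim: p => //= p; apply: sh_isomorphic. Qed.

Section Equivalence.
Variables (T T' : tri_category) (F : exact_equivalence T T').

Lemma fob_iter_sh p (X : T) :
  isomorphic (fob F (iter p (@sh T) X)) (iter p (@sh T') (fob F X)).
Proof.
elim: p => [|p IH] /=; first exact: isomorphic_refl.
apply: isomorphic_trans (sh_isomorphic IH).
by exists (feta F _); apply: feta_isom.
Qed.

Lemma fob_hom_trivial (X Y : T) :
  hom_trivial (fob F X) (fob F Y) <-> hom_trivial X Y.
Proof.
split=> XY f g; first by apply: (fmap_faithful (e:=F)); apply: XY.
have [f' ff'] := fmap_full f; have [g' gg'] := fmap_full g.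
apply: heq_trans (heq_sym ff') _; apply: heq_trans _ gg'.
exact/fmap_heq/XY.
Qed.

Lemma fob_orthogonal (X Y : T) :
  orthogonal X Y -> orthogonal (fob F X) (fob F Y).
Proof.
move=> XY p q; apply: hom_trivial_iso (fob_iter_sh p X) (fob_iter_sh q Y) _.
exact/fob_hom_trivial/XY.
Qed.

End Equivalence.
End Categories.

(** * Twisted complexes over the Fukaya-Seidel category as polynomial matrices *)

Section FukayaSeidelMatrices.
Variable K : fieldType.
Local Notation ssum := (shifted_sum (FS_category K)).
Local Notation gmx E F := 'M[{poly K}]_(slen E, slen F).

Lemma rVpoly1 (v : 'rV[K]_1) : rVpoly v = (v 0 0)%:P.
Proof.
apply/polyP => k; rewrite coefC coef_rVpoly.
by case: insubP => [i _ <-|]; [rewrite ord1|case: k].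
Qed.

(** In a composition of basis vectors at least one factor is a scalar, so it becomes the product of
    polynomials; the order is reversed to match matrix multiplication. *)
Lemma fs_comp_poly X Y Z (g : fs_hom K Y Z) (f : fs_hom K X Y) :
  rVpoly (fs_comp g f) = rVpoly f * rVpoly g.
Proof.
have rV0 (v : 'rV[K]_0) : rVpoly v = 0 by rewrite thinmx0 linear0.
have rV1 := rVpoly1.
case: X Y Z g f => [] [] [] g f; rewrite /fs_comp.
- by rewrite linearZ /= [rVpoly f]rV1 mul_polyC.
- by rewrite linearZ /= [rVpoly f]rV1 mul_polyC.
- by rewrite linear0 [rVpoly g]rV0 mulr0.
- by rewrite linearZ /= [rVpoly g]rV1 mulrC mul_polyC.
- by rewrite linear0 [rVpoly f]rV0 mul0r.
- by rewrite linear0 [rVpoly f]rV0 mul0r.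
- by rewrite linearZ /= [rVpoly f]rV1 mul_polyC.
- by rewrite linearZ /= [rVpoly f]rV1 mul_polyC.
Qed.

Definition gmat_mx (E F : ssum) (f : gmat E F) : gmx E F :=
  \matrix_(i < slen E, j < slen F) rVpoly (f i j : 'rV_(fs_rank (sob i) (sob j))).

Definition mx_gmat (E F : ssum) (f : gmx E F) : gmat E F :=
  fun i j => (poly_rV (f i j) : 'rV_(fs_rank (sob i) (sob j))).

Lemma gmat_mxK (E F : ssum) : cancel (@gmat_mx E F) (@mx_gmat E F).
Proof. by move=> f; apply: gmat_eq => i j; rewrite /mx_gmat mxE rVpolyK. Qed.

Lemma mx_gmatK (E F : ssum) d (f : gmx E F) :
  mxdeg d f -> gmat_mx (mx_gmat f) = f.
Proof.
move=> fd; apply/matrixP => i j; rewrite mxE poly_rV_K //.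
apply/leq_sizeP => k rk; have [//|/fd[]] := eqVneq (f i j)`_k 0.
by rewrite ltnNge rk.
Qed.

Lemma gmat_mx_deg (E F : ssum) d (f : gmat E F) :
  gmat_deg d f -> mxdeg d (gmat_mx f).
Proof.
move=> fd i j k; rewrite mxE coef_rVpoly.
case: insubP => [i0 ki <-|]; last by rewrite eqxx.
have [e _|di] := eqVneq (d + ssh j - ssh i) (i0 : nat)%:Z.
  by rewrite ltn_ord.
by rewrite (fd i j i0 di) eqxx.
Qed.

Lemma mx_gmat_deg (E F : ssum) d (f : gmx E F) :
  mxdeg d f -> gmat_deg d (mx_gmat f).
Proof.
move=> fd i j k di; rewrite mxE.
by have [//|/fd[_ /eqP]] := eqVneq (f i j)`_k 0; rewrite (negPf di).
Qed.

Lemma gmat_mxM (E F G : ssum) (g : gmat F G) (f : gmat E F) :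
  gmat_mx (gmul g f) = gmat_mx f *m gmat_mx g.
Proof.
apply/matrixP => i k; rewrite !mxE [LHS]linear_sum; apply: eq_bigr => j _.
by rewrite !mxE; apply: fs_comp_poly.
Qed.

Lemma gmat_mxD (E F : ssum) (f g : gmat E F) :
  gmat_mx (gadd f g) = gmat_mx f + gmat_mx g.
Proof. by apply/matrixP => i j; rewrite !mxE; apply: linearD. Qed.

Lemma gmat_mx0 (E F : ssum) : gmat_mx (@gzero K (FS_category K) E F) = 0.
Proof. by apply/matrixP => i j; rewrite !mxE; apply: linear0. Qed.

(** Deduced from the unit law of [gmul], which avoids the transport along an equality in the entries
    of [gone]. *)
Lemma gmat_mx1 (E : ssum) : gmat_mx (@gone K (FS_category K) E) = 1%:M.
Proof.
have := gmat_mxM (@gone K (FS_category K) E) (mx_gmat (1%:M : gmx E E)).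
by rewrite gmul1m (mx_gmatK (@mxdeg1 K E)) mul1mx => <-.
Qed.

Local Notation twisted := (twisted (FS_category K)).

(** The same matrix has degree one higher as a map out of E[1], and the sign of the shifted
    differential compensates that of (-1)^d. *)
Lemma acyclic_at_shl (E F : ssum) (dE : gmx E E) (dF : gmx F F) d :
  acyclic_at (- dE : gmx (ssum_shift E) (ssum_shift E)) dF (d + 1) ->
  acyclic_at dE dF d.
Proof.
move=> EF f fd fC; have [||h hd fh] := EF f.
- by move=> i j k /fd[rk <-]; split=> //=; lia.
- by rewrite signzS polyCN mulNmx scaleNr scalerN opprK.
exists h; first by move=> i j k /hd[rk /= <-]; split=> //; lia.
by rewrite {1}fh signzS polyCN mulNmx scaleNr scalerN opprK.
Qed.

Lemma acyclic_at_shr (E F : ssum) (dE : gmx E E) (dF : gmx F F) d :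
  acyclic_at dE (- dF : gmx (ssum_shift F) (ssum_shift F)) (d - 1) ->
  acyclic_at dE dF d.
Proof.
have := signzS K (d - 1); rewrite subrK => sg.
move=> EF f fd fC; have [||h hd fh] := EF f.
- by move=> i j k /fd[rk <-]; split=> //=; lia.
- by rewrite mulmxN fC sg polyCN scaleNr opprK.
exists (- h).
  by apply: mxdegN => i j k /hd[rk /= <-]; split=> //; lia.
by rewrite {1}fh sg polyCN mulmxN mulNmx mulmxN scaleNr scalerN opprK.
Qed.

Lemma dmx_of_subproof (E : twisted) :
  gmat_mx (tdelta (t:=E)) *m gmat_mx (tdelta (t:=E)) = 0.
Proof. by rewrite -gmat_mxM tdelta_mc gmat_mx0. Qed.

Definition dmx_of (E : twisted) : dmx K :=
  Dmx (gmat_mx_deg (tdelta_deg (t:=E))) (dmx_of_subproof E).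

Lemma tw_sh_dif (E : twisted) :
  gmat_mx (tdelta (t:=tw_sh E))
  = - gmat_mx (tdelta (t:=E)) :> gmx (ssum_shift E) (ssum_shift E).
Proof. by apply/matrixP => i j; rewrite [RHS]mxE !mxE; apply: linearN. Qed.

Local Notation tw_acyclic E F :=
  (acyclic_at (gmat_mx (tdelta (t:=E))) (gmat_mx (tdelta (t:=F)))).

Lemma hom_trivial_acyclic0 (E F : twisted) :
  hom_trivial (C:=FS K) E F -> tw_acyclic E F 0.
Proof.
move=> EF f fd; rewrite expr0z scale1r => fC.
have [fm fmE] : exists fm : tw_hom E F, gmat_mx fm = f.
  have cl : gmul (tdelta (t:=F)) (mx_gmat f) = gmul (mx_gmat f) (tdelta (t:=E)).
    apply: (can_inj (@gmat_mxK E F)).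
    by rewrite !gmat_mxM !(mx_gmatK fd).
  by exists (TwHom (mx_gmat_deg fd) cl); rewrite /= (mx_gmatK fd).
have [zm zmE] : exists zm : tw_hom E F, gmat_mx zm = 0.
  have cl : gmul (tdelta (t:=F)) (@gzero K (FS_category K) E F)
      = gmul (@gzero K (FS_category K) E F) (tdelta (t:=E)).
    apply: (can_inj (@gmat_mxK E F)).
    by rewrite !gmat_mxM gmat_mx0 mul0mx mulmx0.
  have z0 : gmat_deg 0 (@gzero K (FS_category K) E F).
    by move=> i j; apply: gdeg0.
  by exists (TwHom z0 cl); rewrite /= gmat_mx0.
have [h [hd fz]] := EF fm zm.
exists (gmat_mx h); first by rewrite sub0r; apply: gmat_mx_deg.
by rewrite scale1r -fmE fz !gmat_mxD !gmat_mxM zmE add0r.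
Qed.

(** Degree n >= 0 is brought to degree 0 by shifting the target n times, degree -(n + 1) by shifting
    the source n + 1 times. *)
Lemma orthogonal_acyclic (E F : twisted) :
  orthogonal (C:=FS K) E F -> hom_acyclic (dmx_of E) (dmx_of F).
Proof.
have shl p E' F' : hom_trivial (C:=FS K) (iter p (@tw_sh _ _) E') F' ->
    tw_acyclic E' F' (- p%:Z).
  elim: p E' => [|p IH] E' EF; first exact: hom_trivial_acyclic0.
  apply: acyclic_at_shl; have -> : - p.+1%:Z + 1 = - p%:Z by lia.
  have := IH (tw_sh E'); rewrite -iterSr => /(_ EF).
  by rewrite tw_sh_dif.
have shr q E' F' : hom_trivial (C:=FS K) E' (iter q (@tw_sh _ _) F') ->
    tw_acyclic E' F' q%:Z.
  elim: q F' => [|q IH] F' EF; first exact: hom_trivial_acyclic0.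
  apply: acyclic_at_shr; have -> : q.+1%:Z - 1 = q%:Z by lia.
  have := IH (tw_sh F'); rewrite -iterSr => /(_ EF).
  by rewrite tw_sh_dif.
move=> EF; case=> n; first exact/shr/(EF 0%N n).
by rewrite NegzE; apply/shl/(EF n.+1 0%N).
Qed.

(** Closed morphisms commute with the differential, so a contraction composed with f - g is a
    homotopy between f and g. *)
Lemma contractible_hom_trivial (E : twisted) :
  contractible (dmx_of E) -> hom_trivial (C:=FS K) E E.
Proof.
case=> h hd h1 f g.
pose k := gmat_mx f - gmat_mx g.
have tC (u : tw_hom E E) :
    gmat_mx u *m ddif (dmx_of E) = ddif (dmx_of E) *m gmat_mx u.
  by rewrite /= -!gmat_mxM tw_closed.
have fgd : mxdeg (-1) (h *m k).
  rewrite -[-1]addr0; apply: mxdegM hd _.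
  by apply: mxdegD; [|apply: mxdegN]; apply: gmat_mx_deg; apply: tw_deg.
exists (mx_gmat (h *m k)); split; first exact: mx_gmat_deg.
apply: (can_inj (@gmat_mxK E E)).
rewrite !gmat_mxD !gmat_mxM (mx_gmatK fgd) -mulmxA.
have -> : k *m gmat_mx (tdelta (t:=E)) = gmat_mx (tdelta (t:=E)) *m k.
  by rewrite /k mulmxBl mulmxBr [_ *m _]tC [X in _ - X]tC.
by rewrite !mulmxA -mulmxDl -h1 mul1mx /k addrC subrK.
Qed.

Lemma no_three_orthogonal (E : 'I_3 -> FS K) :
  (forall a, ~ hom_trivial (E a) (E a)) ->
  (forall a b, a != b -> orthogonal (E a) (E b)) -> False.
Proof.
move=> E0 EO.
have /choice[M MP] : forall a, exists M : dmx K,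
    [/\ minimal M, ~ contractible M & inhabited (retract (dmx_of (E a)) M)].
  by move=> a; apply: minimal_retract => /contractible_hom_trivial /E0.
apply: (@no_three_orthogonal_minimal K M) => [a|a|a b ab].
- by have [] := MP a.
- have [_ nc _] := MP a; rewrite lt0n; apply/eqP => M0; apply: nc.
  exists 0; first exact: mxdeg0.
  by apply/matrixP => i; have := ltn_ord i; rewrite {2}M0.
- have [_ _ [ra]] := MP a; have [_ _ [rb]] := MP b.
  apply: retract_acyclicr rb _; apply: retract_acyclicl ra _.
  exact/orthogonal_acyclic/EO.
Qed.

(** * Shifted thimbles and their direct summands *)

Section Thimbles.

Definition thimble_sum (X : vanishing_cycle) (s : int) : ssum :=
  @ShiftedSum K (FS_category K) 1 (fun=> X) (fun=> s).

Definition thimble (X : vanishing_cycle) (s : int) : twisted.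
Proof.
refine (@Twisted K (FS_category K) (thimble_sum X s)
  (@gzero _ _ _ _) _ _ _).
- by move=> i j; apply: gdeg0.
- by [].
- by apply: (can_inj (@gmat_mxK _ _)); rewrite gmat_mxM gmat_mx0 mul0mx.
Defined.

Lemma twisted_congr (S : ssum) (d1 d2 : gmat S S) a1 a2 b1 b2 c1 c2 :
  d1 = d2 -> @Twisted K (FS_category K) S d1 a1 b1 c1 = @Twisted K (FS_category K) S d2 a2 b2 c2.
Proof.
move=> d12; subst d2.
by rewrite (Prop_irrelevance a1 a2) (Prop_irrelevance b1 b2)
  (Prop_irrelevance c1 c2).
Qed.

Lemma tw_sh_thimble X s : tw_sh (thimble X s) = thimble X (s + 1).
Proof.
apply: (@twisted_congr (thimble_sum X (s + 1))).
by apply: gmat_eq => i j; rewrite /gopp /gzero oppr0.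
Qed.

Lemma iter_sh_thimble p X s :
  iter p (@sh (FS K)) (thimble X s) = thimble X (s + p%:Z).
Proof.
elim: p s => [|p IH] s; first by rewrite addr0.
rewrite iterSr [sh _]tw_sh_thimble IH; congr thimble; lia.
Qed.

Lemma thimble_dif X s : gmat_mx (tdelta (t:=thimble X s)) = 0.
Proof. exact: gmat_mx0. Qed.

(** Both differentials are zero, so homotopies contribute nothing. *)
Lemma homotopic_thimble X s Y t (f g : tw_hom (thimble X s) (thimble Y t)) :
  homotopic f g -> tw_mat f = tw_mat g.
Proof.
move=> [h [_ fg]]; rewrite fg; apply: (can_inj (@gmat_mxK _ _)).
by rewrite !gmat_mxD !gmat_mxM !thimble_dif mulmx0 mul0mx !addr0.
Qed.

Definition thimble_map X s Y t (v : fs_hom K X Y) :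
    gmat (thimble X s) (thimble Y t) := fun i j => v.

Lemma thimble_map_closed X s Y t v :
  gmul (tdelta (t:=thimble Y t)) (@thimble_map X s Y t v)
  = gmul (@thimble_map X s Y t v) (tdelta (t:=thimble X s)).
Proof.
by apply: (can_inj (@gmat_mxK _ _)); rewrite !gmat_mxM !thimble_dif mulmx0 mul0mx.
Qed.

Definition tw_zero (E F : twisted) : tw_hom E F.
Proof.
refine (@TwHom K (FS_category K) E F (@gzero _ _ E F) _ _).
- by move=> i j; apply: gdeg0.
- by apply: (can_inj (@gmat_mxK _ _)); rewrite !gmat_mxM !gmat_mx0 mulmx0 mul0mx.
Defined.

Lemma hom_trivial_thimble10 s t : hom_trivial (C:=FS K) (thimble L1 s) (thimble L0 t).
Proof.
move=> f g; apply: homotopic_eq; apply: gmat_eq => i j.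
by apply/rowP => -[].
Qed.

Lemma hom_nontrivial_thimble01 :
  ~ hom_trivial (C:=FS K) (thimble L0 0) (thimble L1 0).
Proof.
pose v : fs_hom K L0 L1 := delta_mx 0 (0 : 'I_2).
have vd : gmat_deg 0 (@thimble_map L0 0 L1 0 v).
  move=> i j k dk; rewrite /thimble_map mxE eqxx /=.
  have [k0|//] := eqVneq k (0 : 'I_2).
  by move: dk; rewrite k0.
move=> tr; have := tr (TwHom vd (@thimble_map_closed _ _ _ _ _)) (tw_zero _ _).
move=> /homotopic_thimble /(congr1 (fun f => f 0 0)) /=.
move/(congr1 (fun f : 'rV[K]_2 => f 0 0)); rewrite !mxE eqxx /=.
by move/eqP; rewrite oner_eq0.
Qed.

Lemma hom_nontrivial_thimble X s :
  ~ hom_trivial (C:=FS K) (thimble X s) (thimble X s).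
Proof.
move=> /(_ (tw_id _) (tw_zero _ _)) /homotopic_thimble.
move=> /(congr1 (fun f => f 0 0)) /=; rewrite gone_diag.
move/(congr1 (fun f : fs_hom K X X => rVpoly f)); rewrite linear0.
have -> : rVpoly (@gid K (FS_category K) X : fs_hom K X X) = 1.
  by case: X; apply: etrans (rVpoly1 _) _; rewrite mxE.
by move/eqP; rewrite oner_eq0.
Qed.

Lemma idempotent_mx1 (R : idomainType) (M : 'M[R]_1) :
  M *m M = M -> M = 0 \/ M = 1%:M.
Proof.
have M00 (N : 'M[R]_1) : N = (N 0 0)%:M.
  by apply/matrixP => i j; rewrite !ord1 mxE eqxx mulr1n.
move=> /matrixP/(_ 0 0); rewrite mxE big_ord1 => MM.
have /eqP : M 0 0 * (M 0 0 - 1) = 0 by rewrite mulrBr mulr1 MM subrr.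
rewrite mulf_eq0 subr_eq0 [M]M00 !mxE eqxx !mulr1n.
by case/orP => /eqP->; [left; rewrite raddf0|right].
Qed.

(* The endomorphism ring of a shifted thimble is [K], whose only idempotents
   are 0 and 1. *)
Lemma retract_thimble X s (S : FS K) (a : hom S (thimble X s))
    (b : hom (thimble X s : FS K) S) :
  heq (comp b a) (idm S) -> ~ hom_trivial S S ->
  isomorphic S (thimble X s : FS K).
Proof.
move=> ba nS; pose e : tw_hom (thimble X s) (thimble X s) := tw_comp a b.
have ee : homotopic (tw_comp e e) e := @comp_cancel_mid (FS K) _ _ _ _ b a b a ba.
have : gmat_mx (tw_mat e) *m gmat_mx (tw_mat e) = gmat_mx (tw_mat e).
  by rewrite -gmat_mxM -[in RHS](homotopic_thimble ee).
move: (gmat_mxK (tw_mat e)); set M := gmat_mx _ => Me MM.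
have : M = 0 \/ M = 1%:M := idempotent_mx1 MM.
case=> M01.
  (* If the idempotent e = a b is zero, then id_S = (b a)(b a) = b e a is zero, and all
     endomorphisms of S agree. *)
  case: nS => f g.
  have z (h : hom S S) : heq h (tw_zero S S : hom S S).
    have bea : heq (comp (comp b (e : hom (thimble X s : FS K) _)) a) (idm S).
      apply: heq_trans (comp_heq (compA _ _ _) (heq_refl a)) _.
      apply: heq_trans (comp_heq (comp_heq ba (heq_refl b)) (heq_refl a)) _.
      exact: heq_trans (comp_heq (comp1m _) (heq_refl a)) ba.
    apply: heq_trans (heq_sym (compm1 h)) _.
    apply: heq_trans (comp_heq (heq_refl h) (heq_sym bea)) _.
    apply: homotopic_eq; apply: (can_inj (@gmat_mxK _ _)).
    rewrite -[tw_mat _]/(gmul (tw_mat h)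
      (gmul (gmul (tw_mat b) (tw_mat e)) (tw_mat a))).
    have ba0 : gmat_mx (tw_mat b) *m gmat_mx (tw_mat a) = 0 by rewrite -gmat_mxM.
    by rewrite !gmat_mxM ba0 gmat_mx0 mul0mx mulmx0 mul0mx.
  by apply: heq_trans (z f) (heq_sym (z g)).
exists a, b; split=> //; apply: homotopic_eq.
by rewrite -[LHS]Me M01 -gmat_mx1 gmat_mxK.
Qed.

End Thimbles.
End FukayaSeidelMatrices.

Local Open Scope classical_set_scope.

(** * Regular functions and sheaves of modules *)

Section RegularFunctions.
Variables (K : closedFieldType) (n : nat) (Y : set (PP K n)).
Local Notation opens := (opens Y).
Local Notation O := (@structure_sheaf K n Y).

Lemma opens_sub (U : opens) : U `<=` Y.
Proof. by case: U => /= _ [Z _ ->] x []. Qed.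

Lemma regfun_eq (U : opens) (f g : O U) :
  (forall y, regfun f y = regfun g y) -> f = g.
Proof. by move=> fg; apply: val_inj; apply/funext. Qed.

Lemma regfunD (U : opens) (f g : O U) y :
  regfun (f + g) y = regfun f y + regfun g y.
Proof. by []. Qed.

Lemma regfunM (U : opens) (f g : O U) y :
  regfun (f * g) y = regfun f y * regfun g y.
Proof. by []. Qed.

Lemma regfunN (U : opens) (f : O U) y : regfun (- f) y = - regfun f y.
Proof. by []. Qed.

Lemma regfun0 (U : opens) y : regfun (0 : O U) y = 0.
Proof. by []. Qed.

Lemma regfun_sum (U : opens) (I : finType) (f : I -> O U) y :
  regfun (\sum_i f i) y = \sum_i regfun (f i) y.
Proof. by elim/big_rec2: _ => //= i a b _ <-. Qed.

Lemma regfun_ores (U V : opens) (VU : V `<=` U) (f : O U) y :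
  regfun (ores VU f) y = regfun f (incl VU y).
Proof. by []. Qed.

Lemma pt_eq (U : opens) (x y : U) : val x = val y -> x = y.
Proof. exact: val_inj. Qed.

Section Fractions.
Variables (U : opens) (d : nat) (p q : {mpoly K[n.+1]}).
Hypotheses (ph : p \is d.-homog) (qh : q \is d.-homog)
  (qN0 : forall x, oset U x -> q.@[hcoord x] != 0).

Lemma frac_subproof :
  (fun y : U => p.@[hcoord (val y)] / q.@[hcoord (val y)])
    \in @regular_pred K n Y U.
Proof.
apply/asboolP => x; exists U, d, p, q; split=> //.
  exact: set_mem (valP x).
by move=> y Uy; split=> //; apply: qN0.
Qed.

Definition frac : O U := RegularFunction frac_subproof.

End Fractions.

Lemma fracE (U : opens) d p q (ph : p \is d.-homog) (qh : q \is d.-homog)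
    (qN0 : forall x, oset U x -> q.@[hcoord x] != 0) (y : U) :
  regfun (frac ph qh qN0) y
  = p.@[hcoord (val y)] / q.@[hcoord (val y)].
Proof. by []. Qed.

Lemma homog_const c : (c *: 1 : {mpoly K[n.+1]}) \is 0.-homog.
Proof. by apply: rpredZ; apply: dhomog1. Qed.

Lemma oconst_subproof (U : opens) x :
  oset U x -> (1 : {mpoly K[n.+1]}).@[hcoord x] != 0.
Proof. by rewrite meval1 oner_neq0. Qed.

Definition oconst (U : opens) (c : K) : O U :=
  frac (homog_const c) (@dhomog1 _ _ _) (@oconst_subproof U).

Lemma oconstE (U : opens) c (y : U) : regfun (oconst U c) y = c.
Proof. by rewrite fracE mevalZ meval1 mulr1 divr1. Qed.

Lemma ores_const (U V : opens) (VU : V `<=` U) c :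
  ores VU (oconst U c) = oconst V c.
Proof. by apply: regfun_eq => y; rewrite regfun_ores !oconstE. Qed.

Lemma ores1 (U V : opens) (VU : V `<=` U) : ores VU (1 : O U) = 1.
Proof. exact: regfun_eq. Qed.

Lemma ores0 (U V : opens) (VU : V `<=` U) : ores VU (0 : O U) = 0.
Proof. exact: regfun_eq. Qed.

Lemma oresM (U V : opens) (VU : V `<=` U) (f g : O U) :
  ores VU (f * g) = ores VU f * ores VU g.
Proof. exact: regfun_eq. Qed.

Lemma oresD (U V : opens) (VU : V `<=` U) (f g : O U) :
  ores VU (f + g) = ores VU f + ores VU g.
Proof. exact: regfun_eq. Qed.

Lemma ores_ores (U V W : opens) (VU : V `<=` U) (WV : W `<=` V) (WU : W `<=` U)
    (f : O U) : ores WV (ores VU f) = ores WU f.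
Proof.
apply: regfun_eq => y; rewrite !regfun_ores; congr (regfun f _).
exact: pt_eq.
Qed.

Lemma ores_id (U : opens) (UU : U `<=` U) (f : O U) : ores UU f = f.
Proof.
apply: regfun_eq => y; rewrite !regfun_ores; congr (regfun f _).
exact: pt_eq.
Qed.

Lemma whole_subproof : exists2 Z : set (PP K n), zariski_closed Z & Y = Y `\` Z.
Proof.
exists set0; last by rewrite setD0.
exists [set 1]; split.
  by move=> _ ->; exists 0%N; apply: dhomog1.
apply/seteqP; split=> // x /(_ 1 erefl) /eqP.
by rewrite meval1 oner_eq0.
Qed.

Definition whole : opens := Opens whole_subproof.

Lemma nonvanishing_subproof (p : {mpoly K[n.+1]}) : homogeneous p ->
  exists2 Z : set (PP K n), zariski_closed Z &
    [set x | Y x /\ p.@[hcoord x] != 0] = Y `\` Z.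
Proof.
move=> ph; exists (zeros [set p]).
  by exists [set p]; split=> // _ ->.
apply/seteqP; split=> x /= [Yx px]; split=> //.
  by move=> /(_ p erefl) p0; rewrite p0 eqxx in px.
by apply/eqP => p0; apply: px => _ ->.
Qed.

Definition nonvanishing (p : {mpoly K[n.+1]}) (ph : homogeneous p) : opens :=
  Opens (nonvanishing_subproof ph).

Definition linear_form (c : 'I_n.+1 -> K) : {mpoly K[n.+1]} :=
  \sum_i c i *: 'X_i.

Lemma linear_form_homog c : linear_form c \is 1.-homog.
Proof.
by apply: rpred_sum => i _; apply: rpredZ; rewrite dhomogX /= mdeg1.
Qed.

Lemma linear_formE c v : (linear_form c).@[v] = \sum_i c i * v i.
Proof.
rewrite /linear_form raddf_sum /=; apply: eq_bigr => i _.
by rewrite mevalZ mevalXU.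
Qed.

Lemma coord_homog i : ('X_i : {mpoly K[n.+1]}) \is 1.-homog.
Proof. by rewrite dhomogX /= mdeg1. Qed.

Definition chart (i : 'I_n.+1) : opens :=
  nonvanishing (ex_intro _ 1%N (coord_homog i)).

Lemma chartP i x : oset (chart i) x <-> Y x /\ hcoord x i != 0.
Proof. by rewrite /= mevalXU. Qed.

Lemma hcoord_neq0 (x : PP K n) : exists i, hcoord x i != 0.
Proof.
apply: contrapT => /forallNP x0.
have x1 : vpick (val x) = 0.
  by apply/rowP => i; rewrite mxE; apply/eqP/negPn/negP/x0.
by move/eqP: x1; rewrite vpick0 -dimv_eq0 (eqP (valP x)).
Qed.

Lemma chart_cover x : Y x -> exists i, oset (chart i) x.
Proof. by move=> Yx; have [i xi] := hcoord_neq0 x; exists i; apply/chartP. Qed.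

Section Ratio.
Variables (W : opens) (j : 'I_n.+1) (Wj : W `<=` chart j).

Lemma ratio_subproof x : oset W x -> ('X_j : {mpoly K[n.+1]}).@[hcoord x] != 0.
Proof. by case/Wj. Qed.

Definition lratio (c : 'I_n.+1 -> K) : O W :=
  frac (linear_form_homog c) (coord_homog j) ratio_subproof.

Definition ratio (i : 'I_n.+1) : O W :=
  frac (coord_homog i) (coord_homog j) ratio_subproof.

Lemma lratioE c y :
  regfun (lratio c) y = (\sum_i c i * hcoord (val y) i) / hcoord (val y) j.
Proof. by rewrite fracE mevalXU linear_formE. Qed.

Lemma ratioE i y : regfun (ratio i) y = hcoord (val y) i / hcoord (val y) j.
Proof. by rewrite fracE !mevalXU. Qed.

Lemma chart_coord (y : W) : hcoord (val y) j != 0.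
Proof. by have := ratio_subproof (set_mem (valP y)); rewrite mevalXU. Qed.

End Ratio.

Lemma ores_ratio (W V : opens) j (Wj : W `<=` chart j) (VW : V `<=` W)
    (Vj : V `<=` chart j) i : ores VW (ratio Wj i) = ratio Vj i.
Proof. by apply: regfun_eq => y; rewrite regfun_ores !ratioE. Qed.

Lemma ores_lratio (W V : opens) j (Wj : W `<=` chart j) (VW : V `<=` W)
    (Vj : V `<=` chart j) c : ores VW (lratio Wj c) = lratio Vj c.
Proof. by apply: regfun_eq => y; rewrite regfun_ores !lratioE. Qed.

Lemma ratioM (W : opens) i j k (Wj : W `<=` chart j) (Wk : W `<=` chart k) :
  ratio Wk j * ratio Wj i = ratio Wk i.
Proof.
apply: regfun_eq => y; rewrite regfunM !ratioE mulrC mulrA divfK //.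
exact: chart_coord.
Qed.

Lemma ratio_lratio (W : opens) j k c (Wj : W `<=` chart j) (Wk : W `<=` chart k) :
  ratio Wk j * lratio Wj c = lratio Wk c.
Proof.
apply: regfun_eq => y; rewrite regfunM ratioE !lratioE mulrC mulrA divfK //.
exact: chart_coord.
Qed.

Lemma ratio_id (W : opens) j (Wj : W `<=` chart j) : ratio Wj j = 1.
Proof.
apply: regfun_eq => y; rewrite ratioE divff //.
exact: chart_coord.
Qed.

End RegularFunctions.

(** * Locally isomorphic sheaves of modules *)

Section Modules.
Variables (K : closedFieldType) (n : nat) (Y : set (PP K n)).
Local Notation opens := (opens Y).
Local Notation O := (@structure_sheaf K n Y).
Implicit Types F G : omodule Y.

Lemma res0 F (U V : opens) (VU : V `<=` U) : res VU (0 : sec F U) = 0.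
Proof. by rewrite res_zmod. Qed.

Lemma resD F (U V : opens) (VU : V `<=` U) (s t : sec F U) :
  res VU (s + t) = res VU s + res VU t.
Proof. by rewrite res_zmod. Qed.

Lemma resZ F (U V : opens) (VU : V `<=` U) (a : O U) (s : sec F U) :
  res VU (a *: s) = ores VU a *: res VU s.
Proof. by rewrite -[a *: s]addr0 res_linear res0 addr0. Qed.

Lemma res_sum F (U V : opens) (VU : V `<=` U) (I : finType) (s : I -> sec F U) :
  res VU (\sum_i s i) = \sum_i res VU (s i).
Proof. by elim/big_rec2: _ => [|i a b _ <-]; rewrite ?res0 ?resD. Qed.

Lemma res_irr F (U V : opens) (VU VU' : V `<=` U) (s : sec F U) :
  res VU s = res VU' s.
Proof. by rewrite (Prop_irrelevance VU VU'). Qed.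

Lemma app0 F G (f : omorphism F G) U : app f (0 : sec F U) = 0.
Proof. by apply: (addrI (app f (0 : sec F U))); rewrite -app_add !addr0. Qed.

Lemma appZ F G (f : omorphism F G) U (a : O U) (s : sec F U) :
  app f (a *: s) = a *: app f s.
Proof. by rewrite -[a *: s]addr0 app_linear app0 addr0. Qed.

(** An isomorphism between the restrictions of F and G to W, expressed on the open subsets of W so
    that no restricted sheaf has to be formed. *)
Record local_iso F G (W : opens) := LocalIso {
  liso : forall V : opens, V `<=` W -> sec F V -> sec G V;
  liso_inv : forall V : opens, V `<=` W -> sec G V -> sec F V;
  lisoK : forall (V : opens) (VW : V `<=` W), cancel (liso VW) (liso_inv VW);
  liso_invK : forall (V : opens) (VW : V `<=` W), cancel (liso_inv VW) (liso VW);
  liso_linear : forall (V : opens) (VW : V `<=` W) (a : O V) (s t : sec F V),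
    liso VW (a *: s + t) = a *: liso VW s + liso VW t;
  liso_res : forall (V V' : opens) (VW : V `<=` W) (V'W : V' `<=` W)
      (V'V : V' `<=` V) (s : sec F V), liso V'W (res V'V s) = res V'V (liso VW s)
}.

Section LocalIso.
Variables (F G : omodule Y) (W : opens) (phi : local_iso F G W).

Lemma liso0 (V : opens) (VW : V `<=` W) : liso phi VW 0 = 0.
Proof.
have := liso_linear phi VW 1 0 0; rewrite !scale1r addr0 => e.
by apply: (addrI (liso phi VW 0)); rewrite -e addr0.
Qed.

Lemma lisoD (V : opens) (VW : V `<=` W) s t :
  liso phi VW (s + t) = liso phi VW s + liso phi VW t.
Proof. by have := liso_linear phi VW 1 s t; rewrite !scale1r. Qed.

Lemma lisoZ (V : opens) (VW : V `<=` W) a s :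
  liso phi VW (a *: s) = a *: liso phi VW s.
Proof. by rewrite -[a *: s]addr0 liso_linear liso0 addr0. Qed.

Lemma liso_sum (V : opens) (VW : V `<=` W) (I : finType) (s : I -> sec F V) :
  liso phi VW (\sum_i s i) = \sum_i liso phi VW (s i).
Proof. by elim/big_rec2: _ => [|i a b _ <-]; rewrite ?liso0 ?lisoD. Qed.

Lemma generating_liso (V : opens) (VW : V `<=` W) m (s : 'I_m -> sec F V) :
  generating s -> generating (fun i => liso phi VW (s i)).
Proof.
move=> gs V1 V1V t x V1x.
have V1W := subset_trans V1V VW.
have [V2 [V21 [V2V [a [V2x ta]]]]] := gs V1 V1V (liso_inv phi V1W t) x V1x.
have V2W := subset_trans V2V VW.
exists V2, V21, V2V, a; split=> //.
rewrite -[t](liso_invK phi V1W) -(liso_res phi V1W V2W) ta liso_sum.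
by apply: eq_bigr => i _; rewrite lisoZ (liso_res phi VW V2W).
Qed.

End LocalIso.

Lemma generating_res F (U V : opens) (VU : V `<=` U) m (s : 'I_m -> sec F U) :
  generating s -> generating (fun i => res VU (s i)).
Proof.
move=> gs W WV t x Wx.
have [W' [W'W [W'U [a [W'x ta]]]]] := gs W (subset_trans WV VU) t x Wx.
exists W', W'W, (subset_trans W'W WV), a; split=> //; rewrite ta.
by apply: eq_bigr => i _; rewrite (res_res _ _ W'U).
Qed.

(** Both conditions of coherence are tested near a point, and a local isomorphism preserves
    generating families and relations. *)
Lemma coherent_liso F G :
  (forall x, Y x -> exists2 W : opens, oset W x & inhabited (local_iso F G W)) ->
  coherent F -> coherent G.
Proof.
move=> FG [ftF frF]; split=> [x Yx|U m s x Ux].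
  have [W Wx [phi]] := FG x Yx; have [V [m [s [Vx gs]]]] := ftF x Yx.
  have VV : opensI V W `<=` V by apply: subIsetl.
  have VW : opensI V W `<=` W by apply: subIsetr.
  exists (opensI V W), m, (fun i => liso phi VW (res VV (s i))); split=> //.
  by apply: generating_liso; apply: generating_res.
have [W Wx [phi]] := FG x (opens_sub Ux).
have UU : opensI U W `<=` U by apply: subIsetl.
have UW : opensI U W `<=` W by apply: subIsetr.
pose s' i := liso_inv phi UW (res UU (s i)).
have [V [VU [k [r [Vx rr gr]]]]] := frF (opensI U W) m s' x (conj Ux Wx).
have rel (V' : opens) (V'U : V' `<=` opensI U W) (V'U' : V' `<=` U) a :
    relation_on s V'U' a <-> relation_on s' V'U a.
  have V'W := subset_trans V'U UW.
  have e : liso phi V'W (\sum_i a i *: res V'U (s' i)) = \sum_i a i *: res V'U' (s i).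
    rewrite liso_sum; apply: eq_bigr => i _; rewrite lisoZ (liso_res phi UW V'W).
    by rewrite liso_invK (res_res _ _ V'U').
  rewrite /relation_on -e; split=> [e0|->]; last exact: liso0.
  by rewrite -[LHS](lisoK phi V'W) e0 -(liso0 phi V'W) lisoK.
exists V, (subset_trans VU UU), k, r; split=> // [j|V' V'V V'U a ra y V'y].
  by apply/(rel V VU); apply: rr.
have V'U' := subset_trans V'V VU.
exact: (gr V' V'V V'U' a (proj1 (rel V' V'U' V'U a) ra) y V'y).
Qed.

End Modules.

(** * Twisting by O(1) *)

Section Twist.
Variables (K : closedFieldType) (n : nat) (Y : set (PP K n)).
Local Notation opens := (opens Y).
Local Notation O := (@structure_sheaf K n Y).
Local Notation UC U i := (opensI U (chart Y i)).

Lemma UC_l (U : opens) i : UC U i `<=` U. Proof. exact: subIsetl. Qed.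
Lemma UC_r (U : opens) i : UC U i `<=` chart Y i. Proof. exact: subIsetr. Qed.
Lemma UC_mono (U V : opens) i : V `<=` U -> UC V i `<=` UC U i.
Proof. by move=> VU x [/VU]. Qed.
Lemma UC_in (U V : opens) i : V `<=` U -> V `<=` chart Y i -> V `<=` UC U i.
Proof. by move=> VU Vi x Vx; split; [apply: VU|apply: Vi]. Qed.

Section TwistModule.
Variable F : omodule Y.

(* [s i] stands for the quotient of a section of F(1) by the coordinate X_i. *)
Record tw_sec (U : opens) := TwSec {
  tw_fam :> forall i, sec F (UC U i);
  tw_famP : forall i j (W : opens) (Wi : W `<=` UC U i) (Wj : W `<=` UC U j),
    res Wj (tw_fam j) = ratio (subset_trans Wj (@UC_r U j)) i *: res Wi (tw_fam i)
}.

Lemma tw_sec_eq U (s t : tw_sec U) : (forall i, s i = t i) -> s = t.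
Proof.
case: s t => [s sP] [t tP] /= st.
have e : s = t by apply: functional_extensionality_dep.
by subst t; congr TwSec; apply: Prop_irrelevance.
Qed.

Definition tw_sec0 U : tw_sec U.
Proof.
exists (fun=> 0) => i j W Wi Wj.
by rewrite !res0 scaler0.
Defined.

Definition tw_secD U (s t : tw_sec U) : tw_sec U.
Proof.
exists (fun i => s i + t i) => i j W Wi Wj.
by rewrite !resD (tw_famP s Wi Wj) (tw_famP t Wi Wj) scalerDr.
Defined.

Definition tw_secZ U (a : O U) (s : tw_sec U) : tw_sec U.
Proof.
exists (fun i => ores (@UC_l U i) a *: s i) => i j W Wi Wj.
rewrite !resZ (tw_famP s Wi Wj) !scalerA mulrC; congr (_ * _ *: _).
by rewrite !(ores_ores _ _ (subset_trans Wj (@UC_l U j))).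
Defined.

Definition tw_secN U (s : tw_sec U) : tw_sec U.
Proof.
exists (fun i => - s i) => i j W Wi Wj.
by rewrite !res_zmod (tw_famP s Wi Wj) scalerN.
Defined.

HB.instance Definition _ U := gen_eqMixin (tw_sec U).
HB.instance Definition _ U := gen_choiceMixin (tw_sec U).

Lemma tw_secDA U : associative (@tw_secD U).
Proof. by move=> s t u; apply: tw_sec_eq => i; apply: addrA. Qed.
Lemma tw_secDC U : commutative (@tw_secD U).
Proof. by move=> s t; apply: tw_sec_eq => i; apply: addrC. Qed.
Lemma tw_sec0D U : left_id (tw_sec0 U) (@tw_secD U).
Proof. by move=> s; apply: tw_sec_eq => i; apply: add0r. Qed.
Lemma tw_secND U : left_inverse (tw_sec0 U) (@tw_secN U) (@tw_secD U).
Proof. by move=> s; apply: tw_sec_eq => i; apply: addNr. Qed.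

HB.instance Definition _ U := GRing.isZmodule.Build (tw_sec U)
  (@tw_secDA U) (@tw_secDC U) (@tw_sec0D U) (@tw_secND U).

Lemma tw_secZA U (a b : O U) (s : tw_sec U) :
  tw_secZ a (tw_secZ b s) = tw_secZ (a * b) s.
Proof. by apply: tw_sec_eq => i /=; rewrite scalerA -oresM. Qed.
Lemma tw_sec1Z U : left_id (1 : O U) (@tw_secZ U).
Proof. by move=> s; apply: tw_sec_eq => i /=; rewrite ores1 scale1r. Qed.
Lemma tw_secZDr U : right_distributive (@tw_secZ U) +%R.
Proof. by move=> a s t; apply: tw_sec_eq => i /=; apply: scalerDr. Qed.
Lemma tw_secZDl U (s : tw_sec U) :
  {morph (@tw_secZ U)^~ s : a b / a + b}.
Proof. by move=> a b; apply: tw_sec_eq => i /=; rewrite oresD; apply: scalerDl. Qed.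

HB.instance Definition _ U := GRing.Zmodule_isLmodule.Build (O U) (tw_sec U)
  (@tw_secZA U) (@tw_sec1Z U) (@tw_secZDr U) (@tw_secZDl U).

Definition tw_res (U V : opens) (VU : V `<=` U) (s : tw_sec U) : tw_sec V.
Proof.
exists (fun i => res (UC_mono (i:=i) VU) (s i)) => i j W Wi Wj.
have Wi' := subset_trans Wi (UC_mono VU).
have Wj' := subset_trans Wj (UC_mono VU).
rewrite (res_res _ _ Wi') (res_res _ _ Wj') (tw_famP s Wi' Wj').
by congr (_ *: _); apply: regfun_eq => y; rewrite !ratioE.
Defined.

Definition twist_omodule : omodule Y.
Proof.
refine (@OModule K n Y (fun U => tw_sec U : lmodType (O U)) tw_res _ _ _ _ _).
- move=> U V VU a s t; apply: tw_sec_eq => i /=.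
  rewrite res_linear; congr (_ *: _ + _).
  by rewrite !(ores_ores _ _ (subset_trans (@UC_l V i) VU)).
- by move=> U UU s; apply: tw_sec_eq => i /=; apply: res_id.
- by move=> U V W VU WV WU s; apply: tw_sec_eq => i /=; apply: res_res.
- move=> I U V VU cov s t st; apply: tw_sec_eq => i.
  apply: (@sheaf_locality _ _ _ F I (UC U i) (fun k => UC (V k) i)
           (fun k => UC_mono (VU k))) => [x [Ux ix]|k].
    by have [k Vk] := cov x Ux; exists k.
  exact: (congr1 (fun u : tw_sec (V k) => u i) (st k)).
- move=> I U V VU cov s sc.
  have ext i : exists t : sec F (UC U i), forall k, res (UC_mono (VU k)) t = s k i.
    apply: sheaf_gluing => [x [Ux ix]|k l W Wk Wl].
      by have [k Vk] := cov x Ux; exists k.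
    have kW : W `<=` V k := subset_trans Wk (@UC_l _ _).
    have lW : W `<=` V l := subset_trans Wl (@UC_l _ _).
    have iW : W `<=` chart Y i := subset_trans Wk (@UC_r _ _).
    have WW : W `<=` UC W i by apply: UC_in.
    have /(congr1 (fun u : tw_sec W => res WW (u i))) := sc k l W kW lW.
    by rewrite /= (res_res _ _ Wk) (res_res _ _ Wl).
  pose t i := sval (cid (ext i)).
  have tE i k : res (UC_mono (VU k)) (t i) = s k i by apply: (svalP (cid (ext i))).
  (* The pieces glued chart by chart are compatible between charts: this holds on each member of the
     cover, hence everywhere by locality. *)
  have tP i j (W : opens) (Wi : W `<=` UC U i) (Wj : W `<=` UC U j) :
      res Wj (t j) = ratio (subset_trans Wj (@UC_r U j)) i *: res Wi (t i).
    have WU := subset_trans Wi (@UC_l _ _).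
    apply: (@sheaf_locality _ _ _ F I W (fun k => opensI W (V k))
             (fun k => @subIsetl _ W (V k))) => [x Wx|k].
      by have [k Vk] := cov x (WU x Wx); exists k.
    have Vi : opensI W (V k) `<=` UC (V k) i by move=> x [/Wi[_ ?]].
    have Vj : opensI W (V k) `<=` UC (V k) j by move=> x [/Wj[_ ?]].
    have Ui := subset_trans Vi (UC_mono (VU k)).
    have Uj := subset_trans Vj (UC_mono (VU k)).
    rewrite resZ (res_res _ _ Uj) (res_res _ _ Ui).
    rewrite -(res_res (UC_mono (VU k)) Vj) -(res_res (UC_mono (VU k)) Vi) !tE.
    rewrite (tw_famP (s k) Vi Vj); congr (_ *: _).
    by apply: regfun_eq => y; rewrite regfun_ores !ratioE.
  exists (TwSec tP) => k; apply: tw_sec_eq => i; exact: tE.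
Defined.

(* Over the chart X_i <> 0, multiplication by X_i identifies F with F(1). *)
Definition chart_twist i (V : opens) (Vi : V `<=` chart Y i) (s : sec F V) :
  tw_sec V.
Proof.
exists (fun j => ratio (@UC_r V j) i *: res (@UC_l V j) s) => j k W Wj Wk.
rewrite !resZ !(res_res _ _ (subset_trans Wj (@UC_l V j))) scalerA.
congr (_ *: _).
rewrite (ores_ratio _ Wk (subset_trans Wk (@UC_r V k))).
rewrite (ores_ratio _ Wj (subset_trans Wj (@UC_r V j))).
by rewrite ratioM.
Defined.

Definition chart_untwist i (V : opens) (Vi : V `<=` chart Y i) (s : tw_sec V) :
  sec F V := res (UC_in (@subset_refl _ V) Vi) (s i).

Lemma twist_local_iso i : local_iso F twist_omodule (chart Y i).
Proof.
refine (@LocalIso K n Y F twist_omodule (chart Y i)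
  (fun V Vi => @chart_twist i V Vi) (fun V Vi => @chart_untwist i V Vi) _ _ _ _).
- move=> V Vi s; rewrite /chart_untwist /= resZ (res_res _ _ (@subset_refl _ V)).
  rewrite res_id (ores_ratio _ _ Vi) ratio_id scale1r //.
- move=> V Vi s; apply: tw_sec_eq => j; rewrite /chart_untwist /=.
  have Wi : UC V j `<=` UC V i by move=> x [Vx _]; split=> //; apply: Vi.
  have := tw_famP s Wi (@subset_refl _ (UC V j)).
  rewrite res_id (res_res _ _ Wi) => ->; congr (_ *: _).
  by apply: regfun_eq => y; rewrite !ratioE.
- move=> V Vi a s t; apply: tw_sec_eq => j /=.
  by rewrite res_linear scalerDr !scalerA mulrC.
- move=> V V' Vi V'i V'V s; apply: tw_sec_eq => j /=.
  rewrite resZ (res_res _ _ (subset_trans (@UC_l V' j) V'V)).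
  rewrite (res_res _ _ (subset_trans (@UC_l V' j) V'V)).
  by rewrite (ores_ratio _ _ (@UC_r V' j)).
Defined.

Lemma twist_coherent : coherent F -> coherent twist_omodule.
Proof.
apply: coherent_liso => x Yx; have [i xi] := chart_cover Yx.
by exists (chart Y i) => //; split; apply: twist_local_iso.
Qed.

(** Multiplication by the linear form with coefficients c: as sections of the twist are divided by
    X_j on the chart X_j <> 0, the factor there is the form divided by X_j. *)
Definition linear_mul (c : 'I_n.+1 -> K) : omorphism F twist_omodule.
Proof.
unshelve refine (@OMorphism K n Y F twist_omodule
  (fun U s => @TwSec U (fun j => lratio (@UC_r U j) c *: res (@UC_l U j) s) _) _ _).
- move=> i j W Wi Wj.
  rewrite !resZ !(res_res _ _ (subset_trans Wj (@UC_l U j))) scalerA.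
  congr (_ *: _).
  rewrite (ores_lratio _ Wj (subset_trans Wj (@UC_r U j))).
  rewrite (ores_lratio _ Wi (subset_trans Wi (@UC_r U i))).
  by rewrite ratio_lratio.
- move=> U a s t; apply: tw_sec_eq => j /=.
  by rewrite res_linear scalerDr !scalerA mulrC.
- move=> U V VU s; apply: tw_sec_eq => j /=.
  rewrite resZ (res_res _ _ (subset_trans (@UC_l V j) VU)).
  rewrite (res_res _ _ (subset_trans (@UC_l V j) VU)).
  by rewrite (ores_lratio _ _ (@UC_r V j)).
Defined.

End TwistModule.

Definition tw_map (F G : omodule Y) (f : omorphism F G) :
  omorphism (twist_omodule F) (twist_omodule G).
Proof.
unshelve refine (@OMorphism K n Y (twist_omodule F) (twist_omodule G)
  (fun U (s : tw_sec F U) => @TwSec G U (fun j => app f (s j)) _) _ _).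
- by move=> i j W Wi Wj; rewrite -!app_res -appZ (tw_famP s Wi Wj).
- by move=> U a s t; apply: tw_sec_eq => j /=; rewrite app_linear.
- by move=> U V VU s; apply: tw_sec_eq => j /=; rewrite app_res.
Defined.

Lemma tw_map_linear_mul (F G : omodule Y) (f : omorphism F G) c :
  ohom_comp (tw_map f) (linear_mul F c) = ohom_comp (linear_mul G c) f.
Proof.
by apply: omorphism_eq => U s; apply: tw_sec_eq => j /=; rewrite appZ app_res.
Qed.

Lemma tw_map_liso (F G : omodule Y) (f : omorphism F G) i (V : opens)
    (Vi : V `<=` chart Y i) (s : sec F V) :
  app (tw_map f) (liso (twist_local_iso F i) Vi s)
  = liso (twist_local_iso G i) Vi (app f s).
Proof. by apply: tw_sec_eq => j /=; rewrite appZ app_res. Qed.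

Lemma tw_map_liso_inv (F G : omodule Y) (f : omorphism F G) i (V : opens)
    (Vi : V `<=` chart Y i) (s : sec (twist_omodule F) V) :
  app f (liso_inv (twist_local_iso F i) Vi s)
  = liso_inv (twist_local_iso G i) Vi (app (tw_map f) s).
Proof.
apply: (can_inj (lisoK (twist_local_iso G i) Vi)).
by rewrite -tw_map_liso !liso_invK.
Qed.

Definition twist (F : coherent_sheaf Y) : coherent_sheaf Y :=
  CoherentSheaf (twist_coherent (csheafP F)).

Section TwistComplex.
Variable X : Chb (Coh Y).

Lemma twist_cdd m :
  ohom_comp (tw_map (cd X (m + 1))) (tw_map (cd X m)) = 0.
Proof.
apply: omorphism_eq => U s; apply: tw_sec_eq => j /=.
exact: (congr1 (fun f : omorphism _ _ => app f (s j)) (cdd X m)).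
Qed.

Lemma twist_cbounded : exists N : int, forall m : int, N < `|m| ->
  ohom_id (twist (cob X m)) = 0.
Proof.
have [N HN] := cbounded X; exists N => m Nm.
apply: omorphism_eq => U s; apply: tw_sec_eq => j /=.
exact: (congr1 (fun f : omorphism _ _ => app f (s j)) (HN m Nm)).
Qed.

Definition twist_complex : Chb (Coh Y) :=
  @Complex (Coh Y) (fun m => twist (cob X m)) (fun m => tw_map (cd X m))
    twist_cdd twist_cbounded.

Lemma linear_chain_subproof c m :
  ohom_comp (linear_mul (cob X (m + 1)) c) (cd X m)
  = ohom_comp (tw_map (cd X m)) (linear_mul (cob X m) c).
Proof. by rewrite tw_map_linear_mul. Qed.

Definition linear_chain c : hom X twist_complex :=
  @ChainMap (Coh Y) X twist_complex (fun m => linear_mul (cob X m) c)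
    (linear_chain_subproof c).

End TwistComplex.

Section TwistChain.
Variables (X X' : Chb (Coh Y)) (f : hom X X').

Lemma twist_chain_subproof m :
  ohom_comp (tw_map (cmap f (m + 1))) (tw_map (cd X m))
  = ohom_comp (tw_map (cd X' m)) (tw_map (cmap f m)).
Proof.
apply: omorphism_eq => U s; apply: tw_sec_eq => j /=.
exact: (congr1 (fun f : omorphism _ _ => app f (s j)) (cmap_d f m)).
Qed.

Definition twist_chain : hom (twist_complex X) (twist_complex X') :=
  @ChainMap (Coh Y) (twist_complex X) (twist_complex X')
    (fun m => tw_map (cmap f m)) twist_chain_subproof.

Lemma linear_chain_nat c m :
  ohom_comp (tw_map (cmap f m)) (cmap (linear_chain X c) m)
  = ohom_comp (cmap (linear_chain X' c) m) (cmap f m).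
Proof. exact: tw_map_linear_mul. Qed.

(** Being a quasi-isomorphism is a local condition, and on each chart the twist is naturally
    isomorphic to the identity. *)
Lemma twist_quasi_iso : quasi_iso f -> quasi_iso twist_chain.
Proof.
move=> qf m; have [inj surj] := qf m; split.
- move=> U s ds [t st] x Ux.
  have [i xi] := chart_cover (opens_sub Ux).
  have ii := @UC_r U i; have lU := @UC_l U i.
  pose s' := liso_inv (twist_local_iso (cob X (m + 1)) i) ii (res lU s).
  pose t' := liso_inv (twist_local_iso (cob X' m) i) ii (res lU t).
  have [|| V [VU [u [Vx su]]]] := inj (UC U i) s' _ _ x (conj Ux xi).
  + rewrite /s' tw_map_liso_inv app_res ds res0.
    by rewrite -(liso0 (twist_local_iso (cob X (m + 1 + 1)) i) ii) lisoK.
  + exists t'; rewrite /s' /t' !tw_map_liso_inv !app_res; congr (liso_inv _ _ (res _ _)).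
    exact: st.
  have Vi := subset_trans VU ii.
  exists V, (subset_trans VU lU), (liso (twist_local_iso (cob X m) i) Vi u).
  split=> //; rewrite [RHS](tw_map_liso (cd X m)) -su (liso_res _ ii Vi) liso_invK.
  by rewrite (res_res _ _ (subset_trans VU lU)).
- move=> U t dt x Ux.
  have [i xi] := chart_cover (opens_sub Ux).
  have ii := @UC_r U i; have lU := @UC_l U i.
  pose t' := liso_inv (twist_local_iso (cob X' (m + 1)) i) ii (res lU t).
  have [|V [VU [s [u [Vx ds tsu]]]]] := surj (UC U i) t' _ x (conj Ux xi).
    rewrite /t' tw_map_liso_inv app_res dt res0.
    by rewrite -(liso0 (twist_local_iso (cob X' (m + 1 + 1)) i) ii) lisoK.
  have Vi := subset_trans VU ii.
  exists V, (subset_trans VU lU), (liso (twist_local_iso (cob X (m + 1)) i) Vi s),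
    (liso (twist_local_iso (cob X' m) i) Vi u); split=> //.
    by rewrite [LHS](tw_map_liso (cd X (m + 1))) ds liso0.
  rewrite [X in _ = X + _](tw_map_liso (cmap f (m + 1))).
  rewrite [X in _ = _ + X](tw_map_liso (cd X' m)) -lisoD -tsu (liso_res _ ii Vi) liso_invK.
  by rewrite (res_res _ _ (subset_trans VU lU)).
Qed.

End TwistChain.
End Twist.

(** * Morphisms in the derived category *)

Section DerivedHom.
Variables (K : closedFieldType) (n : nat) (Y : set (PP K n)).
Local Notation opens := (opens Y).
Local Notation O := (@structure_sheaf K n Y).
Local Notation D := (DbCoh Y).
Local Notation zigzag := (@zigzag (Chb (Coh Y)) (@quasi_iso K n Y)).
Local Notation zz_of f := (@zz_of (Chb (Coh Y)) (@quasi_iso K n Y) _ _ f).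
Implicit Types X Z T : Chb (Coh Y).

Lemma zz_ofM X Z T (g : hom Z T) (f : hom X Z) :
  zz_eq (zz_fwd g (zz_of f)) (zz_of (comp g f)).
Proof. by apply: zz_sym; apply: zz_fwd_comp. Qed.

Lemma zz_of_eq X Z (f g : hom X Z) :
  heq f g -> zz_eq (zz_of f) (zz_of g).
Proof. by move=> fg; apply: zz_fwd_cong => //; apply: zz_refl. Qed.

Definition chain0 X Z : hom X Z.
Proof.
unshelve refine (@ChainMap (Coh Y) X Z _ _); first exact: (fun m => 0).
move=> m.
by apply: omorphism_eq => U s /=; rewrite app0.
Defined.

(** At a backward arrow s, the zero map is rewritten as s composed with a zero map, and s cancels
    against its formal inverse. *)
Lemma zz_comp0 X Z T (p : zigzag Z T) :
  zz_eq (zz_comp p (zz_of (chain0 X Z))) (zz_of (chain0 X T)).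
Proof.
elim: p => [|T1 T2 f p IH|T1 T2 s w p IH] /=; first exact: zz_refl.
- apply: zz_trans (zz_fwd_cong (heq_refl f) IH) _.
  apply: zz_trans (zz_ofM _ _) _; apply: zz_of_eq => m.
  by apply: omorphism_eq => U t /=; rewrite app0.
- apply: zz_trans (zz_bwd_cong w IH) _.
  apply: zz_trans (zz_bwd_fwd w _).
  apply: zz_bwd_cong; apply: zz_sym.
  apply: zz_trans (zz_ofM _ _) _; apply: zz_of_eq => m.
  by apply: omorphism_eq => U t /=; rewrite app0.
Qed.

(** The naturality square of the linear form is pasted along the zigzag; backward arrows can be
    twisted because the twist preserves quasi-isomorphisms. *)
Lemma linear_chain_zigzag c X Z (p : zigzag X Z) :
  exists q : zigzag (twist_complex X) (twist_complex Z),
    zz_eq (zz_fwd (linear_chain Z c) p) (zz_comp q (zz_of (linear_chain X c))).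
Proof.
elim: p => [|T1 T2 f p [q IH]|T1 T2 s w p [q IH]].
- by exists (zz_id _ _); apply: zz_refl.
- exists (zz_fwd (twist_chain f) q) => /=.
  apply: zz_trans (zz_sym (zz_fwd_comp _ _ _)) _.
  apply: zz_trans _ (zz_fwd_cong (heq_refl _) IH).
  apply: zz_trans _ (zz_fwd_comp _ _ _).
  apply: zz_fwd_cong (zz_refl _) => m; apply: esym; exact: linear_chain_nat.
- have w' := twist_quasi_iso w.
  exists (zz_bwd w' q) => /=.
  apply: zz_trans _ (zz_bwd_cong _ IH).
  apply: zz_trans (zz_sym (zz_bwd_fwd w' _)) _; apply: zz_bwd_cong.
  apply: zz_trans (zz_sym (zz_fwd_comp _ _ _)) _.
  have e : heq (comp (twist_chain s) (linear_chain T2 c))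
               (comp (linear_chain T1 c) s).
    by move=> m; apply: linear_chain_nat.
  apply: zz_trans (zz_fwd_cong e (zz_refl _)) _.
  apply: zz_trans (zz_fwd_comp _ _ _) _; apply: zz_fwd_cong (heq_refl _) _.
  exact: zz_fwd_bwd.
Qed.

Lemma bij_quasi_iso X Z (f : hom X Z) :
  (forall m U, injective (fun s : sec (cob X m) U => app (cmap f m) s)) ->
  (forall m U (t : sec (cob Z m) U), exists s, app (cmap f m) s = t) ->
  quasi_iso f.
Proof.
move=> inj surj m.
have fd k U (s : sec (cob X k) U) :
    app (cmap f (k + 1)) (app (cd X k) s) = app (cd Z k) (app (cmap f k) s).
  exact: (congr1 (fun h : omorphism _ _ => app h s) (cmap_d f k)).
split=> [U s ds [t st] x Ux|U t dt x Ux].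
  have [u ut] := surj m U t.
  exists U, (@subset_refl _ U), u; split=> //; rewrite res_id.
  by apply: inj; rewrite fd ut.
have [s st] := surj (m + 1) U t.
exists U, (@subset_refl _ U), s, 0; split=> //; last by rewrite res_id app0 addr0.
by apply: inj; rewrite fd st dt app0.
Qed.

(* A linear form that kills X and acts invertibly on Z separates them: it
   intertwines the zigzags from X to Z with their twists. *)
Lemma hom_trivial_linear c X Z :
  (forall m U (s : sec (cob X m) U), app (linear_mul (cob X m) c) s = 0) ->
  (forall m U, injective (fun s : sec (cob Z m) U => app (linear_mul (cob Z m) c) s)) ->
  (forall m U (t : sec (twist (cob Z m)) U),
     exists s, app (linear_mul (cob Z m) c) s = t) ->
  hom_trivial (C:=D) X Z.
Proof.
move=> c0 inj surj.
have w := @bij_quasi_iso Z (twist_complex Z) (linear_chain Z c) inj surj.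
(* With w the form on Z and l the form on X, p = w^-1 w p = w^-1 q l = w^-1 q 0 = w^-1 0, which does
   not depend on p. *)
have l0 (p : zigzag X Z) : zz_eq p (zz_bwd w (zz_of (chain0 X (twist_complex Z)))).
  have [q qE] := linear_chain_zigzag c p.
  apply: zz_trans (zz_sym (zz_bwd_fwd w p)) _; apply: zz_bwd_cong.
  apply: zz_trans qE _; apply: zz_trans _ (zz_comp0 X q).
  apply: zz_comp_eq (zz_refl _) _; apply: zz_of_eq => m.
  by apply: omorphism_eq => U s /=; apply: c0.
by move=> p q; apply: zz_trans (l0 p) (zz_sym (l0 q)).
Qed.

Definition coboundary_at X (m : int) (x : PP K n) (V : opens)
    (s : sec (cob X (m + 1)) V) : Prop :=
  exists (W : opens) (WV : W `<=` V) (u : sec (cob X m) W),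
    oset W x /\ res WV s = app (cd X m) u.

(** On an exact complex the zero endomorphism is a quasi-isomorphism, so it becomes invertible and
    every p equals p 0 0^-1 = 0 0^-1. *)
Lemma exact_hom_trivial X :
  (forall m V (s : sec (cob X (m + 1)) V), app (cd X (m + 1)) s = 0 ->
     forall x, oset V x -> coboundary_at x s) ->
  hom_trivial (C:=D) X X.
Proof.
move=> eX.
have w : quasi_iso (chain0 X X : hom X X).
  move=> m; split=> [U s ds _ x Ux|U t dt x Ux].
    have [W [WU [u [Wx su]]]] := eX m U s ds x Ux.
    by exists W, WU, u.
  have [W [WU [u [Wx su]]]] := eX m U t dt x Ux.
  exists W, WU, 0, u; split=> //; first by rewrite app0.
  by rewrite app0 add0r.
have l0 (p : zigzag X X) :
    zz_eq p (zz_comp (zz_of (chain0 X X)) (zz_bwd w (zz_id _ X))).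
  have e : zz_eq p (zz_comp p (zz_fwd (chain0 X X) (zz_bwd w (zz_id _ X)))).
    rewrite -{1}[p]zz_compm1; apply: zz_comp_eq (zz_refl _) _.
    by apply: zz_sym; apply: zz_fwd_bwd.
  apply: zz_trans e _.
  rewrite -[zz_fwd _ _]/(zz_comp (zz_of (chain0 X X)) (zz_bwd w (zz_id _ X))).
  by rewrite zz_compA; apply: zz_comp_eq (zz_comp0 X p) (zz_refl _).
by move=> p q; apply: zz_trans (l0 p) (zz_sym (l0 q)).
Qed.

(** * Action of zigzags on stalks of cohomology *)

Section Germs.
Variables (x : PP K n) (m : int).

Record germ X := Germ {
  gopen : opens;
  gsec : sec (cob X (m + 1)) gopen;
  gmem : oset gopen x;
  gcocycle : app (cd X (m + 1)) gsec = 0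
}.

Definition cohomologous X (a b : germ X) : Prop :=
  exists (W : opens) (Wa : W `<=` gopen a) (Wb : W `<=` gopen b)
         (u : sec (cob X m) W),
    oset W x /\ res Wa (gsec a) = res Wb (gsec b) + app (cd X m) u.

Lemma cohomologous_refl X (a : germ X) : cohomologous a a.
Proof.
exists (gopen a), (@subset_refl _ _), (@subset_refl _ _), 0.
by split; [apply: gmem|rewrite app0 addr0].
Qed.

Lemma cohomologous_sym X (a b : germ X) : cohomologous a b -> cohomologous b a.
Proof.
move=> [W [Wa [Wb [u [Wx e]]]]]; exists W, Wb, Wa, (- u); split=> //.
by rewrite e app_opp addrK.
Qed.

Lemma cohomologous_trans X (a b c : germ X) :
  cohomologous a b -> cohomologous b c -> cohomologous a c.
Proof.
move=> [W [Wa [Wb [u [Wx e]]]]] [V [Vb [Vc [v [Vx f]]]]].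
have IW : opensI W V `<=` W by apply: subIsetl.
have IV : opensI W V `<=` V by apply: subIsetr.
exists (opensI W V), (subset_trans IW Wa), (subset_trans IV Vc),
  (res IV v + res IW u); split=> //.
rewrite -(res_res Wa IW) e resD (res_res _ _ (subset_trans IV Vb)).
rewrite -(res_res Vb IV) f resD (res_res _ _ (subset_trans IV Vc)).
by rewrite app_add !app_res addrA.
Qed.

Definition germ_map X Z (f : hom X Z) (a : germ X) : germ Z.
Proof.
exists (gopen a) (app (cmap f (m + 1)) (gsec a)); first exact: gmem.
have := congr1 (fun h : omorphism _ _ => app h (gsec a)) (cmap_d f (m + 1)).
by move=> /= <-; rewrite gcocycle app0.
Defined.

Lemma germ_map_cohomologous X Z (f : hom X Z) a b :
  cohomologous a b -> cohomologous (germ_map f a) (germ_map f b).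
Proof.
move=> [W [Wa [Wb [u [Wx e]]]]]; exists W, Wa, Wb, (app (cmap f m) u).
split=> //=; rewrite -!app_res e app_add; congr (_ + _).
exact: (congr1 (fun h : omorphism _ _ => app h u) (cmap_d f m)).
Qed.

Lemma germ_map_inj X Z (f : hom X Z) a b : quasi_iso f ->
  cohomologous (germ_map f a) (germ_map f b) -> cohomologous a b.
Proof.
move=> qf [W [Wa [Wb [u [Wx /= e]]]]]; have [inj _] := qf m.
have [|| V [VW [v [Vx f']]]] := inj W (res Wa (gsec a) - res Wb (gsec b)) _ _ x Wx.
- by rewrite app_add app_opp !app_res !gcocycle !res0 subrr.
- by exists u; rewrite app_add app_opp !app_res e addrAC subrr add0r.
exists V, (subset_trans VW Wa), (subset_trans VW Wb), v; split=> //.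
rewrite -f' resD (res_zmod _ VW) !(res_res _ _ (subset_trans VW Wa)).
by rewrite !(res_res _ _ (subset_trans VW Wb)) addrCA subrr addr0.
Qed.

Lemma germ_map_surj X Z (f : hom X Z) b : quasi_iso f ->
  exists a, cohomologous (germ_map f a) b.
Proof.
move=> qf; have [_ surj] := qf m.
have [V [VW [s [u [Vx ds e]]]]] := surj _ _ (gcocycle b) x (gmem b).
exists (@Germ X V s Vx ds), V, (@subset_refl _ V), VW, (- u); split=> //=.
by rewrite res_id e app_opp addrK.
Qed.

(* The action of the localized category on the stalk at x of the cohomology
   sheaf in degree m+1, as a relation between cocycles. *)
Fixpoint germ_rel X Z (p : zigzag X Z) : germ X -> germ Z -> Prop :=
  match p in Defs.zigzag _ _ Z return germ X -> germ Z -> Prop with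
  | zz_id => fun a b => cohomologous a b
  | zz_fwd _ _ f q => fun a b =>
      exists2 c, germ_rel q a c & cohomologous (germ_map f c) b
  | zz_bwd _ _ s _ q => fun a b =>
      exists2 c, germ_rel q a c & cohomologous c (germ_map s b)
  end.

Lemma germ_rel_cohomologous X Z (p : zigzag X Z) a b b' :
  cohomologous b b' -> germ_rel p a b -> germ_rel p a b'.
Proof.
case: p b b' => /= [|T1 T2 f q|T1 T2 s w q] b b' bb'.
- by move=> ab; apply: cohomologous_trans bb'.
- by move=> [c ac cb]; exists c => //; apply: cohomologous_trans bb'.
- move=> [c ac cb]; exists c => //; apply: cohomologous_trans cb _.
  exact: germ_map_cohomologous.
Qed.

(** Cancelling a backward arrow rests on bijectivity of quasi-isomorphisms on stalks of cohomology:
    surjectivity for s s^-1, injectivity for s^-1 s. *)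
Lemma germ_rel_eq X Z (p q : zigzag X Z) : zz_eq p q ->
  forall a b, germ_rel p a b <-> germ_rel q a b.
Proof.
elim=> {Z p q} /=.
- by [].
- by move=> Z p q _ IH a b; rewrite IH.
- by move=> Z p q r _ IH1 _ IH2 a b; rewrite IH1.
- move=> T1 T2 f g p q fg _ IH a b.
  have e c : cohomologous (germ_map f c) (germ_map g c).
    exists (gopen c), (@subset_refl _ _), (@subset_refl _ _), 0.
    by split; [apply: gmem|rewrite app0 addr0 /= fg].
  split=> -[c ac cb]; exists c.
  - by apply/IH.
  - exact: cohomologous_trans (cohomologous_sym (e c)) cb.
  - by apply/IH.
  - exact: cohomologous_trans (e c) cb.
- by move=> T1 T2 s w p q _ IH a b; split=> -[c ac cb]; exists c => //; apply/IH.
- move=> T1 p a b; split=> [[c ac cb]|ab].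
    exact: germ_rel_cohomologous (cb : cohomologous c b) ac.
  by exists b => //; apply: (cohomologous_refl b).
- move=> T1 T2 T3 g f p a b; split=> [[c ac cb]|[c [d ad dc] cb]].
    exists (germ_map f c) => //; exists c => //; exact: cohomologous_refl.
  by exists d => //; apply: cohomologous_trans cb; apply: germ_map_cohomologous dc.
- move=> T1 T2 s w p a b; split=> [[c [d ad dc] cb]|ab].
    by apply: germ_rel_cohomologous ad; apply: cohomologous_trans dc cb.
  have [c cb] := germ_map_surj b w.
  by exists c => //; exists b => //; apply: cohomologous_sym.
- move=> T1 T2 s w p a b; split=> [[c [d ad dc] cb]|ab].
    apply: germ_rel_cohomologous ad; apply: (germ_map_inj w).
    exact: cohomologous_trans dc cb.
  exists (germ_map s b); last exact: cohomologous_refl.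
  by exists b => //; apply: cohomologous_refl.
Qed.

End Germs.

(** The identity relates the germ of s to itself, while the zero map relates germs only to
    coboundaries. *)
Lemma nonexact_hom_nontrivial X m V (s : sec (cob X (m + 1)) V) x :
  oset V x -> app (cd X (m + 1)) s = 0 -> ~ coboundary_at x s ->
  ~ hom_trivial (C:=D) X X.
Proof.
move=> Vx ds ns tr; apply: ns; pose a := Germ Vx ds.
have e := tr (zz_id _ X) (zz_of (chain0 X X)).
have [+ _] := germ_rel_eq e a a; move=> /(_ (cohomologous_refl a)) [c _].
move=> /cohomologous_sym[W [Wa [Wc [u [Wx /= su]]]]].
by exists W, Wa, u; split=> //; rewrite su res0 add0r.
Qed.

End DerivedHom.

(** * The maximal ideal of a point *)

Section Points.
Variables (K : closedFieldType) (n : nat).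
Implicit Types x y : PP K n.

Definition lin_val (c : 'I_n.+1 -> K) x : K := \sum_i c i * hcoord x i.

(** The linear form x_i X_j - x_j X_i. When x_i <> 0, these forms for varying j cut out the point
    x. *)
Definition minor x (i j : 'I_n.+1) : 'I_n.+1 -> K :=
  fun k => hcoord x i * (k == j)%:R - hcoord x j * (k == i)%:R.

Lemma lin_val_minor x i j y :
  lin_val (minor x i j) y = hcoord x i * hcoord y j - hcoord x j * hcoord y i.
Proof.
rewrite /lin_val; under eq_bigr do rewrite mulrBl.
rewrite big_split /= sumrN (bigD1 j) //= [in X in _ - X](bigD1 i) //=.
rewrite !eqxx !mulr1 !big1 ?addr0 // => k /negPf->; by rewrite mulr0 mul0r.
Qed.

Lemma point_eq x y i : hcoord x i != 0 ->
  (forall j, lin_val (minor x i j) y = 0) -> x = y.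
Proof.
move=> xi xy; apply: val_inj.
have d1 (z : PP K n) : <[vpick (val z)]>%VS = val z.
  apply/eqP; rewrite eqEdim -memvE memv_pick (eqP (valP z)) dim_vline.
  by rewrite vpick0 -dimv_eq0 (eqP (valP z)).
have yx : vpick (val y) = (hcoord y i / hcoord x i) *: vpick (val x).
  apply/rowP => j; rewrite mxE; have /eqP := xy j.
  rewrite lin_val_minor subr_eq0 /hcoord => /eqP e.
  apply: (mulfI xi); rewrite /hcoord in xi *; rewrite e.
  by field; rewrite xi.
apply/esym/eqP; rewrite eqEdim (eqP (valP x)) (eqP (valP y)) leqnn andbT.
by rewrite -[in X in (X <= _)%VS]d1 -memvE yx memvZ // memv_pick.
Qed.

Lemma lin_val_minor_self x i j : lin_val (minor x i j) x = 0.
Proof. by rewrite lin_val_minor mulrC subrr. Qed.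

Lemma separating_form x y : x <> y ->
  exists c, lin_val c x = 0 /\ lin_val c y != 0.
Proof.
move=> xy; have [i xi] := hcoord_neq0 x.
apply: contrapT => /forallNP nc; apply: xy; apply: (point_eq xi) => j.
apply: contrapT => /eqP yj; apply: (nc (minor x i j)); split=> //.
exact: lin_val_minor_self.
Qed.

Lemma closed_point x : zariski_closed [set x].
Proof.
have [i xi] := hcoord_neq0 x.
exists [set p | exists j, p = linear_form (minor x i j)]; split.
  by move=> _ [j ->]; exists 1%N; apply: linear_form_homog.
apply/seteqP; split=> [_ -> _ [j ->]|y yx].
  by rewrite linear_formE; apply: lin_val_minor_self.
apply/esym/(point_eq xi) => j; rewrite /lin_val -linear_formE.
by apply: yx; exists j.
Qed.

End Points.

Section MaximalIdeal.
Variables (K : closedFieldType) (n : nat) (Y : set (PP K n)).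
Local Notation opens := (opens Y).
Local Notation O := (@structure_sheaf K n Y).

Section Taylor.
Variables (W : opens) (N : nat) (r : 'I_N -> O W) (c : 'I_N -> K).

(** Says that p(r) - p(c) lies in the ideal generated by the r_q - c_q, with regular coefficients.
    The property is closed under sums and products, hence holds for all polynomials. *)
Let taylor (p : {mpoly K[N]}) : Prop := exists g : 'I_N -> O W, forall y,
  p.@[fun q => regfun (r q) y]
  = p.@[c] + \sum_q regfun (g q) y * (regfun (r q) y - c q).

Let taylorC a : taylor a%:MP.
Proof.
exists (fun=> 0) => y; rewrite !mevalC big1 ?addr0 // => q _.
by rewrite regfun0 mul0r.
Qed.

Let taylorD p q : taylor p -> taylor q -> taylor (p + q).
Proof.
move=> [g gP] [h hP]; exists (fun i => g i + h i) => y.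
rewrite !mevalD gP hP addrACA -big_split; congr (_ + _).
by apply: eq_bigr => i _; rewrite [LHS]/= regfunD mulrDl.
Qed.

Let taylorM p q : taylor p -> taylor q -> taylor (p * q).
Proof.
move=> [g gP] [h hP].
have [Q QE] : exists Q : O W, forall y, regfun Q y = q.@[fun i => regfun (r i) y].
  exists (oconst W q.@[c] + \sum_i h i * (r i - oconst W (c i))) => y; rewrite hP regfunD regfun_sum oconstE; congr (_ + _); apply: eq_bigr => i _.
  by cbv beta; rewrite regfunM regfunD regfunN oconstE.
(* From p(r) q(r) - p(c) q(c) = (p(r) - p(c)) q(r) + p(c) (q(r) - q(c)). *)
exists (fun i => g i * Q + oconst W p.@[c] * h i) => y.
rewrite !mevalM -QE gP mulrDl {1}QE hP mulrDr -addrA; congr (_ + _).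
rewrite mulr_sumr mulr_suml -big_split; apply: eq_bigr => i _.
by rewrite [LHS]/= regfunD !regfunM oconstE; ring.
Qed.

Let taylorX i : taylor 'X_i.
Proof.
exists (fun q => oconst W (q == i)%:R) => y; rewrite !mevalXU.
under eq_bigr do rewrite oconstE.
rewrite (bigD1 i) //= eqxx mul1r big1 => [|q /negPf->]; last by rewrite mul0r.
by rewrite addr0 addrC subrK.
Qed.

Lemma taylorP p : taylor p.
Proof.
elim/mpolyind: p => [|a m p _ _ IH]; first exact: taylorC.
apply: taylorD IH; rewrite -mul_mpolyC; apply: taylorM; first exact: taylorC.
rewrite mpolyXE_id; elim/big_ind: _ => // [|i _]; first exact: taylorC.
elim: (m i) => [|k IH]; first exact: taylorC.
by rewrite exprS; apply: taylorM.
Qed.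

End Taylor.

Lemma meval_homogZ N d (p : {mpoly K[N]}) (a : K) v : p \is d.-homog ->
  p.@[fun i => a * v i] = a ^+ d * p.@[v].
Proof.
move=> ph; rewrite !mevalE mulr_sumr; apply: eq_big_seq => m mp.
rewrite mulrCA; congr (_ * _).
have -> : d = mdeg m by move/dhomogP: ph => /(_ m mp).
rewrite mdegE -prodrXr -big_split /=; apply: eq_bigr => i _.
by rewrite exprMn.
Qed.

(* Away from x one of the generators is invertible; near x this is the Taylor
   expansion at x of the numerator of [h]. *)
Lemma maximal_ideal_generated x i (W : opens) (Wi : W `<=` chart Y i)
    (h : O W) (y : W) :
  hcoord x i != 0 -> (forall z, val z = x -> regfun h z = 0) ->
  exists (W' : opens) (W'W : W' `<=` W) (b : 'I_n.+1 -> O W'),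
    oset W' (val y) /\
    ores W'W h = \sum_q b q * lratio (subset_trans W'W Wi) (minor x i q).
Proof.
move=> xi hx; have Wy : oset W (val y) := set_mem (valP y).
have [yx|yx] := pselect (val y = x); last first.
  have [q yq] : exists q, lin_val (minor x i q) (val y) != 0.
    apply: contrapT => /forallNP nq; apply: yx; apply: esym.
    by apply: (point_eq xi) => q; apply: contrapT => /eqP /nq.
  pose U := nonvanishing Y (ex_intro _ 1%N (linear_form_homog (minor x i q))).
  have W'W : opensI W U `<=` W by apply: subIsetl.
  have nz z : oset (opensI W U) z -> (linear_form (minor x i q)).@[hcoord z] != 0.
    by case=> _ [].
  exists (opensI W U), W'W, (fun k => if k == q then
    ores W'W h * frac (@coord_homog K n i) (linear_form_homog _) nz else 0).
  split; first by split=> //; split; [apply: opens_sub Wy|rewrite linear_formE].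
  rewrite (bigD1 q) //= eqxx big1 ?addr0; last first.
    by move=> k /negPf->; rewrite mul0r.
  apply: regfun_eq => z; rewrite !regfunM fracE lratioE mevalXU -linear_formE.
  have zi : hcoord (val z) i != 0 by apply: (chart_coord (subset_trans W'W Wi)).
  have := nz (val z) (set_mem (valP z)).
  move: (_.@[_]) => t t0; rewrite -[LHS]mulr1 -mulrA; congr (_ * _).
  by field; rewrite zi.
have /asboolP rh := valP h.
have [U [d [p [q [Uy ph qh pq]]]]] := rh y.
have W'W : opensI W U `<=` W by apply: subIsetl.
pose W' := opensI W U; have W'i := subset_trans W'W Wi.
have hpq (z : W') : q.@[hcoord (val z)] != 0 /\
    regfun h (incl W'W z) = p.@[hcoord (val z)] / q.@[hcoord (val z)].
  by apply: (pq (incl W'W z)); case: (set_mem (valP z)).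
have zi (z : W') : hcoord (val z) i != 0 by apply: chart_coord W'i z.
have [g gP] := taylorP (fun k => ratio W'i k) (fun k => hcoord x k / hcoord x i) p.
have hX z : oset W' z -> q.@[hcoord z] != 0.
  by move=> Wz; have [] := hpq (exist _ z (mem_set Wz)).
have Xd : (('X_i : {mpoly K[n.+1]}) ^+ d) \is d.-homog.
  by have := dhomogMn d (@coord_homog K n i); rewrite mul1n.
(* Since p and q have the same degree d, h = p/q equals (X_i^d / q) p(X/X_i). The expansion is at X
   = x, where p vanishes, and X_k/X_i - x_k/x_i is the k-th generator divided by x_i. *)
pose Q : O W' := frac Xd qh hX.
exists W', W'W, (fun k => Q * g k * oconst W' (hcoord x i)^-1).
split=> //; apply: regfun_eq => z.
rewrite regfun_ores regfun_sum; have [qz ->] := hpq z.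
have px : p.@[fun k => hcoord x k / hcoord x i] = 0.
  rewrite (_ : (fun k => _) = (fun k => (hcoord x i)^-1 * hcoord x k)); last first.
    by apply/funext => k; rewrite mulrC.
  rewrite (meval_homogZ _ _ ph) -yx.
  have Wx : oset W' (val y) by [].
  have [qy hy] := hpq (exist _ (val y) (mem_set Wx)).
  have : regfun h (incl W'W (exist _ (val y) (mem_set Wx))) = 0 by apply: hx.
  rewrite hy => /eqP; rewrite mulf_eq0 invr_eq0 (negPf qy) orbF => /eqP /= ->.
  by rewrite mulr0.
have pz : p.@[hcoord (val z)] = hcoord (val z) i ^+ d *
    \sum_k regfun (g k) z * (regfun (ratio W'i k) z - hcoord x k / hcoord x i).
  have := gP z; rewrite px add0r => <-.
  rewrite -(meval_homogZ _ _ ph); congr (p.@[_]); apply/funext => k.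
  by rewrite ratioE mulrC divfK.
rewrite pz mulrAC mulr_sumr; apply: eq_bigr => k _.
rewrite !regfunM ratioE lratioE oconstE fracE -/(lin_val _ _) lin_val_minor.
rewrite rmorphXn /= mevalXU.
by field; rewrite qz xi zi.
Qed.

End MaximalIdeal.

(** * Skyscraper sheaves *)

Section Skyscraper.
Variables (K : closedFieldType) (n : nat) (Y : set (PP K n)).
Local Notation opens := (opens Y).
Local Notation O := (@structure_sheaf K n Y).
Variable x : PP K n.

(** The value at x, extended by 0 to open sets that miss x; over those the skyscraper has only the
    zero section, so the default is harmless. *)
Definition evx (U : opens) (a : O U) : K :=
  match pselect (oset U x) with
  | left Ux => regfun a (exist _ x (mem_set Ux))
  | right _ => 0
  end.

Lemma evxE (U : opens) (a : O U) (z : U) : val z = x -> evx a = regfun a z.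
Proof.
move=> zx; rewrite /evx; case: pselect => [Ux|nUx].
  by congr (regfun a _); apply: val_inj.
by case: nUx; rewrite -zx; apply: set_mem (valP z).
Qed.

Lemma evx_out (U : opens) (a : O U) : ~ oset U x -> evx a = 0.
Proof. by rewrite /evx; case: pselect. Qed.

Lemma evxD (U : opens) (a b : O U) : evx (a + b) = evx a + evx b.
Proof. by rewrite /evx; case: pselect => // _; rewrite addr0. Qed.

Lemma evxM (U : opens) (a b : O U) : evx (a * b) = evx a * evx b.
Proof. by rewrite /evx; case: pselect => // _; rewrite mulr0. Qed.

Lemma evx_ores (U V : opens) (VU : V `<=` U) (a : O U) :
  oset V x -> evx (ores VU a) = evx a.
Proof.
move=> Vx; rewrite (@evxE _ _ (exist _ x (mem_set Vx))) // regfun_ores.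
by rewrite (@evxE _ _ (incl VU (exist _ x (mem_set Vx)))).
Qed.

Lemma evx_const (U : opens) c : oset U x -> evx (oconst U c) = c.
Proof.
by move=> Ux; rewrite (@evxE _ _ (exist _ x (mem_set Ux))) // oconstE.
Qed.

Lemma evx1 (U : opens) : oset U x -> evx (1 : O U) = 1.
Proof. by move=> Ux; rewrite (@evxE _ _ (exist _ x (mem_set Ux))). Qed.

Lemma evx_sum (U : opens) (I : finType) (a : I -> O U) :
  evx (\sum_i a i) = \sum_i evx (a i).
Proof.
elim/big_rec2: _ => [|i u v _ <-]; last exact: evxD.
by rewrite /evx; case: pselect.
Qed.

Section SkyModule.
Variable b : bool.

(** The flag [b] selects the skyscraper or the zero sheaf, so that a complex concentrated in degree
    i has the uniform terms [sky (m == i)], with no case analysis on types. *)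
Record sky_sec (U : opens) := SkySec {
  sky_val : K;
  sky_valP : sky_val != 0 -> oset U x /\ b
}.

Lemma sky_eq U (s t : sky_sec U) : sky_val s = sky_val t -> s = t.
Proof.
case: s t => [s sP] [t tP] /= st; subst t.
by congr SkySec; apply: Prop_irrelevance.
Qed.

Lemma sky_val0 U (s : sky_sec U) : ~ (oset U x /\ b) -> sky_val s = 0.
Proof. by move=> nU; apply/eqP/negPn/negP => /(sky_valP (s:=s)). Qed.

Definition sky0 U : sky_sec U.
Proof. by exists 0; rewrite eqxx. Defined.

Definition skyD U (s t : sky_sec U) : sky_sec U.
Proof.
exists (sky_val s + sky_val t) => st.
apply: contrapT => nU; move: st.
by rewrite !sky_val0 // addr0 eqxx.
Defined.

Definition skyN U (s : sky_sec U) : sky_sec U.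
Proof. by exists (- sky_val s); rewrite oppr_eq0; apply: sky_valP. Defined.

Definition skyZ U (a : O U) (s : sky_sec U) : sky_sec U.
Proof.
exists (evx a * sky_val s); rewrite mulf_eq0 negb_or => /andP[_].
exact: sky_valP.
Defined.

HB.instance Definition _ U := gen_eqMixin (sky_sec U).
HB.instance Definition _ U := gen_choiceMixin (sky_sec U).

Lemma skyDA U : associative (@skyD U).
Proof. by move=> s t u; apply: sky_eq; apply: addrA. Qed.
Lemma skyDC U : commutative (@skyD U).
Proof. by move=> s t; apply: sky_eq; apply: addrC. Qed.
Lemma sky0D U : left_id (sky0 U) (@skyD U).
Proof. by move=> s; apply: sky_eq; apply: add0r. Qed.
Lemma skyND U : left_inverse (sky0 U) (@skyN U) (@skyD U).
Proof. by move=> s; apply: sky_eq; apply: addNr. Qed.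

HB.instance Definition _ U := GRing.isZmodule.Build (sky_sec U)
  (@skyDA U) (@skyDC U) (@sky0D U) (@skyND U).

Lemma skyZA U (a c : O U) (s : sky_sec U) : skyZ a (skyZ c s) = skyZ (a * c) s.
Proof. by apply: sky_eq => /=; rewrite evxM mulrA. Qed.
Lemma sky1Z U : left_id (1 : O U) (@skyZ U).
Proof.
move=> s; apply: sky_eq => /=.
have [[Ux _]|nU] := pselect (oset U x /\ b); first by rewrite evx1 // mul1r.
by rewrite (sky_val0 s nU) mulr0.
Qed.
Lemma skyZDr U : right_distributive (@skyZ U) +%R.
Proof. by move=> a s t; apply: sky_eq; apply: mulrDr. Qed.
Lemma skyZDl U (s : sky_sec U) : {morph (@skyZ U)^~ s : a c / a + c}.
Proof. by move=> a c; apply: sky_eq => /=; rewrite evxD; apply: mulrDl. Qed.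

HB.instance Definition _ U := GRing.Zmodule_isLmodule.Build (O U) (sky_sec U)
  (@skyZA U) (@sky1Z U) (@skyZDr U) (@skyZDl U).

Definition sky_res (U V : opens) (VU : V `<=` U) (s : sky_sec U) : sky_sec V.
Proof.
exists (if `[< oset V x >] then sky_val s else 0).
case: asboolP => [Vx /(sky_valP (s:=s))[_ ?]|]; last by rewrite eqxx.
by split.
Defined.

Lemma sky_res_in (U V : opens) (VU : V `<=` U) (s : sky_sec U) :
  oset V x -> sky_val (sky_res VU s) = sky_val s.
Proof. by move=> Vx /=; case: asboolP. Qed.

Lemma sky_res_out (U V : opens) (VU : V `<=` U) (s : sky_sec U) :
  ~ oset V x -> sky_val (sky_res VU s) = 0.
Proof. by move=> Vx /=; case: asboolP. Qed.

Definition sky_omodule : omodule Y.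
Proof.
refine (@OModule K n Y (fun U => sky_sec U : lmodType (O U)) sky_res _ _ _ _ _).
- move=> U V VU a s t; apply: sky_eq => /=.
  case: asboolP => [Vx|_]; first by rewrite evx_ores.
  by rewrite mulr0 addr0.
- move=> U UU s; apply: sky_eq => /=; case: asboolP => // nU.
  by rewrite sky_val0 // => -[].
- move=> U V W VU WV WU s; apply: sky_eq => /=.
  by case: asboolP => // Wx; case: asboolP => // -[]; apply: WV.
- move=> I U V VU cov s t st; apply: sky_eq.
  have [Ux|nU] := pselect (oset U x); last by rewrite !sky_val0 // => -[].
  have [i Vx] := cov x Ux.
  by rewrite -(sky_res_in (VU i) s Vx) -(sky_res_in (VU i) t Vx) st.
- move=> I U V VU cov s sc.
  have [Ux|nU] := pselect (oset U x); last first.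
    exists (sky0 U) => i; apply: sky_eq; rewrite sky_res_out; last by move/(VU i).
    by rewrite sky_val0 // => -[/(VU i)].
  have [i Vx] := cov x Ux.
  have tP : sky_val (s i) != 0 -> oset U x /\ b.
    by move/(sky_valP (s:=s i)) => [].
  exists (SkySec tP) => j; apply: sky_eq.
  have [Vj|nV] := pselect (oset (V j) x); last first.
    by rewrite sky_res_out // sky_val0 // => -[].
  rewrite sky_res_in //=.
  have Wi : opensI (V i) (V j) `<=` V i by apply: subIsetl.
  have Wj : opensI (V i) (V j) `<=` V j by apply: subIsetr.
  have Wx : oset (opensI (V i) (V j)) x by split.
  by rewrite -(sky_res_in Wi (s i) Wx) -(sky_res_in Wj (s j) Wx) (sc i j _ Wi Wj).
Defined.

Lemma sky_sum U (I : finType) (s : I -> sky_sec U) :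
  sky_val (\sum_i s i) = \sum_i sky_val (s i).
Proof. by elim/big_rec2: _ => //= i u v _ <-. Qed.

Lemma sky_finite_type : finite_type sky_omodule.
Proof.
have oneP : (if `[< Y x >] && b then 1 else 0 : K) != 0 -> oset (whole Y) x /\ b.
  by case: asboolP => [Yx|_]; case: (b); rewrite ?eqxx.
move=> z Yz; exists (whole Y), 1%N, (fun=> SkySec oneP); split=> //.
move=> W WV t y Wy; exists W, (@subset_refl _ W), WV, (fun=> oconst W (sky_val t)).
split=> //; rewrite big_ord1 res_id; apply: sky_eq => /=.
have [[Wx bt]|nW] := pselect (oset W x /\ b); last first.
  rewrite (sky_val0 t nW) [X in X * _](_ : _ = 0) ?mul0r //.
  have [Wx|nx] := pselect (oset W x); first by rewrite evx_const.
  exact: evx_out.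
rewrite evx_const //; case: asboolP => // _.
by rewrite bt andbT; case: asboolP => [_|[]]; [rewrite mulr1|apply: opens_sub Wx].
Qed.

(** Relations are the families a with sum of a_i(x) c_i = 0, a condition only over open sets
    containing x. Away from x, or if all c_i vanish, every family qualifies. At x, if c_i0 <> 0,
    generators are e_j - (c_j / c_i0) e_i0 together with the maximal ideal of x times e_i0. *)
Lemma sky_finite_relations U m (s : 'I_m -> sec sky_omodule U) :
  finite_relations s.
Proof.
move=> z Uz; pose c i : K := sky_val (s i).
have triv (V : opens) (VU : V `<=` U) : oset V z ->
    (forall i, oset V x -> c i = 0) ->
  exists (V : opens) (VU : V `<=` U) (k : nat) (r : 'I_k -> 'I_m -> O V),
    [/\ oset V z, forall j, relation_on s VU (r j) &
      forall (W : opens) (WV : W `<=` V) (WU : W `<=` U) (a : 'I_m -> O W),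
        relation_on s WU a -> forall y, oset W y ->
        exists (W' : opens) (W'W : W' `<=` W) (W'V : W' `<=` V)
               (b : 'I_k -> O W'),
          oset W' y /\
          forall i, ores W'W (a i) = \sum_j b j * ores W'V (r j i)].
  move=> Vz c0; exists V, VU, m, (fun j i => (i == j)%:R); split=> // [j|].
    rewrite /relation_on big1 // => i _; apply: sky_eq => /=.
    by case: asboolP => [Vx|_]; rewrite ?mulr0 // -/(c i) c0 // mulr0.
  move=> W WV WU a _ y Wy; exists W, (@subset_refl _ W), WV, a; split=> // i.
  rewrite ores_id (bigD1 i) //= eqxx ores1 mulr1 big1 ?addr0 // => j ji.
  by rewrite eq_sym (negPf ji) ores0 mulr0.
have [zx|zx] := pselect (z = x); last first.
  have cl : exists2 Z : set (PP K n), zariski_closed Z & Y `\` [set x] = Y `\` Z.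
    by exists [set x] => //; apply: closed_point.
  apply: (triv (opensI U (Opens cl)) (@subIsetl _ _ _)).
    by split=> //; split=> //; apply: opens_sub Uz.
  by move=> i [_ [_ /(_ erefl)]].
have [c0|/existsNP[i0 /eqP ci0]] := pselect (forall i, c i = 0).
  by apply: (triv U (@subset_refl _ U)).
have [j0 xj0] := hcoord_neq0 x.
have VU : opensI U (chart Y j0) `<=` U by apply: subIsetl.
have Vj : opensI U (chart Y j0) `<=` chart Y j0 by apply: subIsetr.
pose V := opensI U (chart Y j0).
pose r1 (j i : 'I_m) : O V := (i == j)%:R - oconst V (c j / c i0) * (i == i0)%:R.
pose r2 (q : 'I_n.+1) (i : 'I_m) : O V := lratio Vj (minor x j0 q) * (i == i0)%:R.
pose r (j : 'I_(m + n.+1)) (i : 'I_m) : O V :=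
  match fintype.split j with inl j => r1 j i | inr q => r2 q i end.
have rl j : r (lshift _ j) = r1 j.
  by apply/funext => i; rewrite /r -[lshift _ _]/(unsplit (inl _)) fintype.unsplitK.
have rr q : r (rshift _ q) = r2 q.
  by apply/funext => i; rewrite /r -[rshift _ _]/(unsplit (inr _)) fintype.unsplitK.
have evnat (W : opens) (k : bool) : oset W x -> evx (k%:R : O W) = k%:R.
  by case: k => Wx; rewrite ?evx1 //; rewrite /evx; case: pselect.
have evopp (W : opens) (f : O W) : evx (- f) = - evx f.
  by rewrite /evx; case: pselect => // _; rewrite oppr0.
have relP (W : opens) (WU : W `<=` U) (a : 'I_m -> O W) :
    relation_on s WU a <-> (oset W x -> \sum_i evx (a i) * c i = 0).
  split=> [e Wx|e].
    have := congr1 (fun t : sky_sec W => sky_val t) e; rewrite sky_sum => e'.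
    apply: etrans _ e'.
    by apply: eq_bigr => i _ /=; case: asboolP.
  apply: sky_eq; rewrite /= sky_sum.
  have [Wx|nW] := pselect (oset W x).
    rewrite -[RHS](e Wx); apply: eq_bigr => i _ /=; by case: asboolP.
  by rewrite big1 // => i _ /=; case: asboolP => // _; rewrite mulr0.
exists V, VU, (m + n.+1)%N, r; split.
- by split=> //; apply/chartP; rewrite zx; split=> //; rewrite -zx; apply: opens_sub Uz.
- move=> j; apply/relP => Vx; rewrite -[j]fintype.splitK; case: (fintype.split j) => [j'|q] /=.
    rewrite rl /r1; under eq_bigr do rewrite evxD evopp evxM evx_const // !evnat // mulrBl.
    rewrite big_split /= sumrN (bigD1 j') //= eqxx mul1r big1 => [|i /negPf->]; last first.
      by rewrite mul0r.
    rewrite (bigD1 i0) //= eqxx mulr1 divfK // big1 => [|i /negPf->]; last first.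
      by rewrite mulr0 mul0r.
    by rewrite !addr0 subrr.
  rewrite rr /r2 big1 // => i _.
  rewrite evxM (@evxE _ _ (exist _ x (mem_set Vx))) // lratioE /=.
  by rewrite -/(lin_val _ _) lin_val_minor_self !mul0r.
- move=> W WV WU a /relP aP y Wy.
  have Wj := subset_trans WV Vj.
  (* The remainder of a along e_i0 after subtracting the sum of a_j (e_j - (c_j / c_i0) e_i0). It
     vanishes at x, so the generators of the maximal ideal express it. *)
  pose h : O W := \sum_j a j * oconst W (c j / c i0).
  pose y' : W := exist _ y (mem_set Wy).
  have hx w : val w = x -> regfun h w = 0.
    move=> wx; rewrite -(evxE _ wx) evx_sum.
    have Wx : oset W x by rewrite -wx; apply: set_mem (valP w).
    under eq_bigr do rewrite evxM evx_const // mulrA.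
    by rewrite -mulr_suml aP // mul0r.
  have [W' [W'W [g [W'y hg]]]] := maximal_ideal_generated Wj y' xj0 hx.
  have W'V := subset_trans W'W WV.
  pose b' (j : 'I_(m + n.+1)) : O W' :=
    match fintype.split j with inl j => ores W'W (a j) | inr q => g q end.
  exists W', W'W, W'V, b'; split=> // i; rewrite big_split_ord /=.
  under eq_bigr => j _ do
    rewrite rl /b' -[lshift _ _]/(unsplit (inl _)) fintype.unsplitK /r1.
  under [X in _ + X]eq_bigr => q _ do
    rewrite rr /b' -[rshift _ _]/(unsplit (inr _)) fintype.unsplitK /r2.
  have oresN (f : O V) : ores W'V (- f) = - ores W'V f by apply: regfun_eq.
  have oresn (k : bool) : ores W'V (k%:R : O V) = k%:R.
    by case: k; rewrite ?ores1 // ores0.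
  have -> : \sum_q g q * ores W'V (lratio Vj (minor x j0 q) * (i == i0)%:R)
      = ores W'W h * (i == i0)%:R.
    rewrite hg mulr_suml; apply: eq_bigr => q _.
    by rewrite oresM oresn (ores_lratio _ _ (subset_trans W'W Wj)) mulrA.
  have -> : \sum_j ores W'W (a j) *
        ores W'V ((i == j)%:R - oconst V (c j / c i0) * (i == i0)%:R)
      = ores W'W (a i) - ores W'W h * (i == i0)%:R.
    under eq_bigr do
      rewrite oresD oresN oresM ores_const !oresn mulrBr mulrA.
    rewrite big_split /= (bigD1 i) //= eqxx mulr1 big1 ?addr0 => [|j ji]; last first.
      by rewrite eq_sym (negPf ji) mulr0.
    rewrite sumrN -mulr_suml; congr (_ - _ * _).
    apply: regfun_eq => w; rewrite regfun_ores !regfun_sum; apply: eq_bigr => j _.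
    by rewrite !regfunM !oconstE regfun_ores.
  by rewrite subrK.
Qed.

Definition sky : coherent_sheaf Y :=
  CoherentSheaf (conj sky_finite_type sky_finite_relations).

Lemma linear_mul_sky0 c U (s : sec sky U) :
  lin_val c x = 0 -> app (linear_mul sky c) s = 0.
Proof.
move=> cx; apply: tw_sec_eq => j; apply: sky_eq => /=.
case: asboolP => [Wx|_]; last by rewrite mulr0.
rewrite (@evxE _ _ (exist _ x (mem_set Wx))) // lratioE /=.
by rewrite -/(lin_val _ _) cx !mul0r.
Qed.

Lemma linear_mul_sky_val c U j (s : sec sky U) : oset (opensI U (chart Y j)) x ->
  sky_val (tw_fam (app (linear_mul sky c) s) j)
  = lin_val c x / hcoord x j * sky_val (s : sky_sec U).
Proof.
move=> Wx /=; case: asboolP => // _.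
by rewrite (@evxE _ _ (exist _ x (mem_set Wx))) // lratioE.
Qed.

Lemma linear_mul_sky_inj c U : lin_val c x != 0 ->
  injective (fun s : sec sky U => app (linear_mul sky c) s).
Proof.
move=> cx s t st; apply: sky_eq.
have [Ux|nU] := pselect (oset U x); last by rewrite !sky_val0 // => -[].
have [j jx] := chart_cover (opens_sub Ux).
have xj : hcoord x j != 0 by case/chartP: jx.
have := congr1 (fun u : tw_sec sky_omodule U => sky_val (tw_fam u j : sky_sec _)) st.
rewrite !linear_mul_sky_val //; apply: mulfI.
by rewrite mulf_neq0 ?invr_eq0.
Qed.

Lemma linear_mul_sky_surj c U (t : sec (twist sky) U) : lin_val c x != 0 ->
  exists s, app (linear_mul sky c) s = t.
Proof.
move=> cx.
have [Ux|nU] := pselect (oset U x); last first.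
  exists 0; apply: tw_sec_eq => j; apply: sky_eq.
  by rewrite !sky_val0 // => -[[/nU]].
have [j jx] := chart_cover (opens_sub Ux).
have xj : hcoord x j != 0 by case/chartP: jx.
(* Inverts the factor c(x) / x_j of the chart j; the compatibility of t between charts makes the
   same v correct in every chart k. *)
pose v := hcoord x j / lin_val c x * sky_val (tw_fam t j : sky_sec _).
have vP : v != 0 -> oset U x /\ b.
  by rewrite mulf_eq0 negb_or => /andP[_ /(sky_valP (s:=_))[[] ]].
exists (SkySec vP); apply: tw_sec_eq => k; apply: sky_eq.
have [kx|nk] := pselect (oset (opensI U (chart Y k)) x); last first.
  by rewrite !sky_val0 // => -[/nk].
rewrite linear_mul_sky_val //= /v.
have xk : hcoord x k != 0 by case: kx => _ /chartP[].
pose W := opensI (opensI U (chart Y j)) (opensI U (chart Y k)).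
have Wj : W `<=` opensI U (chart Y j) by apply: subIsetl.
have Wk : W `<=` opensI U (chart Y k) by apply: subIsetr.
have Wx : oset W x by [].
have /(congr1 (fun u : sky_sec W => sky_val u)) := tw_famP t Wj Wk.
rewrite [LHS](sky_res_in Wk) //= => ->; case: asboolP => // _.
rewrite (@evxE _ _ (exist _ x (mem_set Wx))) // ratioE /=.
by field; rewrite ?cx ?xk ?xj.
Qed.

End SkyModule.

Section SkyComplex.
Variable i : int.

Lemma sky_cdd (m : int) : ohom_comp (0 : omorphism (sky (m + 1 == i)) (sky (m + 1 + 1 == i)))
  (0 : omorphism (sky (m == i)) (sky (m + 1 == i))) = 0.
Proof. by apply: omorphism_eq => U s. Qed.

Lemma sky_cbounded : exists N : int, forall m : int, N < `|m| ->
  ohom_id (sky (m == i)) = 0.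
Proof.
exists `|i| => m im; have mi : (m == i) = false.
  by apply/eqP => e; move: im; rewrite e ltxx.
apply: omorphism_eq => U s; apply: sky_eq => /=.
by rewrite sky_val0 // mi => -[].
Qed.

Definition sky_complex : Chb (Coh Y) :=
  @Complex (Coh Y) (fun m => sky (m == i)) (fun m => 0) sky_cdd sky_cbounded.

End SkyComplex.
End Skyscraper.

(** * Isolated points *)

Section IsolatedPoint.
Variables (K : closedFieldType) (n : nat) (Y : set (PP K n)).
Local Notation opens := (opens Y).
Local Notation O := (@structure_sheaf K n Y).
Variables (x : PP K n) (P : opens).
Hypothesis PE : oset P = [set x].

Let Px : oset P x. Proof. by rewrite PE. Qed.

Let P_sub (U : opens) : oset U x -> P `<=` U.
Proof. by move=> Ux y; rewrite PE => ->. Qed.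

(** Locality for the empty cover. *)
Lemma sec_empty (F : omodule Y) (W : opens) (s t : sec F W) :
  (forall y, ~ oset W y) -> s = t.
Proof.
move=> W0; apply: (@sheaf_locality _ _ _ F False W (fun i => match i with end)
  (fun i => match i with end)) => [y /W0|] //.
Qed.

Let off_subproof : exists2 Z, zariski_closed Z & Y `\` [set x] = Y `\` Z.
Proof. by exists [set x] => //; apply: closed_point. Qed.

Let off : opens := Opens off_subproof.

Lemma sec_isolated_eq (F : omodule Y) (U : opens) (s t : sec F U) :
  (forall (W : opens) (WU : W `<=` U), W `<=` P -> oset W x -> res WU s = res WU t) ->
  (forall (W : opens) (WU : W `<=` U), ~ oset W x -> res WU s = res WU t) -> s = t.
Proof.
move=> on_ off_.
apply: (@sheaf_locality _ _ _ F bool U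
  (fun i => opensI U (if i then P else off)) (fun i => @subIsetl _ _ _)).
  move=> y Uy; have [yx|yx] := pselect (y = x).
    by exists true; split=> //; rewrite yx.
  by exists false; split=> //; split=> //; apply: opens_sub Uy.
move=> i; have [xi|xi] := pselect (oset (opensI U (if i then P else off)) x).
  apply: on_ => //; case: i xi => [_|[_ [_ /(_ erefl)]]//].
  exact: subIsetr.
exact: off_.
Qed.

(** The open sets {x} and Y minus x are disjoint, so z on the first and 0 on the second glue. *)
Lemma extension_by_zero (F : omodule Y) (U : opens) (z : sec F P) :
  exists t : sec F U,
    (forall (W : opens) (WU : W `<=` U) (WP : W `<=` P), res WU t = res WP z) /\
    (forall (W : opens) (WU : W `<=` U), ~ oset W x -> res WU t = 0).
Proof.
pose V (i : bool) := opensI U (if i then P else off).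
have VP : V true `<=` P by apply: subIsetr.
have VU i : V i `<=` U by apply: subIsetl.
pose s (i : bool) : sec F (V i) :=
  match i return sec F (V i) with true => res VP z | false => 0 end.
have [|i j W Wi Wj|t tE] := @sheaf_gluing _ _ _ F bool U V VU _ s.
- move=> y Uy; have [yx|yx] := pselect (y = x).
    by exists true; split=> //; rewrite yx.
  by exists false; split=> //; split=> //; apply: opens_sub Uy.
- have abs : W `<=` V true -> W `<=` V false -> forall y, ~ oset W y.
    move=> Wt Wf y Wy; have [_] := Wt y Wy; rewrite /= PE => yx.
    by have [_ [_ ]] := Wf y Wy.
  case: i j Wi Wj => [] [] Wi Wj /=.
  + exact: res_irr.
  + by apply: sec_empty; apply: abs.
  + by apply: sec_empty; apply: abs.
  + exact: res_irr.
have off0 (W : opens) (WU : W `<=` U) : ~ oset W x -> res WU t = 0.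
  move=> Wx; have WV : W `<=` V false.
    move=> y Wy; split; [exact: WU|split; first exact: opens_sub Wy].
    by move=> yx; apply: Wx; rewrite -[x]yx.
  by rewrite -(res_res (VU false) WV) (tE false) res0.
exists t; split=> // W WU WP.
have [Wx|Wx] := pselect (oset W x); last first.
  by apply: sec_empty => y Wy; apply: Wx; have := WP y Wy; rewrite PE => <-.
have WV : W `<=` V true by move=> y Wy; split; [apply: WU|apply: WP].
by rewrite -(res_res (VU true) WV) (tE true) (res_res _ _ WP).
Qed.

(** Over the one-point open set the ring of regular functions is K, which turns sections over [P]
    into vectors. *)
Lemma isolated_constant (W : opens) (a : O W) : W `<=` P -> oset W x ->
  a = oconst W (evx x a).
Proof.
move=> WP Wx; apply: regfun_eq => y; rewrite oconstE.
by rewrite (@evxE _ _ _ _ _ _ y) //; have := WP _ (set_mem (valP y)); rewrite PE.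
Qed.

Section SkyIn.
Variables (F : omodule Y) (z : sec F P) (b : bool).

Definition sky_ext U (c : K) : sec F U :=
  sval (cid (extension_by_zero U (oconst P c *: z))).

Lemma sky_ext_on (U : opens) c (W : opens) (WU : W `<=` U) (WP : W `<=` P) :
  res WU (sky_ext U c) = oconst W c *: res WP z.
Proof.
rewrite /sky_ext; case: cid => t [/= -> _]; rewrite resZ; congr (_ *: _).
exact: ores_const.
Qed.

Lemma sky_ext_off (U : opens) c (W : opens) (WU : W `<=` U) : ~ oset W x ->
  res WU (sky_ext U c) = 0.
Proof. by rewrite /sky_ext; case: cid => t [/= _]; apply. Qed.

(** The morphism from the skyscraper that sends 1 to z. *)
Definition sky_in : omorphism (sky Y x b) F.
Proof.
refine (@OMorphism K n Y (sky Y x b) F (fun U s => sky_ext U (sky_val s)) _ _).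
- move=> U a s t; apply: sec_isolated_eq => W WU; last first.
    by move=> Wx; rewrite resD resZ !sky_ext_off // scaler0 addr0.
  move=> WP Wx; rewrite resD resZ !(sky_ext_on _ _ WP) /=.
  rewrite (isolated_constant (ores WU a) WP Wx) evx_ores // scalerA -scalerDl.
  congr (_ *: _); apply: regfun_eq => y.
  by rewrite regfunD regfunM !oconstE.
- move=> U V VU s; apply: sec_isolated_eq => W WV; last first.
    move=> Wx; rewrite (res_res _ _ (subset_trans WV VU)) !sky_ext_off //.
  move=> WP Wx; rewrite (res_res _ _ (subset_trans WV VU)) !(sky_ext_on _ _ WP).
  by rewrite (sky_res_in VU s) //; apply: WV.
Defined.

End SkyIn.

Lemma sky_in_comp0 (F G : omodule Y) (f : omorphism F G) z b :
  app f z = 0 -> ohom_comp f (sky_in z b) = 0.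
Proof.
move=> fz; apply: omorphism_eq => U s; apply: sec_isolated_eq => W WU.
  move=> WP Wx; rewrite /= -app_res (sky_ext_on _ _ _ WP) appZ app_res fz.
  by rewrite !res0 scaler0.
by move=> Wx; rewrite /= -app_res sky_ext_off // app0 res0.
Qed.

Section SkyOut.
Variables (F : omodule Y) (lam : sec F P -> K) (b : bool).
Hypothesis lam_linear : forall a s t,
  lam (oconst P a *: s + t) = a * lam s + lam t.

Definition sky_out_val (U : opens) (s : sec F U) : K :=
  match pselect (oset U x) with
  | left Ux => if b then lam (res (P_sub Ux) s) else 0
  | right _ => 0
  end.

Lemma sky_out_valE (U : opens) (s : sec F U) (PU : P `<=` U) :
  sky_out_val s = if b then lam (res PU s) else 0.
Proof.
rewrite /sky_out_val; case: pselect => [Ux|nU].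
  by rewrite (res_irr _ PU).
by case: nU; apply: PU.
Qed.

Lemma sky_out_val0 (U : opens) (s : sec F U) : ~ oset U x -> sky_out_val s = 0.
Proof. by rewrite /sky_out_val; case: pselect. Qed.

(** The morphism to the skyscraper induced by the functional [lam] on sections over {x}. *)
Definition sky_out : omorphism F (sky Y x b).
Proof.
unshelve refine (@OMorphism K n Y F (sky Y x b)
  (fun U s => @SkySec _ _ _ x b U (sky_out_val s) _) _ _).
- rewrite /sky_out_val; case: pselect => [Ux|nU]; last by rewrite eqxx.
  by case: (b) => //; rewrite eqxx.
- move=> U a s t; apply: sky_eq => /=.
  have [Ux|nU] := pselect (oset U x); last by rewrite !sky_out_val0 // mulr0 addr0.
  rewrite !(sky_out_valE _ (P_sub Ux)); case: (b); last by rewrite mulr0 addr0.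
  rewrite res_linear (isolated_constant (ores (P_sub Ux) a) (@subset_refl _ P)) //.
  by rewrite lam_linear evx_ores.
- move=> U V VU s; apply: sky_eq => /=.
  case: asboolP => [Vx|nV]; last by rewrite sky_out_val0.
  rewrite (sky_out_valE _ (P_sub Vx)) (sky_out_valE _ (P_sub (VU _ Vx))).
  by rewrite (res_res _ _ (P_sub (VU _ Vx))).
Defined.

Lemma sky_out_in z : lam z = 1 -> b -> ohom_comp sky_out (sky_in z b) = ohom_id _.
Proof.
move=> lz bt; have if1 (u v : K) : (if b then u else v) = u by rewrite bt.
apply: omorphism_eq => U s; apply: sky_eq => /=.
have [Ux|nU] := pselect (oset U x); last first.
  by rewrite sky_out_val0 // sky_val0 // => -[].
rewrite (sky_out_valE _ (P_sub Ux)) if1 (sky_ext_on _ _ _ (@subset_refl _ P)) res_id.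
have := lam_linear (sky_val s) z 0; rewrite addr0 => ->.
have := lam_linear (-1) 0 0; rewrite scaler0 addr0 mulN1r addNr => ->.
by rewrite addr0 lz mulr1.
Qed.

End SkyOut.

Lemma sky_out_comp0 (F G : omodule Y) (f : omorphism F G) lam b
    (ll : forall a s t, lam (oconst P a *: s + t) = a * lam s + lam t) :
  (forall u, lam (app f u) = 0) -> ohom_comp (@sky_out G lam b ll) f = 0.
Proof.
move=> lf; apply: omorphism_eq => U s; apply: sky_eq => /=.
have [Ux|nU] := pselect (oset U x); last by rewrite sky_out_val0.
by rewrite (sky_out_valE _ _ _ (P_sub Ux)) -app_res lf if_same.
Qed.

Lemma finite_type_span (F : omodule Y) : finite_type F ->
  exists (k : nat) (t : 'I_k -> sec F P), forall v : sec F P,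
    exists a : 'I_k -> K, v = \sum_i oconst P (a i) *: t i.
Proof.
move=> /(_ x (opens_sub Px)) [V [k [s [Vx gs]]]].
have PV := P_sub Vx; exists k, (fun i => res PV (s i)) => v.
have [W [WP [WV [a [Wx va]]]]] := gs P PV v x Px.
have PW := P_sub Wx; exists (fun i => evx x (ores PW (a i))).
rewrite -[v](res_id (@subset_refl _ P)) -(res_res WP PW) va res_sum.
apply: eq_bigr => i _; rewrite resZ (res_res _ _ PV); congr (_ *: _).
exact: isolated_constant.
Qed.

Section Functional.
Variables (F G : omodule Y) (f : omorphism F G) (z : sec G P).
Hypotheses (ftG : finite_type G) (nz : forall u, z <> app f u).

(** A hyperplane that contains the image of f and misses z is built as image plus span of the t_i
    with i in J, for J maximal among the subsets that keep z out; finitely many t_i suffice since G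
    is of finite type. Then [lam v] is the coefficient of z in v modulo the hyperplane. *)
Lemma separating_functional : exists lam : sec G P -> K,
  [/\ forall a s t, lam (oconst P a *: s + t) = a * lam s + lam t,
      forall u, lam (app f u) = 0 & lam z = 1].
Proof.
have [k [t tP]] := finite_type_span ftG.
have oc0 : oconst P 0 = 0 by apply: regfun_eq => y; rewrite oconstE.
have oc1 : oconst P 1 = 1 by apply: regfun_eq => y; rewrite oconstE.
have ocM a c : oconst P (a * c) = oconst P a * oconst P c.
  by apply: regfun_eq => y; rewrite regfunM !oconstE.
have ocN a : oconst P (- a) = - oconst P a.
  by apply: regfun_eq => y; rewrite regfunN !oconstE.
have ocD a c : oconst P (a + c) = oconst P a + oconst P c.
  by apply: regfun_eq => y; rewrite regfunD !oconstE.
pose H (J : {set 'I_k}) (v : sec G P) := exists u (a : 'I_k -> K),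
  (forall i, i \notin J -> a i = 0) /\ v = app f u + \sum_i oconst P (a i) *: t i.
have Hlin J a v w : H J v -> H J w -> H J (oconst P a *: v + w).
  move=> [u [c [c0 ->]]] [u' [c' [c'0 ->]]].
  exists (oconst P a *: u + u'), (fun i => a * c i + c' i); split.
    by move=> i iJ; rewrite c0 // c'0 // mulr0 addr0.
  rewrite app_linear scalerDr -!addrA; congr (_ + _).
  rewrite addrCA; congr (_ + _); rewrite scaler_sumr -big_split.
  by apply: eq_bigr => i _; rewrite [LHS]/= scalerA -scalerDl -ocM -ocD.
have H0 J : H J 0.
  exists 0, (fun=> 0); split=> //; rewrite app0 big1 ?addr0 // => i _.
  by rewrite oc0 scale0r.
have HZ J a v : H J v -> H J (oconst P a *: v).
  by move=> Hv; rewrite -[_ *: _]addr0; apply: Hlin.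
have nH0 : `[< ~ H finset.set0 z >].
  apply/asboolP => -[u [a [a0 zE]]]; apply: (nz (u:=u)).
  rewrite zE big1 ?addr0 // => i _.
  by rewrite a0 ?inE // oc0 scale0r.
have [J /maxsetP[/asboolP nJ maxJ] _] := maxset_exists (P:=fun J => `[< ~ H J z >]) nH0.
have Ht i : exists c, H J (t i - oconst P c *: z).
  have [iJ|iJ] := boolP (i \in J).
    exists 0; rewrite oc0 scale0r subr0.
    exists 0, (fun j => (j == i)%:R); split.
      by move=> j jJ; have [e|//] := eqVneq j i; move: jJ; rewrite e iJ.
    rewrite app0 add0r (bigD1 i) //= eqxx oc1 scale1r big1 ?addr0 // => j /negPf->.
    by rewrite oc0 scale0r.
  (* By maximality, adjoining t_i captures z. Its coefficient a_i is nonzero, as otherwise z would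
     already be captured by J, so t_i is a multiple of z modulo H J. *)
  have [Hz|nHz] := pselect (H (i |: J) z); last first.
    have := maxJ (i |: J); rewrite finset.subsetU1 => /(_ _ isT) e.
    by move: iJ; rewrite -e ?finset.setU11 //; apply/asboolP.
  have [u [a [a0 zE]]] := Hz.
  have Hr : H J (z - oconst P (a i) *: t i).
    exists u, (fun j => if j == i then 0 else a j); split.
      by move=> j jJ; case: eqVneq => // ji; apply: a0; rewrite !inE negb_or ji.
    rewrite zE -addrA; congr (_ + _).
    rewrite (bigD1 i) //= [in RHS](bigD1 i) //= eqxx oc0 scale0r add0r.
    rewrite addrAC subrr add0r; apply: eq_bigr => j /negPf-> //.
  have ai : a i != 0.
    by apply/eqP => ai; apply: nJ; move: Hr; rewrite ai oc0 scale0r subr0.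
  exists (a i)^-1.
  have -> : t i - oconst P (a i)^-1 *: z
      = oconst P (- (a i)^-1) *: (z - oconst P (a i) *: t i).
    rewrite scalerBr scalerA -ocM mulNr mulVf //.
    rewrite !ocN oc1.
    by rewrite scaleN1r opprK scaleNr addrC.
  exact: HZ.
have Hv v : exists c, H J (v - oconst P c *: z).
  have [a ->] := tP v; have [c cP] := choice Ht.
  exists (\sum_i a i * c i).
  suff : H J (\sum_i oconst P (a i) *: (t i - oconst P (c i) *: z)).
    congr (H J _); under eq_bigr do rewrite scalerBr scalerA -ocM.
    rewrite big_split /= sumrN -scaler_suml; congr (_ - _ *: _).
    by apply: regfun_eq => y; rewrite regfun_sum oconstE; apply: eq_bigr => i _; rewrite oconstE.
  elim/big_ind: _ => [|v1 v2 H1 H2|i _]; first exact: H0.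
    by have := Hlin J 1 _ _ H1 H2; rewrite oc1 scale1r.
  exact: HZ.
have [lam lamP] := choice Hv.
have uniq v c : H J (v - oconst P c *: z) -> lam v = c.
  move=> Hc; apply: contrapT => /eqP lc; apply: nJ.
  have d0 : c - lam v != 0 by rewrite subr_eq0 eq_sym.
  have Hd : H J (oconst P (c - lam v) *: z).
    have := Hlin J (-1) _ _ Hc (lamP v).
    congr (H J _); rewrite scalerBr scalerA -ocM mulN1r ocD !ocN oc1 scaleN1r.
    by rewrite scaleNr opprK addrACA addNr add0r scalerBl.
  have := HZ J (c - lam v)^-1 _ Hd.
  by rewrite scalerA -ocM mulVf // oc1 scale1r.
exists lam; split.
- move=> a s u; apply: uniq.
  have := Hlin J a _ _ (lamP s) (lamP u); congr (H J _).
  rewrite scalerBr scalerA -ocM addrACA -opprD -scalerDl -ocD //.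
- move=> u; apply: uniq; rewrite oc0 scale0r subr0.
  exists u, (fun=> 0); split=> //; rewrite big1 ?addr0 // => i _.
  by rewrite oc0 scale0r.
- by apply: uniq; rewrite oc1 scale1r subrr.
Qed.

End Functional.
End IsolatedPoint.

(** * Comparison of the two categories *)

Section SkyComplexes.
Variables (K : closedFieldType) (n : nat) (Y : set (PP K n)).
Local Notation opens := (opens Y).
Local Notation O := (@structure_sheaf K n Y).
Local Notation D := (DbCoh Y).

(** The cohomology sheaf in degree m + 1 has a nonzero stalk at x. The index m is the degree of the
    sections whose differentials are the coboundaries. *)
Definition nonexact_at (X : Chb (Coh Y)) (m : int) (x : PP K n) : Prop :=
  exists (V : opens) (s : sec (cob X (m + 1)) V),
    [/\ oset V x, app (cd X (m + 1)) s = 0 & ~ coboundary_at x s].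

Lemma nonexact_at_sh (X : Chb (Coh Y)) m x :
  nonexact_at X (m + 1) x -> nonexact_at (csh X) m x.
Proof.
move=> [V [s [Vx ds ns]]]; exists V, s; split=> //.
  by rewrite /= ds oppr0.
move=> [W [WV [u [Wx e]]]]; apply: ns; exists W, WV, (- u); split=> //.
by rewrite app_opp; apply: e.
Qed.

Lemma nonexact_at_iter_sh (X : Chb (Coh Y)) m k x :
  nonexact_at X (m + k%:Z) x -> nonexact_at (iter k (@csh _) X) m x.
Proof.
elim: k m X => [|k IH] m X; first by rewrite addr0.
move=> Xk; rewrite iterSr; apply: IH; apply: nonexact_at_sh.
by rewrite -addrA; have -> : k%:Z + 1 = k.+1%:Z by lia.
Qed.

Lemma nonexact_of_nontrivial (X : D) : ~ hom_trivial X X ->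
  exists m x, nonexact_at X m x.
Proof.
move=> nX; apply: contrapT => nE; apply: nX; apply: exact_hom_trivial.
move=> m V s ds x Vx; apply: contrapT => ns; apply: nE.
by exists m, x, V, s.
Qed.

Lemma sky_complex_nontrivial x m : Y x ->
  ~ hom_trivial (C:=D) (sky_complex Y x (m + 1)) (sky_complex Y x (m + 1)).
Proof.
move=> Yx.
have oP : (1 : K) != 0 -> oset (whole Y) x /\ (m + 1 == m + 1) by rewrite eqxx.
apply: (@nonexact_hom_nontrivial _ _ _ (sky_complex Y x (m + 1)) m (whole Y)
  (SkySec oP) x) => // -[W [WV [u [Wx e]]]].
have := congr1 (fun t : sky_sec x (m + 1 == m + 1) W => sky_val t) e.
by rewrite [LHS]/=; case: asboolP => // _ /eqP; rewrite oner_eq0.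
Qed.

(** Orthogonality depends only on the terms of the complexes. This property is visibly stable under
    shift, so shifts of [sky_complex] need not be identified with other ones. *)
Definition sky_components (x : PP K n) (X : Chb (Coh Y)) : Prop :=
  forall m, exists b, cob X m = sky Y x b.

Lemma sky_components_iter_sh x (X : Chb (Coh Y)) k :
  sky_components x X -> sky_components x (iter k (@csh _) X).
Proof. by move=> Xx; elim: k => //= k IH m; apply: IH. Qed.

Lemma sky_orthogonal x y i j : x <> y ->
  orthogonal (C:=D) (sky_complex Y x i) (sky_complex Y y j).
Proof.
move=> xy p q.
have skyC z k : sky_components z (sky_complex Y z k) by move=> m; exists (m == k).
have := sky_components_iter_sh p (skyC x i).
have := sky_components_iter_sh q (skyC y j).
rewrite -[iter p _ _]/(iter p (@csh _) (sky_complex Y x i)).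
rewrite -[iter q _ _]/(iter q (@csh _) (sky_complex Y y j)).
move: (iter _ _ _) (iter _ _ _) => X' X Xy X'x.
have [c [cx cy]] := separating_form xy.
apply: (@hom_trivial_linear _ _ _ c) => m.
- by have [b ->] := X'x m => U s; apply: linear_mul_sky0.
- by have [b ->] := Xy m => U; apply: linear_mul_sky_inj.
- by have [b ->] := Xy m => U t; apply: linear_mul_sky_surj.
Qed.

Section Retract.
Variables (x : PP K n) (P : opens).
Hypothesis PE : oset P = [set x].

Section Casts.
Variables (X : Chb (Coh Y)) (m0 : int).

(** Vector z in degree m0 and 0 elsewhere: together with the dual [cast_fun], it lets data in one
    degree define maps in all degrees. *)
Definition cast_sec (z : sec (cob X m0) P) (m : int) : sec (cob X m) P :=
  match m0 =P m with
  | ReflectT e => eq_rect m0 (fun k => sec (cob X k) P : Type) z m e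
  | ReflectF _ => 0
  end.

Definition cast_fun (lam : sec (cob X m0) P -> K) (m : int)
    (v : sec (cob X m) P) : K :=
  match m =P m0 with
  | ReflectT e => lam (eq_rect m (fun k => sec (cob X k) P : Type) v m0 e)
  | ReflectF _ => 0
  end.

Lemma cast_secE z : cast_sec z m0 = z.
Proof. by rewrite /cast_sec; case: eqP => // e; rewrite eq_axiomK. Qed.

Lemma cast_sec_neq z m : m0 <> m -> cast_sec z m = 0.
Proof. by rewrite /cast_sec; case: eqP. Qed.

Lemma cast_funE lam v : cast_fun lam (m:=m0) v = lam v.
Proof. by rewrite /cast_fun; case: eqP => // e; rewrite eq_axiomK. Qed.

Lemma cast_fun_neq lam m v : m <> m0 -> cast_fun lam (m:=m) v = 0.
Proof. by rewrite /cast_fun; case: eqP. Qed.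

End Casts.

(** The cocycle z gives a chain map from the skyscraper since d z = 0. A functional that vanishes on
    coboundaries gives a chain map back, and its value 1 at z makes the composite the identity. *)
Lemma sky_retract (X : Chb (Coh Y)) m : nonexact_at X m x ->
  exists (a : hom (sky_complex Y x (m + 1)) X) (b : hom X (sky_complex Y x (m + 1))),
    heq (comp b a) (idm (sky_complex Y x (m + 1))).
Proof.
move=> [V [s [Vx ds ns]]].
have PV : P `<=` V by move=> y; rewrite PE => ->.
pose z := res PV s.
have dz : app (cd X (m + 1)) z = 0 by rewrite app_res ds res0.
have nz u : z <> app (cd X m) u.
  by move=> zu; apply: ns; exists P, PV, u; rewrite PE.
have [ft _] := csheafP (cob X (m + 1)).
have [lam [ll ld lz]] := separating_functional PE ft nz.
pose zc k := cast_sec z k.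
have dzc k : app (cd X k) (zc k) = 0.
  have [e|ne] := pselect (m + 1 = k); last by rewrite /zc cast_sec_neq // app0.
  by subst k; rewrite /zc cast_secE.
pose lc k : sec (cob X k) P -> K := cast_fun lam (m:=k).
have lcl k a u v : lc k (oconst P a *: u + v) = a * lc k u + lc k v.
  have [e|ne] := pselect (k = m + 1); last by rewrite /lc !cast_fun_neq // mulr0 addr0.
  by subst k; rewrite /lc !cast_funE.
have lcd k u : lc (k + 1) (app (cd X k) u) = 0.
  have [e|ne] := pselect (k = m); last by rewrite /lc cast_fun_neq // => /addIr.
  by subst k; rewrite /lc cast_funE.
have aP k : ohom_comp (sky_in PE (zc (k + 1)) (k + 1 == m + 1)) 0
    = ohom_comp (cd X k) (sky_in PE (zc k) (k == m + 1)).
  rewrite sky_in_comp0 //; apply: omorphism_eq => U t /=.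
  exact: (app0 (sky_in PE (zc (k + 1)) (k + 1 == m + 1))).
have bP k : ohom_comp (sky_out PE (k + 1 == m + 1) (lcl (k + 1))) (cd X k)
    = ohom_comp 0 (sky_out PE (k == m + 1) (lcl k)).
  by rewrite sky_out_comp0 //; apply: omorphism_eq.
exists (@ChainMap (Coh Y) (sky_complex Y x (m + 1)) X _ aP).
exists (@ChainMap (Coh Y) X (sky_complex Y x (m + 1)) _ bP) => k /=.
have [e|ne] := pselect (k = m + 1); last first.
  apply: omorphism_eq => U t; apply: sky_eq.
  by transitivity (0 : K); [|apply: esym]; apply: sky_val0 => -[_ /eqP].
apply: sky_out_in; last by rewrite e.
by subst k; rewrite /lc /zc cast_funE cast_secE.
Qed.

End Retract.

(** The complement of x in Y is empty or a single point, hence closed. *)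
Lemma isolated_of_few x : Y x ->
  ~ (exists y z, [/\ Y y, Y z, x <> y, x <> z & y <> z]) ->
  exists P : opens, oset P = [set x].
Proof.
move=> Yx few.
have [[y [Yy xy]]|ny] := pselect (exists y, Y y /\ x <> y).
  have cl : exists2 Z : set (PP K n), zariski_closed Z & [set x] = Y `\` Z.
    exists [set y]; first exact: closed_point.
    apply/seteqP; split=> [_ ->|z [Yz zy]] //=.
    apply: contrapT => zx; apply: few; exists y, z.
    by split=> //; [move=> e; apply: zx|move=> e; apply: zy].
  by exists (Opens cl).
exists (whole Y); apply/seteqP; split=> [z Yz|_ ->] //=.
by apply: contrapT => zx; apply: ny; exists z; split=> // e; apply: zx.
Qed.

End SkyComplexes.

(** * Contradiction from an exact equivalence *)

Section Main.
Variables (K : closedFieldType) (n : nat) (Y : set (PP K n)).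
Variable F : exact_equivalence (DbCoh Y) (FS K).

Lemma at_most_two_points x y z : Y x -> Y y -> Y z -> x <> y -> x <> z -> y <> z -> False.
Proof.
move=> Yx Yy Yz xy xz yz.
pose pt (a : 'I_3) := nth x [:: x; y; z] a.
have ptY a : Y (pt a) by case: a => [[|[|[|//]]] ?].
have pt_inj a b : a != b -> pt a <> pt b.
  case: a b => [[|[|[|//]]] ?] [[|[|[|//]]] ?] //= _; rewrite /pt /=;
    by [|apply/nesym].
(* The degree is written [0 + 1] to have the form m + 1 of [sky_complex_nontrivial]. *)
apply: (@no_three_orthogonal K (fun a => fob F (sky_complex Y (pt a) (0 + 1)))).
- move=> a /fob_hom_trivial; exact: sky_complex_nontrivial.
- by move=> a b /pt_inj ab; apply: fob_orthogonal; apply: sky_orthogonal.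
Qed.

(** The skyscraper is a direct summand of X, so its image is a nonzero summand of the thimble, which
    has no proper ones. *)
Lemma sky_thimble (X : DbCoh Y) L s x m :
  isomorphic (fob F X) (thimble K L s : FS K) -> Y x -> nonexact_at X m x ->
  isomorphic (fob F (sky_complex Y x (m + 1))) (thimble K L s : FS K).
Proof.
move=> [i [i' [i'i _]]] Yx Xm.
have [|P PE] := @isolated_of_few _ _ Y x Yx.
  by move=> [y [z [Yy Yz xy xz yz]]]; apply: at_most_two_points xy xz yz.
have [a [b ba]] := sky_retract PE Xm.
pose A : hom (sky_complex Y x (m + 1) : DbCoh Y) X := zz_of _ a.
pose B : hom X (sky_complex Y x (m + 1) : DbCoh Y) := zz_of _ b.
have BA : heq (comp B A) (idm _).
  apply: zz_trans (zz_ofM _ _) _.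
  apply: zz_trans (zz_of_eq ba) _.
  exact: zz_fwd_id.
apply: (@retract_thimble K L s _ (comp i (fmap F A)) (comp (fmap F B) i')).
  apply: heq_trans (comp_cancel_mid _ _ i'i) _.
  apply: heq_trans (heq_sym (fmap_comp _ _ _)) _.
  exact: heq_trans (fmap_heq F BA) (fmap_id _ _).
by move/fob_hom_trivial; apply: sky_complex_nontrivial.
Qed.

Lemma thimble_support L : exists (X : DbCoh Y) x m,
  [/\ isomorphic (fob F X) (thimble K L 0 : FS K), Y x & nonexact_at X m x].
Proof.
have [X [i ii]] := fob_ess_surj F (thimble K L 0).
have Xi : isomorphic (fob F X) (thimble K L 0 : FS K) by exists i.
have [|m [x Xx]] := @nonexact_of_nontrivial _ _ Y X.
  move/(fob_hom_trivial F)/(hom_trivial_iso Xi Xi); exact: hom_nontrivial_thimble.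
exists X, x, m; split=> //.
by have [V [s [Vx _ _]]] := Xx; apply: opens_sub Vx.
Qed.

(** Lets cohomology in degree m + k + 1 be represented by the skyscraper in degree m + 1, so that
    two objects can be compared through one skyscraper. *)
Lemma sky_thimble_shift (X : DbCoh Y) L x m k :
  isomorphic (fob F X) (thimble K L 0 : FS K) -> Y x ->
  nonexact_at X (m + k%:Z) x ->
  isomorphic (fob F (sky_complex Y x (m + 1))) (thimble K L k : FS K).
Proof.
move=> Xi Yx Xm; apply: (sky_thimble (X:=iter k (@sh (DbCoh Y)) X)) => //.
  apply: isomorphic_trans (fob_iter_sh F k X) _.
  by have := iter_sh_isomorphic k Xi; rewrite iter_sh_thimble add0r.
exact: nonexact_at_iter_sh.
Qed.

Lemma no_equivalence : False.
Proof.
have [X0 [x0 [m0 [i0 Y0 n0]]]] := thimble_support L0.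
have [X1 [x1 [m1 [i1 Y1 n1]]]] := thimble_support L1.
have [e|x01] := pselect (x0 = x1); last first.
  apply: (@hom_nontrivial_thimble01 K).
  apply: hom_trivial_iso (sky_thimble i0 Y0 n0) (sky_thimble i1 Y1 n1) _.
  have o := @sky_orthogonal _ _ Y x0 x1 (m0 + 1) (m1 + 1) x01.
  exact: (@fob_orthogonal _ _ F _ _ o 0%N 0%N).
subst x1.
have clash s t : isomorphic (thimble K L0 s : FS K) (thimble K L1 t : FS K) -> False.
  move=> st; apply: (@hom_nontrivial_thimble K L1 t).
  apply: hom_trivial_iso (isomorphic_refl _) st _.
  exact: hom_trivial_thimble10.
(* The object with cohomology in the higher degree is shifted down to the degree of the other; one
   skyscraper then corresponds to shifts of both L0 and L1. *)
have [m01|/ltW m10] := leP m1 m0.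
  have [k mk] : exists k : nat, m0 = m1 + k%:Z.
    by exists `|m0 - m1|%N; lia.
  rewrite mk in n0.
  apply: clash (isomorphic_trans (isomorphic_sym (sky_thimble_shift i0 Y0 n0)) _).
  exact: sky_thimble i1 Y1 n1.
have [k mk] : exists k : nat, m1 = m0 + k%:Z.
  by exists `|m1 - m0|%N; lia.
rewrite mk in n1.
apply: clash (isomorphic_trans (isomorphic_sym (sky_thimble i0 Y0 n0)) _).
exact: sky_thimble_shift i1 Y1 n1.
Qed.

End Main.

Theorem theorem4p1 (R : realType) :
  ~ exists (n : nat) (Y : set (PP R[i] n)),
      projective_variety Y /\ triangulated_equivalent (DbCoh Y) (FS R[i]).
Proof. by case=> n [Y [_ [F]]]; exact: no_equivalence F. Qed.
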